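(* Let $p>1$ and let $\mathcal{M}$ be a maximal ideal of the commutative ring (algebra) $F^p$. Then the following statements about $\mathcal{M}$ are equivalent: (i) $\mathcal{M}$ is closed with respect to the topology of uniform convergence on compact subsets of $\mathbb{D}$; (ii) $F^p/\mathcal{M}\cong \mathbb{C}$; (iii) there exists $\lambda\in\mathbb{D}$ such that $\mathcal{M}=\mathcal{M}_\lambda:=\{f\in F^p : f(\lambda)=0\}$; (iv) $\mathcal{M}$ is a closed ideal in $F^p$ with respect to the topology induced on $F^p$ by the family of seminorms $\{\|\cdot\|_{p,c}\}_{c>0}$, where for $f(z)=\sum_{n=0}^\infty a_n z^n$, $$\|f\|_{p,c}=\sum_{n=0}^{\infty}|a_n|\exp\left(-c\,n^{1/(p+1)}\right);$$ (v) $\mathcal{M}$ is a closed ideal in $F^p$ with respect to the topology induced on $F^p$ by the family of seminorms $\{|\|\cdot\||_{p,c}\}_{c>0}$, where $$|\|f\||_{p,c}=\int_0^1 \exp\left(-c(1-r)^{-1/p}\right) M_p(r,f)\,dr,\qquad M_p(r,f)=\left(\int_0^{2\pi}|f(re^{i\theta})|^p\,\frac{d\theta}{2\pi}\right)^{1/p}.$$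
   Context: $\mathbb{D}$ denotes the open unit disk in $\mathbb{C}$. For $1<p<\infty$, $F^p$ is the set of all holomorphic functions $f$ on $\mathbb{D}$ such that $\lim_{r\to 1}(1-r)^{1/p}\log^+ M_\infty(r,f)=0$, where $M_\infty(r,f)=\max_{|z|\le r}|f(z)|$ for $0<r<1$ and $\log^+ x=\max\{\log x,0\}$. $F^p$ is a commutative algebra with identity under pointwise addition and multiplication. For $f\in F^p$ with Taylor series $f(z)=\sum_{n\ge 0}a_nz^n$, the quantities $\|f\|_{p,c}$ (for every $c>0$) are finite, so the seminorms in (iv) are well defined on $F^p$; the seminorms in (v) are also defined on $F^p$. *)

(* Defs.v *)
From HB Require Import structures.
From mathcomp Require Import all_boot all_order all_algebra.
From mathcomp Require Import all_classical all_reals all_analysis.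
From mathcomp Require Import ring_quotient complex lra.
Set Implicit Arguments.
Unset Strict Implicit.
Unset Printing Implicit Defensive.
Import Order.TTheory GRing.Theory Num.Theory numFieldNormedType.Exports.
Local Open Scope classical_set_scope.
Local Open Scope ring_scope.

(* The complex numbers, packaged as a numClosedFieldType so that they carry the
   norm, the topology and the module structure over themselves. *)
Definition Cplx (R : realType) : numClosedFieldType := R[i].

(* `|z| lives in [Cplx R]; [modulus z] is the same number as an element of [R]. *)
Definition modulus (R : realType) (z : Cplx R) : R := complex.Re `|z|.
Arguments modulus {R} z.

Definition disk (R : realType) : set (Cplx R) := [set z | modulus z < 1].

Arguments disk : clear implicits.

Section modulus.
Variable R : realType.
Implicit Types z w : Cplx R.

Lemma modulusE z : `|z| = (modulus z)%:C%C.
Proof. by rewrite /modulus normc_def. Qed.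

Lemma modulus_ge0 z : 0 <= modulus z.
Proof. by rewrite -ler0c -modulusE normr_ge0. Qed.

Lemma modulusM z w : modulus (z * w) = modulus z * modulus w.
Proof. by apply: complexI; rewrite rmorphM -!modulusE normrM. Qed.

Lemma modulusN z : modulus (- z) = modulus z.
Proof. by rewrite /modulus normrN. Qed.

Lemma modulusB_le z w : modulus (z - w) <= modulus z + modulus w.
Proof. by rewrite -lecR rmorphD -!modulusE ler_normB. Qed.

Lemma modulusD_le z w : modulus (z + w) <= modulus z + modulus w.
Proof. by rewrite -lecR rmorphD -!modulusE ler_normD. Qed.

Lemma modulus_dist z w : `|modulus z - modulus w| <= modulus (z - w).
Proof.
have h (x y : Cplx R) : modulus x <= modulus y + modulus (x - y).
  by have := modulusD_le y (x - y); rewrite [y + _]addrC subrK.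
rewrite ler_norml; have := h z w; have := h w z.
rewrite -(modulusN (w - z)) opprB; lra.
Qed.

Lemma disk0 : (0 : Cplx R) \in disk R.
Proof. by rewrite inE /disk /= /modulus normr0 /= ltr01. Qed.

Lemma continuous_modulus : continuous (@modulus R).
Proof.
move=> z; apply/(@cvgrPdist_lt _ _ _ (nbhs z)) => e e0; near=> w.
rewrite (le_lt_trans (modulus_dist _ _))// -ltcR -modulusE.
near: w; apply: (@nbhsx_ballx _ _ z e%:C%C); by rewrite ltcR.
Unshelve. all: by end_near. Qed.

Lemma open_disk : open (disk R).
Proof.
rewrite (_ : disk R = modulus @^-1` [set x | x < 1])//.
by apply: open_comp => [z _|]; [exact: continuous_modulus|exact: open_lt].
Qed.

Lemma compact_modulus_le (r : R) : compact [set z : Cplx R | modulus z <= r].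
Proof.
pose g (x : R * R) : Cplx R := (x.1 +i* x.2)%C.
have gE x y : modulus (g x - g y) <= `|x.1 - y.1| + `|x.2 - y.2|.
  rewrite /modulus normc_def /=.
  rewrite -[leRHS]ger0_norm ?addr_ge0// -sqrtr_sqr ler_wsqrtr//.
  rewrite [leRHS]sqrrD !real_normK ?num_real// lerD2r lerDl.
  by rewrite mulrn_wge0// mulr_ge0.
have gc : continuous g.
  move=> x; apply/cvgrPdist_lt => e e0.
  have ee : e = (complex.Re e)%:C%C by case: (e) e0 => a b /[!ltcE]/= /andP[/eqP->].
  near=> y.
  rewrite ee modulusE ltcR (le_lt_trans (gE _ _))//.
  rewrite (splitr (complex.Re e)) ltrD//; near: y.
    have : (fst y @[y --> x]) --> x.1 by exact: cvg_fst.
    by move/cvgrPdist_lt; apply; rewrite divr_gt0// -ltcR -ee.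
  have : (snd y @[y --> x]) --> x.2 by exact: cvg_snd.
  by move/cvgrPdist_lt; apply; rewrite divr_gt0// -ltcR -ee.
have cK : compact (g @` (`[-r, r]%classic `*` `[-r, r]%classic)).
  apply: continuous_compact; first exact: continuous_subspaceT.
  by apply: compact_setX; exact: segment_compact.
apply: (subclosed_compact _ cK).
  rewrite (_ : mkset _ = modulus @^-1` [set x | x <= r])//.
  by apply: closed_comp => [z _|]; [exact: continuous_modulus|exact: closed_le].
move=> z /= zr; exists (complex.Re z, complex.Im z); last by case: z {zr}.
have : `|complex.Re z| <= r /\ `|complex.Im z| <= r.
  split; apply: le_trans zr; rewrite /modulus normc_def/= -sqrtr_sqr ler_wsqrtr//.
  by rewrite lerDl sqr_ge0.
  by rewrite lerDr sqr_ge0.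
by rewrite !ler_norml /= !in_itv /=.
Unshelve. all: by end_near. Qed.

End modulus.

HB.instance Definition _ (R : realType) :=
  isPointed.Build (disk R) (exist _ 0 (disk0 R)).

Section growth.
Variable R : realType.
Implicit Types f g : disk R -> Cplx R.

(* Functions on the disk are functions on the subtype [disk R], so that they are
   determined by their values on the disk. [ext f] prolongs f by 0 to the whole
   plane; only its values, and its germs, at points of the disk are relevant. *)
Definition ext f : Cplx R -> Cplx R := 'valL_0 f.

Definition holomorphic f := forall z, disk R z -> derivable (ext f) z 1.

Definition M_infty f (r : R) : R :=
  sup [set modulus (f z) | z in [set z : disk R | modulus (val z) <= r]].

(* ln x = 0 for x <= 0 in the library, so that logp 0 = 0 as expected. *)
Definition logp (x : R) : R := Num.max (ln x) 0.

Definition Fp_set (p : R) : set (disk R -> Cplx R) :=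
  [set f | holomorphic f /\
    (1 - r) `^ p^-1 * logp (M_infty f r) @[r --> 1^'-] --> 0].

Lemma extE f (z : disk R) : ext f (val z) = f z.
Proof. by have := congr1 (fun h => h z) (@valLK _ _ 0 (disk R) f). Qed.

Lemma extB f g : ext (f - g) = ext f - ext g.
Proof.
apply/funext => z; rewrite /ext /valL_ /= oinv_set_val !fctE /=.
by case: insub => //=; rewrite subr0.
Qed.

Lemma extM f g : ext (f * g) = ext f * ext g.
Proof.
apply/funext => z; rewrite /ext /valL_ /= oinv_set_val !fctE /=.
by case: insub => //=; rewrite mulr0.
Qed.

Lemma holomorphic_cst (k : Cplx R) : holomorphic (cst k).
Proof.
move=> z zD; apply: (@near_eq_derivable _ _ _ (cst k)) => //.
  apply: filterS (open_disk zD) => w /mem_set wD.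
  exact/esym/(extE (cst k) (exist _ w wD)).
Qed.

Lemma holomorphicB f g : holomorphic f -> holomorphic g -> holomorphic (f - g).
Proof.
by move=> hf hg z zD; rewrite extB; apply: derivableB; [exact: hf|exact: hg].
Qed.

Lemma holomorphicM f g : holomorphic f -> holomorphic g -> holomorphic (f * g).
Proof.
by move=> hf hg z zD; rewrite extM; apply: derivableM; [exact: hf|exact: hg].
Qed.

Lemma M_infty_has_sup f r : holomorphic f -> 0 <= r < 1 ->
  has_sup [set modulus (f z) | z in [set z : disk R | modulus (val z) <= r]].
Proof.
move=> hf /andP[r0 r1]; split.
  by exists (modulus (f point)), point => //=; rewrite /modulus normr0.
have cfK : compact ((modulus \o ext f) @` [set z : Cplx R | modulus z <= r]).
  apply: continuous_compact (@compact_modulus_le R r).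
  apply: continuous_in_subspaceT => z /set_mem /= zr.
  apply: continuous_comp; last exact: continuous_modulus.
  apply: differentiable_continuous; apply/derivable1_diffP.
  by apply: hf; exact: le_lt_trans zr r1.
have [B [_ /(_ (B + 1))]] := compact_bounded cfK.
rewrite ltrDl => /(_ ltr01) hB.
exists (B + 1) => _ [z /= zr <-]; rewrite -[leLHS]ger0_norm ?modulus_ge0//.
by apply: hB; exists (val z) => //=; rewrite extE.
Qed.

Lemma M_infty_ub f r (z : disk R) : holomorphic f -> 0 <= r < 1 ->
  modulus (val z) <= r -> modulus (f z) <= M_infty f r.
Proof.
move=> hf r01 zr; apply: ub_le_sup; last by exists z.
by have [] := M_infty_has_sup hf r01.
Qed.

Lemma M_infty_ge0 f r : holomorphic f -> 0 <= r < 1 -> 0 <= M_infty f r.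
Proof.
move=> hf r01; apply: le_trans (modulus_ge0 (f point)) _.
by apply: M_infty_ub => //=; rewrite /modulus normr0; case/andP: r01.
Qed.

Lemma M_infty_le f r x : holomorphic f -> 0 <= r < 1 ->
  (forall z : disk R, modulus (val z) <= r -> modulus (f z) <= x) ->
  M_infty f r <= x.
Proof.
move=> hf r01 fx; apply: ge_sup; first by have [] := M_infty_has_sup hf r01.
by move=> _ [z /= zr <-]; exact: fx.
Qed.

Lemma M_inftyM f g r : holomorphic f -> holomorphic g -> 0 <= r < 1 ->
  M_infty (f * g) r <= M_infty f r * M_infty g r.
Proof.
move=> hf hg r01; apply: (M_infty_le (holomorphicM hf hg) r01) => z zr.
rewrite modulusM; apply: ler_pM; rewrite ?modulus_ge0//; exact: M_infty_ub.
Qed.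

Lemma M_inftyB f g r : holomorphic f -> holomorphic g -> 0 <= r < 1 ->
  M_infty (f - g) r <= M_infty f r + M_infty g r.
Proof.
move=> hf hg r01; apply: (M_infty_le (holomorphicB hf hg) r01) => z zr.
apply: le_trans (modulusB_le _ _) _; apply: lerD; exact: M_infty_ub.
Qed.

Lemma logp_ge0 x : 0 <= logp x.
Proof. by rewrite le_max lexx orbT. Qed.

Lemma le_logp : {homo logp : x y / x <= y}.
Proof.
move=> x y xy; rewrite /logp ge_max logp_ge0 andbT le_max.
have [x0|x0] := leP x 0; first by rewrite ln0// lexx orbT.
by rewrite ler_ln ?posrE ?xy// (lt_le_trans x0).
Qed.

Lemma logpM x y : 0 <= x -> 0 <= y -> logp (x * y) <= logp x + logp y.
Proof.
rewrite le_eqVlt => /predU1P[<- _|x0].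
  by rewrite mul0r lerDl logp_ge0.
rewrite le_eqVlt => /predU1P[<-|y0].
  by rewrite mulr0 lerDr logp_ge0.
rewrite {1}/logp ge_max addr_ge0 ?logp_ge0// andbT lnM ?posrE//.
by rewrite lerD// /logp le_max lexx.
Qed.

Lemma logpD x y : 0 <= x -> 0 <= y -> logp (x + y) <= logp x + logp y + ln 2.
Proof.
have ln2 : logp 2 = ln 2 :> R by apply/max_idPl; rewrite ln_ge0// ler1n.
wlog : x y / x <= y => [h x0 y0|xy x0 y0].
  have [xy|yx] := leP x y; first exact: h.
  by rewrite addrC [logp x + _]addrC; apply: h => //; exact: ltW.
rewrite -ln2 (@le_trans _ _ (logp (y * 2)))//.
  by rewrite le_logp// mulr_natr mulr2n lerD2r.
by rewrite (le_trans (logpM _ _))// lerD2r lerDr logp_ge0.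
Qed.

Lemma near_left1 : \forall r \near (1 : R)^'-, 0 <= r < 1.
Proof.
near=> r; apply/andP; split; near: r; last exact: nbhs_left_lt.
by apply: nbhs_left_ge; exact: ltr01.
Unshelve. all: by end_near. Qed.

Lemma cvg_powR_left1 (p k : R) : 0 < p ->
  (1 - r) `^ p^-1 * k @[r --> 1^'-] --> 0.
Proof.
move=> p0; rewrite -[X in _ --> X](mul0r k); apply: cvgMl.
apply/cvgrPdist_lt => e e0; near=> r.
have r1 : 0 < 1 - r by rewrite subr_gt0; near: r; exact: nbhs_left_lt.
rewrite sub0r normrN ger0_norm ?powR_ge0//.
have -> : e = (e `^ p) `^ p^-1 by rewrite -powRrM mulfV ?gt_eqF// powRr1// ltW.
rewrite gt0_ltr_powR ?invr_gt0 ?nnegrE ?powR_ge0//; first exact: ltW.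
rewrite ltrBlDr -ltrBlDl; near: r; apply: nbhs_left_gt.
by rewrite ltrBlDr ltrDl powR_gt0.
Unshelve. all: by end_near. Qed.

Lemma growth_squeeze (p : R) (u v : R -> R) :
  (\forall r \near (1 : R)^'-, 0 <= u r <= v r) ->
  (1 - r) `^ p^-1 * v r @[r --> 1^'-] --> 0 ->
  (1 - r) `^ p^-1 * u r @[r --> 1^'-] --> 0.
Proof.
move=> uv v0; apply: (squeeze_cvgr _ _ v0); last exact: (cvg_cst 0).
apply: filterS uv => r /andP[u0 uv].
by rewrite mulr_ge0 ?powR_ge0//= ler_wpM2l ?powR_ge0.
Qed.

Lemma growthD (p : R) (u v : R -> R) :
  (1 - r) `^ p^-1 * u r @[r --> 1^'-] --> 0 ->
  (1 - r) `^ p^-1 * v r @[r --> 1^'-] --> 0 ->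
  (1 - r) `^ p^-1 * (u r + v r) @[r --> 1^'-] --> 0.
Proof.
move=> u0 v0; under eq_fun do rewrite mulrDr.
by have := cvgD u0 v0; rewrite addr0; exact.
Qed.

Variables (p : R) (p_gt1 : 1 < p).
Let p_gt0 : 0 < p. Proof. exact: lt_trans p_gt1. Qed.

Lemma Fp_set_cst (k : Cplx R) : Fp_set p (cst k).
Proof.
split; first exact: holomorphic_cst.
apply: growth_squeeze (cvg_powR_left1 (logp (modulus k)) p_gt0).
apply: filterS near_left1 => r r01; rewrite logp_ge0 /=.
by apply: le_logp; apply: (M_infty_le (@holomorphic_cst k) r01) => z _.
Qed.

Lemma Fp_setB f g : Fp_set p f -> Fp_set p g -> Fp_set p (f - g).
Proof.
move=> [hf f0] [hg g0]; split; first exact: holomorphicB.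
pose v r := logp (M_infty f r) + logp (M_infty g r) + ln 2.
apply: (@growth_squeeze p _ v).
  apply: filterS near_left1 => r r01; rewrite logp_ge0/=.
  rewrite (le_trans (le_logp (M_inftyB hf hg r01)))//.
  by apply: logpD; exact: M_infty_ge0.
by apply: growthD (cvg_powR_left1 _ p_gt0); exact: growthD.
Qed.

Lemma Fp_setM f g : Fp_set p f -> Fp_set p g -> Fp_set p (f * g).
Proof.
move=> [hf f0] [hg g0]; split; first exact: holomorphicM.
apply: (@growth_squeeze p _ (fun r => logp (M_infty f r) + logp (M_infty g r))).
  apply: filterS near_left1 => r r01; rewrite logp_ge0/=.
  rewrite (le_trans (le_logp (M_inftyM hf hg r01)))//.
  by apply: logpM; exact: M_infty_ge0.
exact: growthD.
Qed.

End growth.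

Section Fp.
Variables (R : realType) (p : R) (p_gt1 : 1 < p).

(* The proof of 1 < p is an argument of [Fp], as F^p is not a ring for p <= 0. *)
Definition Fp_pred of 1 < p : {pred disk R -> Cplx R} := mem (Fp_set p).

Lemma Fp_subring_closed : subring_closed (Fp_pred p_gt1).
Proof.
split=> [|f g|f g]; rewrite !inE; first exact: Fp_set_cst.
- exact: Fp_setB.
- exact: Fp_setM.
Qed.

Lemma Fp_scaler_closed : scaler_closed (Fp_pred p_gt1).
Proof. by move=> k f; rewrite !inE; apply: Fp_setM; exact: Fp_set_cst. Qed.

HB.instance Definition _ := GRing.isSubringClosed.Build _ (Fp_pred p_gt1)
  Fp_subring_closed.
HB.instance Definition _ := GRing.isScaleClosed.Build _ _ (Fp_pred p_gt1)
  Fp_scaler_closed.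

Record Fp := MkFp {
  Fp_fun :> disk R -> Cplx R ;
  _ : Fp_fun \in Fp_pred p_gt1 }.

HB.instance Definition _ := [isSub for Fp_fun].
HB.instance Definition _ := [Choice of Fp by <:].
HB.instance Definition _ := [SubChoice_isSubComNzRing of Fp by <:].
HB.instance Definition _ := [SubZmodule_isSubLmodule of Fp by <:].

Lemma Fp_scalerAl (k : Cplx R) (f g : Fp) : k *: (f * g) = k *: f * g.
Proof. by apply/val_inj/funext => z; exact: mulrA. Qed.

HB.instance Definition _ := GRing.Lmodule_isLalgebra.Build _ Fp Fp_scalerAl.
HB.instance Definition _ := GRing.Lalgebra_isComAlgebra.Build _ Fp.
End Fp.

Definition maximal_ideal (A : comNzRingType) (M : idealr A) : Prop :=
  forall J : idealr A, {subset M <= J} -> J =i M.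

Section seminorms.
Variable R : realType.
Implicit Types f : disk R -> Cplx R.

Definition taylor_coef f (n : nat) : Cplx R := derive1n n (ext f) 0 / n`!%:R.

(* Both seminorms are given with values in \bar R, so that no convergence or
   integrability hypothesis is built into their definition. *)
Definition coef_seminorm (p c : R) f : \bar R :=
  (\sum_(0 <= n <oo)
     (modulus (taylor_coef f n) * expR (- (c * n%:R `^ (p + 1)^-1)))%:E)%E.

Definition M_mean (p : R) f (r : R) : \bar R :=
  (((2 * pi)^-1%:E *
    \int[lebesgue_measure]_(t in `[0%R, (2 * pi)%R])
      (modulus (ext f (r * cos t +i* (r * sin t))%C) `^ p)%:E) `^ p^-1)%E.

Definition mean_seminorm (p c : R) f : \bar R :=
  (\int[lebesgue_measure]_(r in `[0%R, 1%R[)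
     ((expR (- (c * (1 - r) `^ (- p^-1))))%:E * M_mean p f r))%E.

End seminorms.

(* The topology on V induced by a family N of seminorms: U is open when around
   each of its points it contains a ball for finitely many of them. *)
Definition seminorm_topology (R : realType) (V : zmodType) (I : choiceType)
  (N : I -> V -> \bar R) : Type := V.

Section seminorm_topology.
Variables (R : realType) (V : zmodType) (I : choiceType) (N : I -> V -> \bar R).
Local Notation T := (seminorm_topology N).

Definition seminorm_open : set_system T := [set U | forall f : V, U f ->
  exists (s : seq I) (e : R), 0 < e /\
    forall g : V, (forall i, i \in s -> (N i (g - f) < e%:E)%E) -> U g].

Lemma seminorm_openT : seminorm_open setT.
Proof. by move=> f _; exists [::], 1; split. Qed.

Lemma seminorm_openI : setI_closed seminorm_open.
Proof.
move=> A B oA oB f [/oA[s [d [d0 sA]]] /oB[t [e [e0 tB]]]].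
exists (s ++ t), (Num.min d e); split; first by rewrite lt_min d0.
move=> g fg; split; [apply: sA|apply: tB] => i hi;
  apply: lt_le_trans (fg i _) _; rewrite ?mem_cat ?hi ?orbT//;
  by rewrite lee_fin ge_min lexx ?orbT.
Qed.

Lemma seminorm_open_bigU (J : Type) (F : J -> set T) :
  (forall j, seminorm_open (F j)) -> seminorm_open (\bigcup_j F j).
Proof.
move=> oF f [j _ /oF[s [e [e0 sF]]]]; exists s, e; split=> // g /sF Fg.
by exists j.
Qed.

HB.instance Definition _ := Choice.copy T V.
HB.instance Definition _ := isOpenTopological.Build T
  seminorm_openT seminorm_openI seminorm_open_bigU.

End seminorm_topology.

Section topologies.
Variables (R : realType) (p : R) (p_gt1 : 1 < p).

(* F^p as a subspace of the functions on the disk with uniform convergence on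
   the compact subsets of the disk *)
Definition Fp_compact_topology : Type :=
  initial_topology (@Fp_fun R p p_gt1 : _ -> {family compact, disk R -> Cplx R}).
HB.instance Definition _ := Topological.on Fp_compact_topology.

Definition Fp_coef_topology : Type := seminorm_topology
  (fun (c : {posnum R}) (f : Fp p_gt1) => coef_seminorm p c%:num f).
HB.instance Definition _ := Topological.on Fp_coef_topology.

Definition Fp_mean_topology : Type := seminorm_topology
  (fun (c : {posnum R}) (f : Fp p_gt1) => mean_seminorm p c%:num f).
HB.instance Definition _ := Topological.on Fp_mean_topology.

End topologies.

(* Main.v *)
Require Import Defs.
From HB Require Import structures.
From mathcomp Require Import all_boot all_order all_algebra.
From mathcomp Require Import all_classical all_reals all_analysis.
From mathcomp Require Import ring_quotient complex ring lra.
Import Order.TTheory GRing.Theory Num.Theory numFieldNormedType.Exports.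
Set Implicit Arguments.
Unset Strict Implicit.
Unset Printing Implicit Defensive.
Local Open Scope classical_set_scope.
Local Open Scope ring_scope.

(* The topology (iv) of the coefficient seminorms N_c is the finest of the three:
   the suprema over compact subsets of the disk and the mean seminorms are bounded
   by multiples of coefficient seminorms, so a maximal ideal M closed in (i) or in
   (v) is closed in (iv).  The algebra F^p is complete for the N_c, which satisfy
   N_c (f g) <= N_{c/2} f * N_{c/2} g.  If M is closed in (iv), a Gelfand-Mazur
   argument shows that z - l is in M for some complex l: otherwise z - l would be
   invertible modulo M for every l, and the averages of its inverse over the circle
   |l| = s, discretised over roots of unity, would not depend on s, although they
   tend to 0 at infinity and are the inverse of z at s = 0.  As z - l is a unit of
   F^p for |l| >= 1, the point l is in the disk, and as f - f(l) is divisible by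
   z - l in F^p, M is the kernel of the evaluation at l.  This kernel is closed in
   (i), and in (v) because Cauchy's formula on the circles |z| = s, |l| < s < 1,
   bounds f(l) by a mean seminorm of f.  The Taylor expansion of holomorphic
   functions comes from Goursat's lemma on rectangles pulled back by exp. *)

(** * Complex derivatives *)

(** What is missing compared with a Banach algebra is submultiplicativity: a product halves the
    index c, so a geometric series in an element need not converge and resolvents modulo M are not
    obviously bounded. Completeness replaces it, through infinite products whose factors tend to 1
    as fast as required. Estimates on the quotient by M are made on representatives and only for
    finite sums, which is why roots of unity stand in for a vector-valued integral. The exponent
    1/(p+1) balances two growths. With t = n^(1/(p+1)) and 1 - r = d t^(-p), both n (1 - r) and (1 -
    r)^(-1/p) are multiples of t. Cauchy's estimate at that radius thus turns the growth condition
    of F^p into the decay measured by exp(-c t); conversely, for fixed c, the maximum over n of c t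
    - n (1 - r) is at most a multiple of (1 - r)^(-1/p). In (ii) the isomorphism is linear over the
    complex numbers: it sends the class of z to some l, and z - l is then in M. *)

Section modulus_theory.
Variable R : realType.
Local Notation C := (Cplx R).
Implicit Types z w : C.

Lemma modulus0 : modulus (0 : C) = 0.
Proof. by rewrite /modulus normr0. Qed.

Lemma modulus1 : modulus (1 : C) = 1.
Proof. by rewrite /modulus normr1. Qed.

Lemma modulus_eq0 z : (modulus z == 0) = (z == 0).
Proof. by rewrite -(normr_eq0 z) modulusE -(inj_eq (@complexI R)). Qed.

Lemma modulus_gt0 z : (0 < modulus z) = (z != 0).
Proof. by rewrite lt_def modulus_eq0 modulus_ge0 andbT. Qed.

Lemma modulusX z n : modulus (z ^+ n) = modulus z ^+ n.
Proof. by elim: n => [|n IH]; rewrite ?expr0 ?modulus1// !exprS modulusM IH. Qed.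

Lemma modulusV z : modulus z^-1 = (modulus z)^-1.
Proof.
have [->|z0] := eqVneq z 0; first by rewrite invr0 modulus0 invr0.
by apply: (mulfI (x := modulus z)); rewrite ?modulus_eq0// -modulusM !divff ?modulus1 ?modulus_eq0.
Qed.

Lemma modulus_real (r : R) : modulus (r%:C%C : C) = `|r|.
Proof.
by rewrite /modulus normc_def /= expr0n /= addr0 sqrtr_sqr.
Qed.

Lemma modulus_natr n : modulus (n%:R : C) = n%:R.
Proof. by rewrite -(rmorph_nat (@real_complex R)) modulus_real ger0_norm. Qed.

Lemma modulus_sum (I : Type) (s : seq I) (P : pred I) (F : I -> C) :
  modulus (\sum_(i <- s | P i) F i) <= \sum_(i <- s | P i) modulus (F i).
Proof.
elim/big_ind2: _ => [|x1 x2 y1 y2 h1 h2|//]; first by rewrite modulus0.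
by rewrite (le_trans (modulusD_le _ _))// lerD.
Qed.

Lemma modulusBC z w : modulus (z - w) = modulus (w - z).
Proof. by rewrite -modulusN opprB. Qed.

Lemma modulus_tri w z u : modulus (z - u) <= modulus (z - w) + modulus (w - u).
Proof. by have := modulusD_le (z - w) (w - u); rewrite addrA subrK. Qed.

Lemma Re_le_modulus z : `|complex.Re z| <= modulus z.
Proof. by rewrite /modulus normc_def/= -sqrtr_sqr ler_wsqrtr// lerDl sqr_ge0. Qed.

Lemma Im_le_modulus z : `|complex.Im z| <= modulus z.
Proof. by rewrite /modulus normc_def/= -sqrtr_sqr ler_wsqrtr// lerDr sqr_ge0. Qed.

Lemma modulus_le_ReIm z : modulus z <= `|complex.Re z| + `|complex.Im z|.
Proof.
rewrite /modulus normc_def /=.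
rewrite -[leRHS]ger0_norm ?addr_ge0// -sqrtr_sqr ler_wsqrtr//.
rewrite [leRHS]sqrrD !real_normK ?num_real// lerD2r lerDl.
by rewrite mulrn_wge0// mulr_ge0.
Qed.

Lemma modulus_nbhsP z (P : set C) :
  nbhs z P <-> exists2 d : R, 0 < d & forall w, modulus (w - z) < d -> P w.
Proof.
split=> [/nbhs_normP[e /= e0 zP]|[d d0 zP]].
  have ee : e = (complex.Re e)%:C%C by case: (e) e0 => a b /[!ltcE]/= /andP[/eqP->].
  exists (complex.Re e); first by rewrite -ltcR -ee.
  by move=> w wz; apply: zP; rewrite /= ee distrC modulusE ltcR.
apply/nbhs_normP; exists d%:C%C; first by rewrite /= ltcR.
by move=> w /=; rewrite distrC modulusE ltcR; exact: zP.
Qed.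

Lemma modulus_dnbhsP z (P : set C) :
  z^' P <-> exists2 d : R, 0 < d &
              forall w, w != z -> modulus (w - z) < d -> P w.
Proof.
split; first by move=> /modulus_nbhsP[d d0 h]; exists d => // w ? ?; exact: h.
by move=> [d d0 h]; apply/modulus_nbhsP; exists d => // w ? ?; exact: h.
Qed.

Lemma modulus_cvgP (T : Type) (F : set_system T) (f : T -> C) z : Filter F ->
  f @ F --> z <-> forall e : R, 0 < e -> \forall t \near F, modulus (f t - z) < e.
Proof.
move=> FF; split=> [fz e e0|fz P /modulus_nbhsP[d d0 dP]].
  have /fz : nbhs z [set w | modulus (w - z) < e].
    by apply/modulus_nbhsP; exists e.
  exact.
by apply: filterS (fz d d0) => t /= /dP.
Qed.

(** A division-free form of differentiability with all estimates in [R]; it includes w = z, so it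
    composes and passes to sums without case distinctions. *)
Definition cderiv (f : C -> C) z d := forall e : R, 0 < e -> exists2 d' : R, 0 < d' &
  forall w, modulus (w - z) < d' ->
    modulus (f w - f z - d * (w - z)) <= e * modulus (w - z).

Lemma cderivP (f : C -> C) z d :
  cderiv f z d <-> derivable f z 1 /\ derive1 f z = d.
Proof.
pose q h : C := h^-1 *: (f (h + z) - f z).
have qE : (fun h : C => h^-1 *: ((f \o shift z) (h *: (1 : C)) - f z)) = q.
  by apply/funext => h; rewrite /q /= [h%:A]mulr1.
have qP : cderiv f z d <-> q h @[h --> 0^'] --> d.
  split=> [fd|].
    apply/modulus_cvgP => e e0; apply/modulus_dnbhsP.
    have [d' d'0 fd'] := fd (e / 2) (divr_gt0 e0 (ltr0Sn _ _)).
    exists d' => // w w0; rewrite subr0 => wd; rewrite /q.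
    have := fd' (w + z); rewrite addrK => /(_ wd) fw.
    rewrite (_ : _ - d = w^-1 * (f (w + z) - f z - d * w)); last first.
      by rewrite [in RHS]mulrBr mulrCA mulVf// mulr1.
    rewrite modulusM modulusV ltr_pdivrMl ?modulus_gt0//.
    rewrite (le_lt_trans fw)// mulrC ltr_pM2l ?modulus_gt0//; lra.
  move/modulus_cvgP => fd e /fd /modulus_dnbhsP[d' d'0 fd']; exists d' => // w wz.
  have [->|wNz] := eqVneq w z; first by rewrite !subrr mulr0 subrr modulus0 mulr0.
  have wz0 : w - z != 0 by rewrite subr_eq0.
  have := fd' (w - z) wz0; rewrite subr0 => /(_ wz); rewrite /q subrK => /ltW fw.
  rewrite (_ : _ - _ = (w - z) * ((w - z)^-1 * (f w - f z) - d)); last first.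
    by rewrite [in RHS]mulrBr mulVKf// [in LHS](mulrC d).
  by rewrite modulusM mulrC ler_wpM2r ?modulus_ge0.
rewrite qP /derivable qE /derive1; split => [qd|[fq <-]//].
by split; [apply/cvg_ex; exists d|apply/cvg_lim].
Qed.

Lemma derivable_cderiv (f : C -> C) z :
  derivable f z 1 -> cderiv f z (derive1 f z).
Proof. by move=> fz; apply/cderivP. Qed.

Lemma cderiv_near (f g : C -> C) z d : (\forall w \near z, f w = g w) ->
  cderiv f z d -> cderiv g z d.
Proof.
move=> /[dup] /nbhs_singleton fgz /modulus_nbhsP[d1 d10 fg] fd e /fd[d2 d20 h].
exists (Num.min d1 d2) => [|w]; first by rewrite lt_min d10.
by rewrite lt_min => /andP[/fg w1 /h]; rewrite w1 fgz.
Qed.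

Lemma cderiv_cvg (f : C -> C) z d : cderiv f z d -> f w @[w --> z] --> f z.
Proof.
move=> fd; apply/(@modulus_cvgP _ (nbhs z)) => e e0; apply/modulus_nbhsP.
have [d1 d10 h] := fd 1 ltr01.
have D0 : 0 < 1 + modulus d by rewrite ltr_pwDl ?modulus_ge0.
exists (Num.min d1 (e / (1 + modulus d))) => [|w]; first by rewrite lt_min d10 divr_gt0.
rewrite lt_min => /andP[/h wd we].
rewrite -[_ - _](subrK (d * (w - z))) (le_lt_trans (modulusD_le _ _))//.
rewrite (le_lt_trans (lerD wd (lexx _)))// modulusM -mulrDl mulrC.
by rewrite -ltr_pdivlMr.
Qed.

Lemma cderiv_comp (f g : C -> C) z a b : cderiv g z a -> cderiv f (g z) b ->
  cderiv (f \o g) z (b * a).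
Proof.
move=> ga fb e e0.
(* The cap at 1 makes g Lipschitz at z with constant 1 + |a|; the other bound keeps b times the
   error of g below half of the target. *)
pose e1 := Num.min 1 (e / (2 * (1 + modulus b))).
have b0 : 0 < 1 + modulus b by rewrite ltr_pwDl ?modulus_ge0.
have a0 : 0 < 1 + modulus a by rewrite ltr_pwDl ?modulus_ge0.
have e10 : 0 < e1 by rewrite lt_min ltr01 divr_gt0// mulr_gt0.
have [d1 d10 h1] := ga e1 e10.
pose e2 := e / (2 * (1 + modulus a)).
have [d2 d20 h2] := fb e2 (divr_gt0 e0 (mulr_gt0 (ltr0Sn _ _) a0)).
exists (Num.min d1 (d2 / (1 + modulus a))) => [|w].
  by rewrite lt_min d10 divr_gt0.
rewrite lt_min => /andP[/h1 wd we].
have gw : modulus (g w - g z) <= (1 + modulus a) * modulus (w - z).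
  rewrite -[_ - _](subrK (a * (w - z))) (le_trans (modulusD_le _ _))//.
  rewrite modulusM mulrDl lerD2r (le_trans wd)// ler_wpM2r ?modulus_ge0//.
  by rewrite /e1 ge_min lexx.
have /h2 fw : modulus (g w - g z) < d2.
  by rewrite (le_lt_trans gw)// mulrC -ltr_pdivlMr.
have -> : (f \o g) w - (f \o g) z - b * a * (w - z) =
    (f (g w) - f (g z) - b * (g w - g z)) + b * (g w - g z - a * (w - z)).
  by rewrite (mulrBr b _ (a * _)) mulrA addrA subrK.
rewrite (le_trans (modulusD_le _ _))// modulusM.
have -> : e * modulus (w - z) = e / 2 * modulus (w - z) + e / 2 * modulus (w - z).
  by rewrite -mulrDl -splitr.
apply: lerD.
  rewrite (le_trans fw)// (le_trans (ler_wpM2l _ gw))//.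
    by rewrite divr_ge0 ?(ltW e0)// mulr_ge0// ltW.
  rewrite mulrA ler_wpM2r ?modulus_ge0// /e2 invfM mulrA -[leLHS]mulrA mulVf ?gt_eqF//.
  by rewrite mulr1.
rewrite (le_trans (ler_wpM2l (modulus_ge0 _) wd))// mulrA ler_wpM2r ?modulus_ge0//.
rewrite (@le_trans _ _ ((1 + modulus b) * e1))//.
  by rewrite ler_wpM2r ?(ltW e10)// lerDr.
rewrite mulrC -ler_pdivlMr// /e1 ge_min; apply/orP; right.
by rewrite invfM mulrA.
Qed.

End modulus_theory.

(** * Limits and continuity of complex-valued functions *)

Section complex_limits.
Variable R : realType.
Local Notation C := (Cplx R).

Section filter.
Variables (T : Type) (F : set_system T) (FF : Filter F).
Implicit Types (f g : T -> C) (a b : C).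

Lemma ccvgD f g a b : f @ F --> a -> g @ F --> b -> (fun t => f t + g t) @ F --> a + b.
Proof. exact: cvgD. Qed.

Lemma ccvgB f g a b : f @ F --> a -> g @ F --> b -> (fun t => f t - g t) @ F --> a - b.
Proof. exact: cvgB. Qed.

Lemma ccvgM f g a b : f @ F --> a -> g @ F --> b -> (fun t => f t * g t) @ F --> a * b.
Proof. exact: cvgM. Qed.

End filter.

Variable T : topologicalType.
Implicit Types (f g : T -> C) (k : C).

Lemma ccontD f g : continuous f -> continuous g -> continuous (fun t => f t + g t).
Proof. by move=> cf cg t; apply: ccvgD; [exact: cf|exact: cg]. Qed.

Lemma ccontB f g : continuous f -> continuous g -> continuous (fun t => f t - g t).
Proof. by move=> cf cg t; apply: ccvgB; [exact: cf|exact: cg]. Qed.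

Lemma ccont_cst k : continuous (fun _ : T => k).
Proof. by move=> t; exact: cvg_cst. Qed.

Lemma ccontZ k f : continuous f -> continuous (fun t => k * f t).
Proof. by move=> cf t; apply: ccvgM; [exact: cvg_cst|exact: cf]. Qed.

End complex_limits.

(** * Power series *)

Section power_series.
Variable R : realType.
Local Notation C := (Cplx R).
Implicit Types (z w : C) (a b : nat -> C).

Lemma modulus_limit_le (x : C) (u : nat -> C) (B : R) :
  (forall e, 0 < e -> exists2 n, modulus (x - u n) <= e & modulus (u n) <= B) ->
  modulus x <= B.
Proof.
move=> h; apply/ler_addgt0Pr => e /h[n xn un].
by rewrite -[x](subrK (u n)) (le_trans (modulusD_le _ _))// addrC lerD.
Qed.

Lemma cauchy_real (u : nat -> R) :
  (forall e, 0 < e -> exists N, forall n, (N <= n)%N -> `|u n - u N| <= e) ->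
  cvgn u.
Proof.
move=> h; apply/cauchy_cvgP/cauchy_exP => e e0.
have [N hN] := h (e / 2) (divr_gt0 e0 (ltr0Sn _ _)).
exists (u N); exists N => // n /= /hN; rewrite distrC /ball /=.
by move=> /le_lt_trans; apply; lra.
Qed.

Lemma cauchy_complex (u : nat -> C) :
  (forall e, 0 < e -> exists N, forall n, (N <= n)%N -> modulus (u n - u N) <= e) ->
  exists l : C, forall e, 0 < e ->
    exists N, forall n, (N <= n)%N -> modulus (u n - l) <= e.
Proof.
move=> h.
have cRe : cvgn (fun n => complex.Re (u n)).
  apply: cauchy_real => e /h[N hN]; exists N => n /hN; apply: le_trans.
  by rewrite (le_trans _ (Re_le_modulus _))//; case: (u n) (u N) => [? ?] [? ?].
have cIm : cvgn (fun n => complex.Im (u n)).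
  apply: cauchy_real => e /h[N hN]; exists N => n /hN; apply: le_trans.
  by rewrite (le_trans _ (Im_le_modulus _))//; case: (u n) (u N) => [? ?] [? ?].
exists (limn (fun n => complex.Re (u n)) +i* limn (fun n => complex.Im (u n)))%C.
move=> e e0; have e20 : 0 < e / 2 by rewrite divr_gt0.
move: cRe cIm => /cvgrPdist_le/(_ _ e20)[N1 _ h1] /cvgrPdist_le/(_ _ e20)[N2 _ h2].
exists (maxn N1 N2) => n; rewrite geq_max => /andP[/h1 /= n1 /h2 /= n2].
rewrite (le_trans (modulus_le_ReIm _))// (splitr e); case: (u n) n1 n2 => x y /=.
by rewrite distrC => n1; rewrite distrC => n2; exact: lerD.
Qed.

(** Radius of convergence at least 1, expressed by boundedness of the terms at each smaller radius
    instead of an upper limit of roots. *)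
Definition radius_ge1 a := forall r : R, 0 <= r < 1 ->
  exists B, forall n, modulus (a n) * r ^+ n <= B.

Definition psum a n z := \sum_(k < n) a k * z ^+ k.

(** [limn] has a default value on divergent sequences; the value is meaningful for |z| < 1 under
    [radius_ge1]. *)
Definition ps a z : C := limn (fun n => psum a n z).

Lemma psum_diff_le a z (B q : R) m n : 0 <= q < 1 -> 0 <= B ->
  (forall k, modulus (a k * z ^+ k) <= B * q ^+ k) -> (m <= n)%N ->
  modulus (psum a n z - psum a m z) <= B / (1 - q) * q ^+ m.
Proof.
move=> /andP[q0 q1] B0 h mn; have q10 : 0 < 1 - q by rewrite subr_gt0.
have step k : modulus (psum a k.+1 z - psum a k z) <= B * q ^+ k.
  by rewrite /psum big_ord_recr /= addrAC subrr add0r.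
suff : modulus (psum a n z - psum a m z) <= B / (1 - q) * (q ^+ m - q ^+ n).
  move=> /le_trans; apply; rewrite ler_wpM2l ?gerBl ?exprn_ge0//.
  by rewrite divr_ge0// ltW.
rewrite -(subnKC mn); elim: (n - m)%N => [|j IH].
  by rewrite addn0 !subrr modulus0 mulr0.
rewrite addnS -[psum a _ z](subrK (psum a (m + j) z)) -addrA.
rewrite (le_trans (modulusD_le _ _))// (le_trans (lerD (step _) IH))//.
rewrite exprS le_eqVlt; apply/orP; left; apply/eqP; field.
by rewrite gt_eqF.
Qed.

(** Boundedness of the terms at the intermediate radius s = (1 + r) / 2 gives the ratio r / s < 1 on
    |z| <= r. *)
Lemma psum_geometric a (r : R) : radius_ge1 a -> 0 <= r < 1 ->
  exists B q, [/\ 0 <= B, 0 <= q < 1 & forall z, modulus z <= r ->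
    forall k, modulus (a k * z ^+ k) <= B * q ^+ k].
Proof.
move=> ha /andP[r0 r1]; pose s := (1 + r) / 2.
have s1 : 0 <= s < 1 by rewrite /s; apply/andP; split; lra.
have s0 : 0 < s by rewrite /s; lra.
have [B hB] := ha s s1; exists B, (r / s); split.
- by apply: le_trans (hB 0%N); rewrite mulr_ge0 ?modulus_ge0 ?exprn_ge0// ltW.
- by rewrite divr_ge0 ?(ltW s0)//= ltr_pdivrMr// mul1r /s; lra.
move=> z zr k; rewrite modulusM modulusX exprMn exprVn mulrCA mulrC.
have sk : 0 < s ^+ k by rewrite exprn_gt0.
apply: (@le_trans _ _ (modulus (a k) * r ^+ k)).
  by rewrite mulrC ler_wpM2l ?modulus_ge0// lerXn2r ?nnegrE ?modulus_ge0.
rewrite mulrC ler_wpM2l ?exprn_ge0// ler_pdivlMr//; exact: hB.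
Qed.

Lemma ps_psum_le a (r : R) : radius_ge1 a -> 0 <= r < 1 ->
  exists B q, [/\ 0 <= B, 0 <= q < 1 & forall z n, modulus z <= r ->
    modulus (ps a z - psum a n z) <= B * q ^+ n].
Proof.
move=> ha r1; have [B [q [B0 q01 h]]] := psum_geometric ha r1.
have q10 : 0 < 1 - q by rewrite subr_gt0; case/andP: q01.
have q0 : 0 <= q by case/andP: q01.
have BQ0 : 0 <= B / (1 - q) by rewrite divr_ge0// ltW.
have qn0 e : 0 < e -> exists N, B / (1 - q) * q ^+ N <= e.
  move=> e0; have : B / (1 - q) * q ^+ n @[n --> \oo] --> 0.
    rewrite -[X in _ --> X](mulr0 (B / (1 - q))); apply: cvgMr.
    by apply: cvg_expr; rewrite ger0_norm//; case/andP: q01.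
  move=> /cvgrPdist_le/(_ _ e0)[N _ /(_ N (leqnn _))]; rewrite sub0r normrN => hN.
  by exists N; apply: le_trans (ler_norm _) hN.
exists (B / (1 - q)), q; split=> // z n zr.
have hz := h z zr.
have [e e0|l hl] := @cauchy_complex (fun n => psum a n z).
  have [N hN] := qn0 e e0; exists N => m Nm.
  exact: le_trans (psum_diff_le q01 B0 hz Nm) hN.
have <- : l = ps a z.
  apply/esym/cvg_lim => //; apply/modulus_cvgP => e e0.
  have [N hN] := hl (e / 2) (divr_gt0 e0 (ltr0Sn _ _)).
  exists N => // m /= /hN /le_lt_trans; apply; lra.
apply/ler_addgt0Pr => e e0; have [N hN] := hl e e0.
rewrite -[l](subrK (psum a (maxn N n) z)) -addrA (le_trans (modulusD_le _ _))//.
rewrite [leLHS]addrC lerD//; last by rewrite modulusBC hN// leq_maxl.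
exact: (psum_diff_le q01 B0 hz (leq_maxr _ _)).
Qed.

Lemma ps_cvg a z : radius_ge1 a -> modulus z < 1 -> forall e : R, 0 < e ->
  exists N, forall n, (N <= n)%N -> modulus (ps a z - psum a n z) <= e.
Proof.
move=> ha z1 e e0.
have r1 : 0 <= modulus z < 1 by rewrite modulus_ge0.
have [B [q [B0 /andP[q0 q1] h]]] := ps_psum_le ha r1.
have : B * q ^+ n @[n --> \oo] --> 0.
  rewrite -[X in _ --> X](mulr0 B); apply: cvgMr.
  by apply: cvg_expr; rewrite ger0_norm.
move=> /cvgrPdist_le/(_ _ e0)[N _ hN]; exists N => n /hN; rewrite sub0r normrN => {}hN.
by rewrite (le_trans (h z n (lexx _)))// (le_trans (ler_norm _) hN).
Qed.

Lemma ps_le a z (B : R) : radius_ge1 a -> modulus z < 1 ->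
  (forall n, \sum_(k < n) modulus (a k) * modulus z ^+ k <= B) ->
  modulus (ps a z) <= B.
Proof.
move=> ha z1 h; apply: (@modulus_limit_le _ (fun n => psum a n z)) => e e0.
have [N hN] := ps_cvg ha z1 e0; exists N; first exact: hN.
rewrite (le_trans (modulus_sum _ _ _))// (le_trans _ (h N))// ler_sum// => k _.
by rewrite modulusM modulusX.
Qed.

Lemma ps0 a : radius_ge1 a -> ps a 0 = a 0%N.
Proof.
move=> ha; apply/eqP; rewrite -subr_eq0 -modulus_eq0 eq_le modulus_ge0 andbT.
apply/ler_addgt0Pr => e e0; rewrite add0r.
have z1 : modulus (0 : C) < 1 by rewrite modulus0.
have [N hN] := ps_cvg ha z1 e0; have := hN N.+1 (leqnSn _).
rewrite /psum big_ord_recl expr0 mulr1 big1 ?addr0// => k _.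
by rewrite expr0n mulr0.
Qed.

Definition dps a k : C := k.+1%:R * a k.+1.

(** q^k is the smallest of the k + 1 terms of 1 + q + ... + q^k, whose sum is (1 - q^(k+1)) / (1 -
    q). *)
Lemma natr_expr_le (q : R) k : 0 <= q < 1 -> k.+1%:R * q ^+ k <= (1 - q)^-1.
Proof.
move=> /andP[q0 q1]; have q10 : 0 < 1 - q by rewrite subr_gt0.
rewrite -[leRHS]mul1r ler_pdivlMr// mulrAC.
suff : k.+1%:R * (1 - q) * q ^+ k <= 1 - q ^+ k.+1.
  by move=> /le_trans; apply; rewrite gerBl exprn_ge0.
elim: k => [|k IH]; first by rewrite mul1r expr0 mulr1 expr1.
have qk : q ^+ k.+1 <= q ^+ k by rewrite exprS ler_piMl ?exprn_ge0// ltW.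
rewrite -natr1 mulrDl mul1r mulrDl.
have : k.+1%:R * (1 - q) * q ^+ k.+1 <= k.+1%:R * (1 - q) * q ^+ k.
  by rewrite ler_wpM2l// mulr_ge0// ltW.
move=> /le_trans/(_ IH) h; rewrite (le_trans (lerD h (lexx _)))//.
by rewrite mulrBl mul1r -exprS addrA subrK.
Qed.

Lemma radius_ge1_dps a : radius_ge1 a -> radius_ge1 (dps a).
Proof.
move=> ha r /andP[r0 r1].
have [s rs s1'] : exists2 s : R, r < s & s < 1 by exists ((1 + r) / 2); lra.
have s0 : 0 < s by exact: le_lt_trans r0 rs.
have s1 : 0 <= s < 1 by rewrite s1' ltW.
have [B hB] := ha s s1.
have sN0 : s != 0 by rewrite gt_eqF.
have q01 : 0 <= r / s < 1.
  by rewrite divr_ge0 ?(ltW s0)//= ltr_pdivrMr// mul1r.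
exists (s^-1 * B * (1 - r / s)^-1) => n.
have B0 : 0 <= B.
  by apply: le_trans (hB 0%N); rewrite mulr_ge0 ?modulus_ge0 ?exprn_ge0// ltW.
rewrite modulusM modulus_natr.
have -> : n.+1%:R * modulus (a n.+1) * r ^+ n =
    s^-1 * (modulus (a n.+1) * s ^+ n.+1) * (n.+1%:R * (r / s) ^+ n).
  by rewrite exprMn exprVn exprS; field; rewrite expf_neq0.
apply: ler_pM; rewrite ?mulr_ge0 ?invr_ge0 ?modulus_ge0 ?exprn_ge0 ?(ltW s0)//.
- by case/andP: q01.
- by rewrite ler_wpM2l ?invr_ge0 ?(ltW s0).
- exact: natr_expr_le.
Qed.

(** The second-order remainders satisfy rem_(k+1) = w rem_k + (k+2) z^(k+1) (w - z)^2. The factor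
    (k+2)(k+1) is the one in the coefficients of the second derived series, so that the sum over k
    is controlled by [dps (dps a)]. *)
Lemma expr_taylor2 z w (r : R) k : modulus z <= r -> modulus w <= r ->
  modulus (w ^+ k.+2 - z ^+ k.+2 - k.+2%:R * z ^+ k.+1 * (w - z)) <=
  k.+2%:R * k.+1%:R * r ^+ k * modulus (w - z) ^+ 2.
Proof.
move=> zr wr; have r0 : 0 <= r by rewrite (le_trans _ zr)// modulus_ge0.
have m2 : 0 <= modulus (w - z) ^+ 2 by rewrite exprn_ge0// modulus_ge0.
elim: k => [|k IH].
  rewrite expr0 mulr1 (_ : _ - _ = (w - z) ^+ 2); last by ring.
  by rewrite modulusX ler_peMl// mulr1 ler1n.
have -> : w ^+ k.+3 - z ^+ k.+3 - k.+3%:R * z ^+ k.+2 * (w - z) =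
   w * (w ^+ k.+2 - z ^+ k.+2 - k.+2%:R * z ^+ k.+1 * (w - z)) +
   k.+2%:R * z ^+ k.+1 * (w - z) ^+ 2.
  by rewrite -[k.+3%:R]natr1 !exprS; ring.
rewrite (le_trans (modulusD_le _ _))// !modulusM !modulusX modulus_natr.
apply: (@le_trans _ _ (r * (k.+2%:R * k.+1%:R * r ^+ k * modulus (w - z) ^+ 2) +
  k.+2%:R * r ^+ k.+1 * modulus (w - z) ^+ 2)).
  apply: lerD; first by rewrite ler_pM ?modulus_ge0.
  by rewrite ler_wpM2r// ler_wpM2l// lerXn2r ?nnegrE ?modulus_ge0.
rewrite [leLHS](_ : _ = k.+2%:R * k.+2%:R * r ^+ k.+1 * modulus (w - z) ^+ 2); last first.
  by rewrite -[k.+2%:R]natr1 (exprS r k); ring.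
apply: ler_wpM2r => //; apply: ler_wpM2r; first by rewrite exprn_ge0.
by apply: ler_wpM2r => //; rewrite ler_nat.
Qed.

Lemma psumS a n z : psum a n.+1 z = psum a n z + a n * z ^+ n.
Proof. by rewrite /psum big_ord_recr. Qed.

(** The powers of degree 0 and 1 have no second-order remainder, whence the shift by two. *)
Lemma psum_taylor2 a z w n :
  psum a n.+2 w - psum a n.+2 z - psum (dps a) n.+1 z * (w - z) =
  \sum_(k < n) a k.+2 * (w ^+ k.+2 - z ^+ k.+2 - k.+2%:R * z ^+ k.+1 * (w - z)).
Proof.
elim: n => [|n IH].
  rewrite /psum /dps !big_ord_recr !big_ord0 /= !expr0 !expr1; ring.
rewrite big_ord_recr /= -IH {IH} !(psumS a n.+2) (psumS (dps a) n.+1) /dps; ring.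
Qed.

(** The termwise remainders add up to at most K |w - z|^2, with K a geometric bound for the second
    derived series on a disk of radius r > |z|; this bound survives the limit of the partial
    sums. *)
Lemma cderiv_ps a z : radius_ge1 a -> modulus z < 1 -> cderiv (ps a) z (ps (dps a) z).
Proof.
move=> ha z1; have had := radius_ge1_dps ha; have hadd := radius_ge1_dps had.
pose r := (1 + modulus z) / 2.
have z0 := modulus_ge0 z.
have r1 : 0 <= r < 1 by rewrite /r; apply/andP; split; lra.
have zr : modulus z < r by rewrite /r; lra.
have [B [q [B0 q01 hB]]] := psum_geometric hadd r1.
pose K := B / (1 - q).
have q10 : 0 < 1 - q by rewrite subr_gt0; case/andP: q01.
have K0 : 0 <= K by rewrite divr_ge0// ltW.
have r0 : 0 <= r by case/andP: r1.
have main w : modulus w <= r ->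
    modulus (ps a w - ps a z - ps (dps a) z * (w - z)) <= K * modulus (w - z) ^+ 2.
  move=> wr; pose u n := psum a n.+2 w - psum a n.+2 z - psum (dps a) n.+1 z * (w - z).
  have w1 : modulus w < 1 by rewrite (le_lt_trans wr)//; case/andP: r1.
  apply: (@modulus_limit_le _ u) => e e0.
    have e3 : 0 < e / 3 by rewrite divr_gt0.
    have D0 : 0 < 1 + modulus (w - z) by rewrite ltr_pwDl ?modulus_ge0.
    have [N1 h1] := ps_cvg ha w1 e3; have [N2 h2] := ps_cvg ha z1 e3.
    have [N3 h3] := ps_cvg had z1 (divr_gt0 e3 D0).
    exists (N1 + N2 + N3)%N.
      have idt (x1 x2 x3 y1 y2 y3 d : C) :
          x1 - x2 - x3 * d - (y1 - y2 - y3 * d) = (x1 - y1) - (x2 - y2) - (x3 - y3) * d.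
        by ring.
      rewrite /u idt.
      rewrite (le_trans (modulusB_le _ _))// [leRHS](_ : _ = e / 3 + e / 3 + e / 3); last by field.
      apply: lerD.
        rewrite (le_trans (modulusB_le _ _))// lerD//; [apply: h1|apply: h2].
          by rewrite -addnA -addn2 -addnA leq_addr.
        by rewrite -addnA addnCA -addn2 -addnA leq_addr.
      rewrite modulusM.
      have /h3 h : (N3 <= (N1 + N2 + N3).+1)%N by rewrite -addnS -addSnnS leq_addl.
      apply: le_trans (ler_wpM2r (modulus_ge0 _) h) _.
      rewrite -mulrA ler_piMr ?(ltW e3)// mulrC ler_pdivrMr// mul1r lerDr//.
  set n := (_ + _)%N; rewrite {}/u psum_taylor2.
  rewrite (le_trans (modulus_sum _ _ _))//.
  apply: (@le_trans _ _ (\sum_(k < n) B * q ^+ k * modulus (w - z) ^+ 2)).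
    apply: ler_sum => k _; rewrite modulusM.
    apply: le_trans (ler_wpM2l (modulus_ge0 _) (expr_taylor2 _ (ltW zr) wr)) _.
    rewrite mulrA ler_wpM2r ?exprn_ge0 ?modulus_ge0//.
    (* Evaluating the geometric bound at the real point r turns it into a bound for |a_k| r^k. *)
    have rm : modulus (r%:C%C : C) = r by rewrite modulus_real ger0_norm.
    have := hB r%:C%C; rewrite rm lexx => /(_ isT k).
    rewrite modulusM modulusX rm /dps !modulusM !modulus_natr; apply: le_trans.
    rewrite le_eqVlt; apply/orP; left; apply/eqP; ring.
  rewrite -mulr_suml ler_wpM2r ?exprn_ge0 ?modulus_ge0// -mulr_sumr ler_wpM2l//.
  rewrite -[leRHS]mul1r ler_pdivlMr//.
  have := subrX1 q n; rewrite -opprB -[q - 1]opprB mulNr => /oppr_inj.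
  rewrite mulrC => <-; rewrite gerBl exprn_ge0//; by case/andP: q01.
move=> e e0; exists (Num.min (r - modulus z) (e / (K + 1))) => [|w].
  by rewrite lt_min subr_gt0 zr divr_gt0// ltr_wpDl.
rewrite lt_min => /andP[wz1 wz2].
have /main : modulus w <= r.
  rewrite -[w](subrK z) (le_trans (modulusD_le _ _))//; lra.
move=> /le_trans; apply; rewrite expr2 mulrA ler_wpM2r ?modulus_ge0//.
move: wz2; rewrite ltr_pdivlMr ?ltr_wpDl// => /ltW; apply: le_trans.
by rewrite mulrC ler_wpM2l ?modulus_ge0// lerDl.
Qed.

Lemma iter_dpsE a n k :
  iter n dps a k = ((k + n)`!%:R / k`!%:R) * a (k + n)%N.
Proof.
elim: n k => [|n IH] k; first by rewrite addn0 divff ?mul1r// pnatr_eq0 -lt0n fact_gt0.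
rewrite iterS {1}/dps IH addSnnS mulrA factS natrM invfM.
by congr (_ * _); rewrite mulrCA mulVKf// pnatr_eq0.
Qed.

Lemma radius_ge1_iter_dps a n : radius_ge1 a -> radius_ge1 (iter n dps a).
Proof. by move=> ha; elim: n => //= n IH; exact: radius_ge1_dps. Qed.

(** Each differentiation uses a neighbourhood, so the induction runs over the whole disk |z| < r; at
    0 the n-th derived series has constant term n! a_n. *)
Lemma taylor_coef_ps (f : disk R -> C) a (r : R) : 0 < r <= 1 -> radius_ge1 a ->
  (forall z, modulus z < r -> ext f z = ps a z) -> forall n, taylor_coef f n = a n.
Proof.
move=> /andP[r0 r1] ha fa n.
have key m z : modulus z < r -> derive1n m (ext f) z = ps (iter m dps a) z.
  elim: m z => [|m IH] z zr; first exact: fa.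
  rewrite derive1nS iterS; apply: (proj2 (proj1 (cderivP _ _ _) _)).
  apply: (@cderiv_near _ (ps (iter m dps a))); last first.
    by apply: cderiv_ps; [exact: radius_ge1_iter_dps|exact: lt_le_trans r1].
  apply/modulus_nbhsP; exists (r - modulus z); first by rewrite subr_gt0.
  move=> w wz; apply/esym/IH; rewrite -[w](subrK z) (le_lt_trans (modulusD_le _ _))//.
  by rewrite -ltrBrDr.
rewrite /taylor_coef key ?modulus0// ps0; last exact: radius_ge1_iter_dps.
rewrite iter_dpsE add0n fact0 divr1 mulrC mulKf// pnatr_eq0 -lt0n fact_gt0//.
Qed.

End power_series.

(** * Integrals along segments and Goursat's lemma *)

Section segment_integral.
Variable R : realType.
Local Notation C := (Cplx R).
Local Notation mu := (@lebesgue_measure R).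
Implicit Types (u v : R -> R) (a b c : R).

Definition Rint a b u : R := \int[mu]_(t in `[a, b]) u t.

Lemma continuous_itv_integrable a b u : continuous u ->
  mu.-integrable `[a, b] (EFin \o u).
Proof.
move=> cu; apply: continuous_compact_integrable; first exact: segment_compact.
exact: continuous_subspaceT.
Qed.

Lemma eq_Rint a b u v : u =1 v -> Rint a b u = Rint a b v.
Proof. by move=> uv; rewrite /Rint; congr Rintegral; apply/funext. Qed.

Lemma RintD a b u v : continuous u -> continuous v ->
  Rint a b (fun t => u t + v t) = Rint a b u + Rint a b v.
Proof. by move=> cu cv; rewrite /Rint RintegralD//; exact: continuous_itv_integrable. Qed.

Lemma RintZ a b k u : continuous u -> Rint a b (fun t => k * u t) = k * Rint a b u.
Proof. by move=> cu; rewrite /Rint RintegralZl//; exact: continuous_itv_integrable. Qed.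

Lemma Rint_cst a b k : a <= b -> Rint a b (fun=> k) = k * (b - a).
Proof.
move=> ab; rewrite /Rint Rintegral_cst//= lebesgue_measure_itv /= lte_fin.
case: ifPn => [|/negP]; first by [].
by move=> /negP; rewrite -leNgt => ba; rewrite (@le_anti _ _ a b) ?ab// subrr mulr0.
Qed.

Lemma Rint_cat a b c u : a <= b -> b <= c -> continuous u ->
  Rint a c u = Rint a b u + Rint b c u.
Proof.
move=> ab bc cu; have := @Rintegral_itvB R u (BLeft a) (BRight c) b.
rewrite !bnd_simp => /(_ (continuous_itv_integrable _ _ cu) ab bc).
rewrite Rintegral_itv_obnd_cbnd; last first.
  by apply: integrableS (continuous_itv_integrable b c cu) => //; exact: subset_itv_oc_cc.
by rewrite /Rint => <-; rewrite addrC subrK.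
Qed.

Lemma le_Rint a b u v : continuous u -> continuous v ->
  (forall t, a <= t <= b -> u t <= v t) -> Rint a b u <= Rint a b v.
Proof.
by move=> cu cv uv; apply: le_Rintegral => //; exact: continuous_itv_integrable.
Qed.

Lemma Rint_norm_le a b u v : continuous u -> continuous v ->
  (forall t, a <= t <= b -> `|u t| <= v t) -> `|Rint a b u| <= Rint a b v.
Proof.
move=> cu cv uv; rewrite ler_norml; apply/andP; split; last first.
  by apply: le_Rint => // t /uv; rewrite ler_norml => /andP[].
rewrite lerNl -mulN1r -RintZ//; apply: le_Rint => //.
  by move=> t; apply: cvgMr; exact: cu.
by move=> t /uv; rewrite ler_norml mulN1r lerNl => /andP[].
Qed.

Definition cint a b (u : R -> C) : C :=
  (Rint a b (fun t => complex.Re (u t)) +i* Rint a b (fun t => complex.Im (u t)))%C.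

Lemma continuous_Re : continuous (@complex.Re R : C -> R).
Proof.
move=> z; apply/(@cvgrPdist_lt _ _ _ (nbhs z)) => e e0; apply/modulus_nbhsP.
exists e => // w wz; rewrite distrC (le_lt_trans _ wz)//.
by rewrite (le_trans _ (Re_le_modulus _))//; case: z w {wz} => [? ?] [].
Qed.

Lemma continuous_Im : continuous (@complex.Im R : C -> R).
Proof.
move=> z; apply/(@cvgrPdist_lt _ _ _ (nbhs z)) => e e0; apply/modulus_nbhsP.
exists e => // w wz; rewrite distrC (le_lt_trans _ wz)//.
by rewrite (le_trans _ (Im_le_modulus _))//; case: z w {wz} => [? ?] [].
Qed.

Lemma continuous_complex (T : topologicalType) (x y : T -> R) (t : T) :
  x s @[s --> t] --> x t -> y s @[s --> t] --> y t ->
  ((x s +i* y s)%C : C) @[s --> t] --> ((x t +i* y t)%C : C).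
Proof.
move=> cx cy; apply/(@modulus_cvgP _ _ (nbhs t)) => e e0; near=> s.
rewrite (le_lt_trans (modulus_le_ReIm _))//= (splitr e) ltrD//; near: s.
  move: cx => /cvgrPdist_lt/(_ _ (divr_gt0 e0 (ltr0Sn _ 1))).
  by apply: filterS => s; rewrite distrC.
move: cy => /cvgrPdist_lt/(_ _ (divr_gt0 e0 (ltr0Sn _ 1))).
by apply: filterS => s; rewrite distrC.
Unshelve. all: by end_near. Qed.

Lemma continuous_ReC (u : R -> C) : continuous u -> continuous (fun t => complex.Re (u t)).
Proof. by move=> cu t; apply: continuous_comp (cu t) _; exact: continuous_Re. Qed.

Lemma continuous_ImC (u : R -> C) : continuous u -> continuous (fun t => complex.Im (u t)).
Proof. by move=> cu t; apply: continuous_comp (cu t) _; exact: continuous_Im. Qed.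

Implicit Types f g : R -> C.

Lemma eq_cint a b f g : f =1 g -> cint a b f = cint a b g.
Proof. by move=> fg; congr cint; apply/funext. Qed.

Lemma ReD (z w : C) : complex.Re (z + w) = complex.Re z + complex.Re w.
Proof. by case: z w => [? ?] []. Qed.

Lemma ImD (z w : C) : complex.Im (z + w) = complex.Im z + complex.Im w.
Proof. by case: z w => [? ?] []. Qed.

Lemma cintD a b f g : continuous f -> continuous g ->
  cint a b (fun t => f t + g t) = cint a b f + cint a b g.
Proof.
move=> cf cg; rewrite /cint; under eq_Rint do rewrite ReD.
under [X in (_ +i* X)%C]eq_Rint do rewrite ImD.
by rewrite !RintD//; (exact: continuous_ReC || exact: continuous_ImC).
Qed.

Lemma cintZ a b (k : C) f : continuous f ->
  cint a b (fun t => k * f t) = k * cint a b f.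
Proof.
move=> cf; have cR := continuous_ReC cf; have cI := continuous_ImC cf.
case: k => x y; rewrite /cint.
have cZ (l : R) u : continuous u -> continuous (fun t => l * u t).
  by move=> cu t; apply: cvgMr; exact: cu.
have hR : Rint a b (fun t => complex.Re ((x +i* y)%C * f t)) =
    x * Rint a b (fun t => complex.Re (f t)) - y * Rint a b (fun t => complex.Im (f t)).
  rewrite -mulNr -!RintZ// -RintD; try exact: cZ.
  by apply: eq_Rint => t; case: (f t) => ? ? /=; rewrite mulNr.
have hI : Rint a b (fun t => complex.Im ((x +i* y)%C * f t)) =
    x * Rint a b (fun t => complex.Im (f t)) + y * Rint a b (fun t => complex.Re (f t)).
  rewrite -!RintZ// -RintD; try exact: cZ.
  by apply: eq_Rint => t; case: (f t).
by rewrite hR hI.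
Qed.

Lemma cintB a b f g : continuous f -> continuous g ->
  cint a b (fun t => f t - g t) = cint a b f - cint a b g.
Proof.
move=> cf cg; rewrite (@eq_cint _ _ _ (fun t => f t + (-1) * g t)); last first.
  by move=> t; rewrite mulN1r.
by rewrite (cintD _ _ cf (@ccontZ _ _ (-1) _ cg)) (cintZ _ _ _ cg) mulN1r.
Qed.

Lemma cint_cst a b (k : C) : a <= b -> cint a b (fun=> k) = k * (b - a)%:C%C.
Proof.
move=> ab; rewrite /cint !Rint_cst//; case: k => x y.
by apply/eqP; rewrite eq_complex /= !mulr0 subr0 add0r !eqxx.
Qed.

Lemma cint_cat a b c f : a <= b -> b <= c -> continuous f ->
  cint a c f = cint a b f + cint b c f.
Proof.
move=> ab bc cf; rewrite /cint (Rint_cat ab bc (continuous_ReC cf)).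
by rewrite (Rint_cat ab bc (continuous_ImC cf)).
Qed.

(* The constant 2 comes from treating real and imaginary parts separately. *)
Lemma cint_modulus_le a b f (v : R -> R) : continuous f -> continuous v ->
  (forall t, a <= t <= b -> modulus (f t) <= v t) ->
  modulus (cint a b f) <= 2 * Rint a b v.
Proof.
move=> cf cv fv; rewrite (le_trans (modulus_le_ReIm _))//= mulrDl mul1r.
apply: lerD; apply: Rint_norm_le => //.
- exact: continuous_ReC.
- by move=> t /fv; apply: le_trans; exact: Re_le_modulus.
- exact: continuous_ImC.
- by move=> t /fv; apply: le_trans; exact: Im_le_modulus.
Qed.

Lemma cint_bound a b f (B : R) : a <= b -> continuous f ->
  (forall t, a <= t <= b -> modulus (f t) <= B) ->
  modulus (cint a b f) <= 2 * (B * (b - a)).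
Proof.
move=> ab cf fB; rewrite -(Rint_cst B ab); apply: cint_modulus_le => //.
by move=> t; exact: cvg_cst.
Qed.

Lemma cint_conj a b f : continuous f ->
  cint a b (fun t => conjc (f t)) = conjc (cint a b f).
Proof.
move=> cf; rewrite /cint /=; apply/eqP; rewrite eq_complex /=; apply/andP; split.
  by apply/eqP/eq_Rint => t; case: (f t).
rewrite -mulN1r -RintZ; last exact: continuous_ImC.
by apply/eqP/eq_Rint => t; case: (f t) => ? ? /=; rewrite mulN1r.
Qed.

End segment_integral.

#[global] Opaque Rint cint.

Section goursat.
Variable R : realType.
Local Notation C := (Cplx R).
Implicit Types H : C -> C.

(* The contour integral of [H] along the boundary of [x1, x2] x [y1, y2]. *)
Definition rect H (x1 x2 y1 y2 : R) : C :=
  ('i%C : C) * (cint y1 y2 (fun y => H (x2 +i* y)%C) - cint y1 y2 (fun y => H (x1 +i* y)%C)) -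
  (cint x1 x2 (fun x => H (x +i* y2)%C) - cint x1 x2 (fun x => H (x +i* y1)%C)).

Lemma continuous_hline H (y : R) : continuous H -> continuous (fun x : R => H (x +i* y)%C).
Proof.
move=> cH x; apply: (@continuous_comp _ _ _ (fun x : R => (x +i* y)%C : C) H).
  by apply: continuous_complex; [exact: cvg_id|exact: cvg_cst].
exact: cH.
Qed.

Lemma continuous_vline H (x : R) : continuous H -> continuous (fun y : R => H (x +i* y)%C).
Proof.
move=> cH y; apply: (@continuous_comp _ _ _ (fun y : R => (x +i* y)%C : C) H).
  by apply: continuous_complex; [exact: cvg_cst|exact: cvg_id].
exact: cH.
Qed.

Lemma rectB H G x1 x2 y1 y2 : continuous H -> continuous G ->
  rect (fun w => H w - G w) x1 x2 y1 y2 = rect H x1 x2 y1 y2 - rect G x1 x2 y1 y2.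
Proof.
move=> cH cG; rewrite /rect !cintB; try exact: continuous_hline; try exact: continuous_vline.
ring.
Qed.

Lemma rect_split_x H x1 x x2 y1 y2 : continuous H -> x1 <= x -> x <= x2 ->
  rect H x1 x2 y1 y2 = rect H x1 x y1 y2 + rect H x x2 y1 y2.
Proof.
move=> cH x1x xx2; rewrite /rect.
rewrite !(cint_cat x1x xx2 (@continuous_hline H _ cH)); ring.
Qed.

Lemma rect_split_y H x1 x2 y1 y y2 : continuous H -> y1 <= y -> y <= y2 ->
  rect H x1 x2 y1 y2 = rect H x1 x2 y1 y + rect H x1 x2 y y2.
Proof.
move=> cH y1y yy2; rewrite /rect.
rewrite !(cint_cat y1y yy2 (@continuous_vline H _ cH)); ring.
Qed.

(** The integrand differs by a constant between opposite sides, and each pair of sides yields i d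
    (x2 - x1) (y2 - y1), with opposite signs. *)
Lemma rect_affine (k d w0 : C) x1 x2 y1 y2 : x1 <= x2 -> y1 <= y2 ->
  rect (fun w => k + d * (w - w0)) x1 x2 y1 y2 = 0.
Proof.
move=> x12 y12; rewrite /rect.
have cA : continuous (fun w : C => k + d * (w - w0)).
  apply: ccontD; first exact: ccont_cst.
  by apply: ccontZ; apply: ccontB; [move=> ?; exact: cvg_id|exact: ccont_cst].
rewrite -!cintB; try exact: (@continuous_vline _ _ cA); try exact: (@continuous_hline _ _ cA).
rewrite (@eq_cint _ _ _ _ (fun=> d * (x2 - x1)%:C%C)); last first.
  move=> y; rewrite (_ : (x2 +i* y)%C = (x1 +i* y)%C + (x2 - x1)%:C%C :> C); last first.
    by apply/eqP; rewrite eq_complex /= addr0 addrC subrK !eqxx.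
  by ring.
rewrite [X in _ - X](@eq_cint _ _ _ _ (fun=> d * ('i%C * (y2 - y1)%:C%C))); last first.
  move=> x; rewrite (_ : (x +i* y2)%C = (x +i* y1)%C + ('i%C * (y2 - y1)%:C%C) :> C); last first.
    by apply/eqP; rewrite eq_complex /= !mul0r !mul1r !subr0 ?addr0 ?add0r [y1 + _]addrC subrK !eqxx.
  by ring.
rewrite !cint_cst//; ring.
Qed.

(** The factor 4 counts two sides of each direction, each with the factor 2 of [cint_bound]. *)
Lemma rect_bound H (B x1 x2 y1 y2 : R) : continuous H -> x1 <= x2 -> y1 <= y2 ->
  (forall x y, x1 <= x <= x2 -> y1 <= y <= y2 -> modulus (H (x +i* y)%C) <= B) ->
  modulus (rect H x1 x2 y1 y2) <= 4 * B * ((x2 - x1) + (y2 - y1)).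
Proof.
move=> cH x12 y12 HB.
have i1 : modulus ('i%C : C) = 1 by rewrite /modulus normc_def /= expr0n add0r expr1n sqrtr1.
have h1 := cint_bound y12 (@continuous_vline H x2 cH) (fun y hy => HB _ _ (introT andP (conj x12 (lexx _))) hy).
have h2 := cint_bound y12 (@continuous_vline H x1 cH) (fun y hy => HB _ _ (introT andP (conj (lexx _) x12)) hy).
have h3 := cint_bound x12 (@continuous_hline H y2 cH) (fun y hy => HB _ _ hy (introT andP (conj y12 (lexx _)))).
have h4 := cint_bound x12 (@continuous_hline H y1 cH) (fun y hy => HB _ _ hy (introT andP (conj (lexx _) y12))).
rewrite (le_trans (modulusB_le _ _))// modulusM i1 mul1r.
rewrite (le_trans (lerD (modulusB_le _ _) (modulusB_le _ _)))//.
rewrite (le_trans (lerD (lerD h1 h2) (lerD h3 h4)))//.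
rewrite le_eqVlt; apply/orP; left; apply/eqP; ring.
Qed.

(** Subtracting the affine approximation leaves the integral unchanged, and the remainder is at most
    e times the half perimeter; the length of the contour supplies the second power. *)
Lemma rect_local H (e x1 x2 y1 y2 : R) (w0 d : C) : continuous H -> 0 <= e ->
  x1 <= complex.Re w0 <= x2 -> y1 <= complex.Im w0 <= y2 ->
  (forall w, modulus (w - w0) <= (x2 - x1) + (y2 - y1) ->
    modulus (H w - H w0 - d * (w - w0)) <= e * modulus (w - w0)) ->
  modulus (rect H x1 x2 y1 y2) <= 4 * e * ((x2 - x1) + (y2 - y1)) ^+ 2.
Proof.
move=> cH e0 /andP[xw1 xw2] /andP[yw1 yw2] h.
have x12 := le_trans xw1 xw2; have y12 := le_trans yw1 yw2.
have cA : continuous (fun w : C => H w0 + d * (w - w0)).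
  apply: ccontD; first exact: ccont_cst.
  by apply: ccontZ; apply: ccontB; [move=> ?; exact: cvg_id|exact: ccont_cst].
have cHA : continuous (fun w => H w - (H w0 + d * (w - w0))).
  exact: (ccontB cH cA).
have := rectB x1 x2 y1 y2 cH cA; rewrite rect_affine// subr0 => <-.
rewrite expr2 mulrA -(mulrA 4 e); apply: rect_bound => // x y /andP[x1x xx2] /andP[y1y yy2].
have wd : modulus ((x +i* y)%C - w0) <= x2 - x1 + (y2 - y1).
  rewrite (le_trans (modulus_le_ReIm _))//; case: w0 xw1 xw2 yw1 yw2 {h cA cHA} => a b /= *.
  by apply: lerD; rewrite ler_norml; apply/andP; split; lra.
by rewrite opprD addrA (le_trans (h _ wd))// ler_wpM2l.
Qed.

(** Repeated quartering: a nonzero integral forces nested rectangles whose integrals stay above eps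
    / 4^n, while [rect_local] at their common point gives at most 4 e L^2 / 4^n, with e as small as
    desired. *)
Theorem goursat H (x1 x2 y1 y2 : R) : continuous H -> x1 <= x2 -> y1 <= y2 ->
  (forall x y, x1 <= x <= x2 -> y1 <= y <= y2 -> exists d, cderiv H (x +i* y)%C d) ->
  rect H x1 x2 y1 y2 = 0.
Proof.
move=> cH x12 y12 dH; apply/eqP/negPn/negP => I0.
(* Half of the integral, so that the strict inequality in [bad] holds at the start. *)
pose eps := modulus (rect H x1 x2 y1 y2) / 2.
have eps0 : 0 < eps by rewrite divr_gt0// modulus_gt0.
pose lx n := (x2 - x1) / 2 ^+ n; pose ly n := (y2 - y1) / 2 ^+ n.
have e2 n : 0 < 2 ^+ n :> R by rewrite exprn_gt0.
have lx0 n : 0 <= lx n by rewrite divr_ge0 ?subr_ge0// ltW.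
have ly0 n : 0 <= ly n by rewrite divr_ge0 ?subr_ge0// ltW.
have lxS n : lx n = lx n.+1 + lx n.+1.
  by rewrite /lx exprS; field; rewrite gt_eqF.
have lyS n : ly n = ly n.+1 + ly n.+1.
  by rewrite /ly exprS; field; rewrite gt_eqF.
pose J n (s : R * R) := rect H s.1 (s.1 + lx n) s.2 (s.2 + ly n).
pose bad n (s : R * R) := eps / 4 ^+ n < modulus (J n s).
pose next n (s s' : R * R) := [/\ bad n.+1 s', s.1 <= s'.1 <= s.1 + lx n.+1 &
  s.2 <= s'.2 <= s.2 + ly n.+1].
have step n s : bad n s -> exists s', next n s s'.
  case: s => x y; rewrite /bad /J /=.
  have x0 : x <= x + lx n.+1 by rewrite lerDl.
  have y0 : y <= y + ly n.+1 by rewrite lerDl.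
  have x0' : x + lx n.+1 <= x + lx n.+1 + lx n.+1 by rewrite lerDl.
  have y0' : y + ly n.+1 <= y + ly n.+1 + ly n.+1 by rewrite lerDl.
  rewrite (lxS n) (lyS n) !addrA (rect_split_x _ _ cH x0 x0').
  rewrite (rect_split_y x _ cH y0 y0') (rect_split_y (x + lx n.+1) _ cH y0 y0').
  move=> hbad; apply: contrapT => /forallNP hn.
  have q x' y' : x <= x' <= x + lx n.+1 -> y <= y' <= y + ly n.+1 ->
      modulus (rect H x' (x' + lx n.+1) y' (y' + ly n.+1)) <= eps / 4 ^+ n.+1.
    move=> hx hy; rewrite leNgt; apply/negP => hb.
    by apply: (hn (x', y')); split.
  have := q x y; rewrite !lexx !lerDl => /(_ (lx0 _) (ly0 _)) q1.
  have := q (x + lx n.+1) y; rewrite !lexx !lerDl => /(_ (andb_true_intro (conj (lx0 _) isT)) (ly0 _)) q2.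
  have := q x (y + ly n.+1); rewrite !lexx !lerDl => /(_ (lx0 _) (andb_true_intro (conj (ly0 _) isT))) q3.
  have := q (x + lx n.+1) (y + ly n.+1); rewrite !lexx !lerDl.
  move=> /(_ (andb_true_intro (conj (lx0 _) isT)) (andb_true_intro (conj (ly0 _) isT))) q4.
  move: hbad; rewrite ltNge => /negP; apply.
  rewrite (le_trans (modulusD_le _ _))//.
  rewrite (le_trans (lerD (modulusD_le _ _) (modulusD_le _ _)))//.
  rewrite (le_trans (lerD (lerD q1 q3) (lerD q2 q4)))//.
  rewrite le_eqVlt; apply/orP; left; apply/eqP; rewrite exprS; field.
  by rewrite expf_neq0// pnatr_eq0.
(* The lower left corners of the chosen rectangles. The default of [xget] is never taken, since
   [step] provides a successor for every bad rectangle. *)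
pose s := fix s n := if n is m.+1 then xget (s m) (next m (s m)) else (x1, y1).
have sbad n : bad n (s n).
  elim: n => [|n IH].
    rewrite /bad /J /= /lx /ly !expr0 !divr1 ![_ + (_ - _)]addrC !subrK.
    by rewrite /eps ltr_pdivrMr// ltr_pMr ?modulus_gt0// ltr1n.
  have [s' hs'] := step n _ IH.
  by rewrite /=; case: xgetP => [_ -> []//|/(_ s')].
have snext n : next n (s n) (s n.+1).
  have [s' hs'] := step n _ (sbad n).
  by rewrite /=; case: xgetP => [_ -> //|/(_ s')].
have limP (c : nat -> R) (l : nat -> R) : (forall n, c n <= c n.+1 <= c n + l n.+1) ->
    (forall n, 0 <= l n) -> (forall n, l n = l n.+1 + l n.+1) ->
    exists t, forall n, c n <= t <= c n + l n.
  move=> hc l0 lS.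
  have cnd : nondecreasing_seq c by apply/nondecreasing_seqP => n; case/andP: (hc n).
  have cni : nonincreasing_seq (fun n => c n + l n).
    by apply/nonincreasing_seqP => n; rewrite (lS n) addrA lerD2r; case/andP: (hc n).
  have cb n : c n <= c 0%N + l 0%N.
    by apply: le_trans (cni 0%N n (leq0n _)); rewrite lerDl.
  have cc : cvgn c.
    by apply: nondecreasing_is_cvgn => //; exists (c 0%N + l 0%N) => _ [n _ <-].
  exists (limn c) => n; apply/andP; split; first exact: nondecreasing_cvgn_le.
  apply: limr_le => //; exists n => // m /= nm.
  by apply: le_trans (cni _ _ nm); rewrite lerDl.
have [x hx] : exists t, forall n, (s n).1 <= t <= (s n).1 + lx n.
  by apply: limP => // n; case: (snext n).
have [y hy] : exists t, forall n, (s n).2 <= t <= (s n).2 + ly n.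
  by apply: limP => // n; case: (snext n).
have [d hd] : exists d, cderiv H (x +i* y)%C d.
  apply: dH; [have := hx 0%N|have := hy 0%N];
  by rewrite /= ?/lx ?/ly expr0 divr1 [_ + (_ - _)]addrC subrK.
pose L := (x2 - x1) + (y2 - y1).
have L0 : 0 <= L by rewrite addr_ge0// subr_ge0.
(* This makes 4 e L^2 <= eps; the added 1 keeps the denominator positive even if L = 0. *)
pose e := eps / (4 * (L ^+ 2 + 1)).
have L20 : 0 < L ^+ 2 + 1 by rewrite ltr_wpDl ?exprn_ge0.
have e0 : 0 < e by rewrite divr_gt0// mulr_gt0.
have [d' d'0 hd'] := hd e e0.
have [n Ln] : exists n, L / 2 ^+ n < d'.
  have : L * 2^-1 ^+ n @[n --> \oo] --> 0.
    rewrite -[X in _ --> X](mulr0 L); apply: cvgMr; apply: cvg_expr.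
    by rewrite ger0_norm ?invr_ge0// invf_lt1// ltr1n.
  move=> /cvgrPdist_lt/(_ _ d'0)[N _ /(_ N (leqnn _))]; rewrite sub0r normrN => h.
  by exists N; rewrite -exprVn; exact: le_lt_trans (ler_norm _) h.
have Lnl : lx n + ly n = L / 2 ^+ n by rewrite /lx /ly -mulrDl.
have := sbad n; rewrite /bad /J ltNge => /negP; apply.
have := @rect_local H e (s n).1 ((s n).1 + lx n) (s n).2 ((s n).2 + ly n) (x +i* y)%C d cH (ltW e0) (hx n) (hy n).
rewrite ![_ + _ - _]addrC !addKr Lnl => /(_ _)/le_trans; apply.
  by move=> w wL; apply: hd'; exact: le_lt_trans wL Ln.
rewrite exprMn exprVn -exprM mulnC exprM (_ : 2 ^+ 2 = 4); last by ring.
rewrite mulrA ler_wpM2r ?invr_ge0 ?exprn_ge0//.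
have -> : 4 * e * L ^+ 2 = eps * (L ^+ 2 / (L ^+ 2 + 1)).
  by rewrite /e; field; rewrite gt_eqF.
by rewrite ler_piMr ?(ltW eps0)// ler_pdivrMr// mul1r lerDl.
Qed.

End goursat.

(** * Means over circles *)

Section circle_means.
Variable R : realType.
Local Notation C := (Cplx R).
Implicit Types (g : C -> C) (s t : R).

Definition circ s t : C := (s * cos t +i* (s * sin t))%C.

(** The complex exponential in polar form, which maps vertical segments to arcs of circles. *)
Definition cexp (w : C) : C := circ (expR (complex.Re w)) (complex.Im w).

Lemma modulus_circ s t : 0 <= s -> modulus (circ s t) = s.
Proof.
move=> s0; rewrite /modulus normc_def /= !exprMn -mulrDr cos2Dsin2 mulr1.
by rewrite sqrtr_sqr ger0_norm.
Qed.

Lemma circ_neq0 s t : 0 < s -> circ s t != 0.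
Proof. by move=> s0; rewrite -modulus_gt0 modulus_circ// ltW. Qed.

Lemma circ_cvg (T : topologicalType) (x y : T -> R) (a : T) :
  x u @[u --> a] --> x a -> y u @[u --> a] --> y a ->
  circ (x u) (y u) @[u --> a] --> circ (x a) (y a).
Proof.
move=> cx cy; apply: (@continuous_complex _ _ (fun u => x u * cos (y u)) (fun u => x u * sin (y u))).
  apply: cvgM cx _; apply: continuous_comp cy _; exact: continuous_cos.
apply: cvgM cx _; apply: continuous_comp cy _; exact: continuous_sin.
Qed.

Lemma real_deriv_approx (f : R -> R) (x d : R) : is_derive x 1 f d ->
  forall e : R, 0 < e -> exists2 d' : R, 0 < d' &
    forall h, `|h| < d' -> `|f (x + h) - f x - d * h| <= e * `|h|.
Proof.
move=> [fx fd] e e0; move: (fx); rewrite /derivable => /cvg_ex[/= l fl].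
have ld : l = d by rewrite -fd /derive; apply/esym/cvg_lim.
move: fl; rewrite ld => /cvgrPdist_le/(_ _ e0)/nbhs_ballP[d' /= d'0 hd'].
exists d' => // h hd; have [->|h0] := eqVneq h 0.
  by rewrite addr0 subrr mulr0 subrr normr0 mulr0.
have := hd' h; rewrite /ball /= sub0r normrN => /(_ hd h0) /=.
rewrite [h *: 1]mulr1 [h + x]addrC => hh.
rewrite (_ : _ - _ = h * (h^-1 *: (f (x + h) - f x) - d)); last first.
  by rewrite mulrBr [d * h]mulrC [h^-1 *: _]/(h^-1 * _) mulVKf.
by rewrite normrM mulrC ler_wpM2r// distrC.
Qed.

Lemma cexpD w z : cexp (w + z) = cexp w * cexp z.
Proof.
case: w z => [a b] [c d]; apply/eqP; rewrite eq_complex /= expRD cosD sinD.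
by apply/andP; split; apply/eqP; ring.
Qed.

Lemma cderiv_cexp0 : cderiv cexp 0 1.
Proof.
(* Each component of the error is at most 3 e1 m, so e / 8 is small enough; e1 <= 1 yields |exp x|
   <= 2. *)
move=> e e0; pose e1 := Num.min 1 (e / 8).
have e10 : 0 < e1 by rewrite lt_min ltr01 divr_gt0.
have e11 : e1 <= 1 by rewrite ge_min lexx.
have e1e : e1 <= e / 8 by rewrite ge_min lexx orbT.
have [d1 d10 hexp] := real_deriv_approx (is_derive_expR (0 : R)) e10.
have [d2 d20 hcos] := real_deriv_approx (is_derive_cos (0 : R)) e10.
have [d3 d30 hsin] := real_deriv_approx (is_derive_sin (0 : R)) e10.
exists (Num.min (Num.min d1 d2) (Num.min d3 (e1 / 2))) => [|[x y]].
  by rewrite !lt_min d10 d20 d30 divr_gt0.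
rewrite subr0 !lt_min => /andP[/andP[w1 w2] /andP[w3 w4]].
have xw := Re_le_modulus (x +i* y)%C; have yw := Im_le_modulus (x +i* y)%C.
rewrite /= in xw yw.
move: (hexp _ (le_lt_trans xw w1)) (hcos _ (le_lt_trans yw w2)) (hsin _ (le_lt_trans yw w3)).
rewrite !add0r expR0 cos0 sin0 subr0 !mul1r oppr0 mul0r subr0 => hx hc hs.
set m := modulus _ in w1 w2 w3 w4 xw yw *.
have m0 : 0 <= m by exact: modulus_ge0.
have hc' : `|cos y - 1| <= e1 * m by rewrite (le_trans hc)// ler_wpM2l// ltW.
have hs' : `|sin y - y| <= e1 * m by rewrite (le_trans hs)// ler_wpM2l// ltW.
have hx' : `|expR x - 1 - x| <= e1 * m by rewrite (le_trans hx)// ler_wpM2l// ltW.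
have e1m : e1 * m <= m by rewrite ler_piMl.
have hx1 : `|expR x - 1| <= e1.
  rewrite -[_ - 1](subrK x) (le_trans (ler_normD _ _))// (le_trans (lerD hx' xw))//; lra.
have hx2 : `|expR x| <= 2.
  rewrite -[expR x](subrK 1) (le_trans (ler_normD _ _))// normr1; lra.
rewrite (le_trans (modulus_le_ReIm _))// /cexp /circ /= expR0 cos0 sin0 ?mulr1 ?mulr0 ?mul1r ?mul0r ?subr0 ?addr0 ?add0r ?subr0.
have -> : expR x * cos y - 1 - x = (expR x - 1 - x) + expR x * (cos y - 1) by ring.
have -> : expR x * sin y - y = expR x * (sin y - y) + (expR x - 1) * y by ring.
have h1 : `|expR x - 1 - x + expR x * (cos y - 1)| <= e1 * m + 2 * (e1 * m).
  rewrite (le_trans (ler_normD _ _))// lerD// normrM ler_pM//.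
have h2 : `|expR x * (sin y - y) + (expR x - 1) * y| <= 2 * (e1 * m) + e1 * m.
  rewrite (le_trans (ler_normD _ _))// !normrM lerD// ler_pM//.
rewrite (le_trans (lerD h1 h2))//.
apply: (@le_trans _ _ (8 * (e1 * m))).
  have := mulr_ge0 (ltW e10) m0; lra.
by rewrite mulrA ler_wpM2r//; lra.
Qed.

Lemma cderiv_cexp w : cderiv cexp w (cexp w).
Proof.
have w0 : 0 < modulus (cexp w) by rewrite /cexp modulus_circ ?expR_gt0// expR_ge0.
move=> e e0; have [d d0 h] := cderiv_cexp0 (divr_gt0 e0 w0).
exists d => // z zw; have := h (z - w); rewrite subr0 mul1r => /(_ zw) hz.
have -> : cexp z - cexp w - cexp w * (z - w) = cexp w * (cexp (z - w) - cexp 0 - (z - w)).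
  rewrite {1}(_ : z = w + (z - w)) ?cexpD; last by rewrite addrC subrK.
  rewrite (_ : cexp 0 = 1); first by ring.
  by rewrite /cexp /circ /= expR0 cos0 sin0 mulr0 mulr1.
rewrite modulusM (le_trans (ler_wpM2l (ltW w0) hz))// mulrA.
by rewrite mulrCA divff ?gt_eqF// mulr1.
Qed.

Lemma continuous_min_cst (X : R) : continuous (fun x : R => Num.min x X).
Proof.
move=> x; apply/cvgrPdist_lt => e e0; near=> y.
have : `|x - y| < e by near: y; exact: cvgr_dist_lt.
apply: le_lt_trans; rewrite /Num.min.
by case: ltP => h1; case: ltP => h2; rewrite ler_norml; apply/andP; split;
  have := ler_norm (x - y); have := ler_norm (y - x); rewrite distrC; lra.
Unshelve. all: by end_near. Qed.

(** The origin is left out to admit the integrands [F z / z ^+ n]. *)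
Definition punctured_continuous g :=
  forall z, modulus z < 1 -> z != 0 -> g w @[w --> z] --> g z.

Lemma continuous_circle g s : punctured_continuous g -> 0 < s < 1 ->
  continuous (fun t => g (circ s t)).
Proof.
move=> cg /andP[s0 s1] t; apply: (@continuous_comp _ _ _ (fun t => circ s t) g).
  by apply: (@circ_cvg _ (fun=> s) id); [exact: cvg_cst|exact: cvg_id].
by apply: cg; rewrite ?modulus_circ ?circ_neq0// ltW.
Qed.

(** Not divided by 2 pi; the normalising factor appears in the values instead. *)
Definition cmean g s : C := cint 0 (pi *+ 2) (fun t => g (circ s t)).

Lemma pi2_ge0 : 0 <= pi *+ 2 :> R.
Proof. by rewrite mulrn_wge0// pi_ge0. Qed.

(** The exponential pulls the annulus back to a rectangle of height 2 pi, whose vertical sides give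
    the two means and whose horizontal sides cancel. *)
Lemma cmean_const g s1 s2 : punctured_continuous g -> 0 < s1 -> s1 <= s2 -> s2 < 1 ->
  (forall z, s1 <= modulus z <= s2 -> exists d, cderiv g z d) ->
  cmean g s1 = cmean g s2.
Proof.
move=> cg s10 s12 s21 dg; have s20 := lt_le_trans s10 s12.
pose X := ln s2 / 2.
have lns2 : ln s2 < 0 by rewrite ln_lt0// s20.
have X0 : X < 0 by rewrite /X; lra.
have X2 : ln s2 < X by rewrite /X; lra.
(* [goursat] asks for continuity on the whole plane, whereas g is controlled in the unit disk only.
   Capping the real part at X < 0 keeps the argument inside, and X > ln s2 leaves g composed with
   [cexp] unchanged near the rectangle. *)
pose E (w : C) := circ (expR (Num.min (complex.Re w) X)) (complex.Im w).
pose H w := g (E w).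
have cH : continuous H.
  move=> w; apply: (@continuous_comp _ _ _ E g).
    apply: (@circ_cvg _ (fun w : C => expR (Num.min (complex.Re w) X)) (fun w : C => complex.Im w)).
      apply: (@continuous_comp _ _ _ (fun w : C => Num.min (complex.Re w) X) expR); last exact: continuous_expR.
      apply: (@continuous_comp _ _ _ (fun w : C => complex.Re w) (fun x => Num.min x X)); last exact: continuous_min_cst.
      exact: continuous_Re.
    exact: continuous_Im.
  apply: cg; rewrite ?modulus_circ ?circ_neq0 ?expR_gt0 ?expR_ge0//.
  by rewrite expR_lt1 (le_lt_trans _ X0)// ge_min lexx orbT.
have HE x y : x <= ln s2 -> H (x +i* y)%C = g (circ (expR x) y).
  by move=> xs; rewrite /H /E /= min_l// (le_trans xs)// ltW.
have xs12 : ln s1 <= ln s2 by rewrite ler_ln.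
have [lnK1 lnK2] : expR (ln s1) = s1 /\ expR (ln s2) = s2 by rewrite !lnK.
have rect0 : rect H (ln s1) (ln s2) 0 (pi *+ 2) = 0.
  apply: goursat => //; first exact: pi2_ge0.
  move=> x y /andP[x1 x2] _.
  have [d hd] : exists d, cderiv g (cexp (x +i* y)%C) d.
    apply: dg; rewrite modulus_circ ?expR_ge0//; apply/andP.
    by split; [rewrite -lnK1 ler_expR|rewrite -lnK2 ler_expR].
  exists (d * cexp (x +i* y)%C).
  apply: (@cderiv_near _ (g \o cexp)); last by apply: cderiv_comp hd; exact: cderiv_cexp.
  apply/modulus_nbhsP; exists (X - x); first by rewrite subr_gt0 (le_lt_trans x2).
  move=> [a b] wx; rewrite /H /E /cexp /= min_l//.
  have := le_lt_trans (Re_le_modulus _) wx; rewrite /= ltr_norml => /andP[_ h].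
  by rewrite ltW// -(ltrD2r (- x)).
have cVl x := @continuous_vline R H x cH.
move: rect0; rewrite /rect.
(* Both horizontal sides carry the same values, as [cos] and [sin] have period 2 pi. *)
rewrite (@eq_cint _ _ _ (fun x => H (x +i* (pi *+ 2))%C) (fun x => H (x +i* 0)%C)); last first.
  by move=> x; rewrite /H /E /circ /= cos2pi sin2pi cos0 sin0.
move: (cint (ln s1) (ln s2) _) => A; rewrite (subrr A) subr0 => /eqP.
rewrite mulf_eq0 => /orP[/eqP|].
  by move=> /(congr1 (@complex.Im R)) /= /eqP; rewrite oner_eq0.
rewrite subr_eq0 => /eqP hh; rewrite /cmean -[in LHS]lnK1 -[in RHS]lnK2.
transitivity (cint 0 (pi *+ 2) (fun y => H (ln s1 +i* y)%C)).
  by apply: eq_cint => y; rewrite HE.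
by rewrite -hh; apply: eq_cint => y; rewrite HE.
Qed.

Lemma cmean_cvg g s : punctured_continuous g -> 0 < s < 1 ->
  forall e : R, 0 < e -> exists2 d : R, 0 < d & forall s', 0 < s' < 1 -> `|s' - s| < d ->
    modulus (cmean g s' - cmean g s) <= e.
Proof.
move=> cg s01 e e0; have [s0 s1] := andP s01.
pose e1 := e / (2 * (pi *+ 2)).
have pi20 : 0 < pi *+ 2 :> R by rewrite mulrn_wgt0 ?pi_gt0.
have e10 : 0 < e1 by rewrite divr_gt0// mulr_gt0.
(* The near-covering form of compactness makes continuity in the radius uniform in the angle. *)
have h : \forall s' \near s, `[0, pi *+ 2] `<=`
    [set t | modulus (g (circ s' t) - g (circ s t)) < e1].
  apply: (proj1 (compact_near_coveringP _) (@segment_compact R 0 (pi *+ 2)) R (nbhs s)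
    (fun s' t => modulus (g (circ s' t) - g (circ s t)) < e1)) => t _.
  have cst : modulus (circ s t) < 1 /\ circ s t != 0.
    by rewrite modulus_circ ?circ_neq0 ?ltW.
  have e20 : 0 < e1 / 2 by rewrite divr_gt0.
  have c1 : {for (t, s), continuous (fun u : R * R => g (circ u.2 u.1))}.
    apply: (@continuous_comp _ _ _ (fun u : R * R => circ u.2 u.1) g); last exact: cg cst.1 cst.2.
    by apply: (@circ_cvg _ (fun u : R * R => u.2) (fun u : R * R => u.1)); [exact: cvg_snd|exact: cvg_fst].
  have c2 : {for (t, s), continuous (fun u : R * R => g (circ s u.1))}.
    apply: (@continuous_comp _ _ _ (fun u : R * R => circ s u.1) g); last exact: cg cst.1 cst.2.
    by apply: (@circ_cvg _ (fun u : R * R => s) (fun u : R * R => u.1)); [exact: cvg_cst|exact: cvg_fst].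
  move/(@modulus_cvgP _ _ (nbhs (t, s)))/(_ _ e20) : c1 => c1.
  move/(@modulus_cvgP _ _ (nbhs (t, s)))/(_ _ e20) : c2 => c2.
  apply: filterS2 c1 c2 => -[t' s'] /= h1 h2.
  rewrite (_ : _ - _ = (g (circ s' t') - g (circ s t)) - (g (circ s t') - g (circ s t))); last first.
    by rewrite opprB addrA subrK.
  by rewrite (le_lt_trans (modulusB_le _ _))// (splitr e1) ltrD.
move: h => /nbhs_ballP[d /= d0 hd]; exists d => // s' s'01 s's.
have cs' := continuous_circle cg s'01; have cs := continuous_circle cg s01.
rewrite /cmean -cintB//.
have := @cint_bound R 0 (pi *+ 2) (fun t => g (circ s' t) - g (circ s t)) e1 pi2_ge0 (ccontB cs' cs).
rewrite subr0 (_ : 2 * (e1 * _) = e); first apply.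
  move=> t t01; apply/ltW; apply: (hd s'); first by rewrite /ball /= distrC.
  by rewrite /= in_itv.
by rewrite mulrCA mulfVK// mulf_neq0// gt_eqF.
Qed.

Lemma cmean_at0 g : punctured_continuous g -> g w @[w --> 0] --> g 0 ->
  forall e : R, 0 < e -> exists2 d : R, 0 < d & forall s, 0 < s < 1 -> s < d ->
    modulus (cmean g s - g 0 * (pi *+ 2)%:C%C) <= e.
Proof.
move=> cg /(@modulus_cvgP _ _ (nbhs (0 : C))) g0 e e0.
have pi20 : 0 < pi *+ 2 :> R by rewrite mulrn_wgt0 ?pi_gt0.
pose e1 := e / (2 * (pi *+ 2)).
have e10 : 0 < e1 by rewrite divr_gt0// mulr_gt0.
have /modulus_nbhsP[d d0 hd] := g0 e1 e10; exists d => // s s01 sd.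
have [s0 s1] := andP s01.
have := @cint_cst R 0 (pi *+ 2) (g 0) pi2_ge0; rewrite subr0 => <-.
have cs := continuous_circle cg s01; have cc := @ccont_cst R R (g 0).
rewrite /cmean -cintB//.
have := @cint_bound R 0 (pi *+ 2) (fun t => g (circ s t) - g 0) e1 pi2_ge0 (ccontB cs cc).
rewrite subr0 (_ : 2 * (e1 * _) = e); first apply.
  by move=> t _; apply/ltW; apply: hd; rewrite subr0 modulus_circ ?ltW.
by rewrite mulrCA mulfVK// mulf_neq0// gt_eqF.
Qed.

Lemma modulus_small (z w : C) : (forall e : R, 0 < e -> modulus (z - w) <= e) -> z = w.
Proof.
move=> h; apply/eqP; rewrite -subr_eq0 -modulus_eq0 eq_le modulus_ge0 andbT.
by apply/ler_addgt0Pr => e /h; rewrite add0r.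
Qed.

(* The exceptional circle of radius [rho] is crossed by continuity of the mean. *)
Lemma mean_value g (rho : R) : (forall z, modulus z < 1 -> g w @[w --> z] --> g z) ->
  (forall z, modulus z < 1 -> z != 0 -> modulus z != rho -> exists d, cderiv g z d) ->
  forall s, 0 < s < 1 -> cmean g s = g 0 * (pi *+ 2)%:C%C.
Proof.
move=> cg0 dg; have cg : punctured_continuous g by move=> z z1 _; exact: cg0.
have g00 : g w @[w --> 0] --> g 0 by apply: cg0; rewrite modulus0.
have const s1 s2 : 0 < s1 -> s1 <= s2 -> s2 < 1 ->
    (forall s, s1 <= s <= s2 -> s != rho) -> cmean g s1 = cmean g s2.
  move=> s10 s12 s21 hr; apply: cmean_const => // z /[dup] /hr zr /andP[z1 z2].
  by apply: dg => //; [exact: le_lt_trans z2 s21|rewrite -modulus_gt0 (lt_le_trans s10)].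
(* The alternative rho <= 0 covers the absence of an exceptional circle, as for powers of z, where
   rho is -1. *)
have inner s : 0 < s < 1 -> s < rho \/ rho <= 0 -> cmean g s = g 0 * (pi *+ 2)%:C%C.
  move=> s01 sr; have [s0 s1] := andP s01; apply: modulus_small => e e0.
  have [d d0 hd] := cmean_at0 cg g00 e0.
  pose s' := Num.min s (d / 2).
  have s'0 : 0 < s' by rewrite lt_min s0 divr_gt0.
  have s's : s' <= s by rewrite ge_min lexx.
  rewrite -(const s' s)//; last first.
    move=> u /andP[u1 u2]; case: sr => sr; first by rewrite lt_eqF// (le_lt_trans u2).
    by rewrite gt_eqF// (le_lt_trans sr)// (lt_le_trans s'0).
  apply: hd; first by rewrite s'0 (le_lt_trans s's).
  by rewrite /s' gt_min; apply/orP; right; lra.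
have at_rho : 0 < rho < 1 -> cmean g rho = g 0 * (pi *+ 2)%:C%C.
  move=> r01; have [r0 r1] := andP r01; apply: modulus_small => e e0.
  have [d d0 hd] := cmean_cvg cg r01 e0.
  pose s' := Num.max (rho / 2) (rho - d / 2).
  have s'r : s' < rho by rewrite gt_max; apply/andP; split; lra.
  have s'0 : 0 < s' by rewrite lt_max divr_gt0.
  have s'01 : 0 < s' < 1 by rewrite s'0 (lt_trans s'r).
  rewrite -(inner s' s'01); last by left.
  rewrite modulusBC; apply: hd => //.
  have : rho - d / 2 <= s' by rewrite le_max lexx orbT.
  by rewrite ltr_norml => ?; apply/andP; split; lra.
move=> s s01; have [s0 s1] := andP s01.
have [sr|rs|srho] := ltgtP s rho.
- by apply: inner => //; left.
- have [r0|r0] := leP rho 0; first by apply: inner => //; right.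
  have r01 : 0 < rho < 1 by rewrite r0 (lt_trans rs).
  rewrite -at_rho//; apply: modulus_small => e e0.
  have [d d0 hd] := cmean_cvg cg r01 e0.
  pose s' := Num.min s (rho + d / 2).
  have rs' : rho < s' by rewrite lt_min rs; lra.
  have s's : s' <= s by rewrite ge_min lexx.
  have s'0 : 0 < s' by exact: lt_trans rs'.
  rewrite -(const s' s)//; last first.
    by move=> u /andP[u1 _]; rewrite gt_eqF// (lt_le_trans rs').
  apply: hd; first by rewrite s'0 (le_lt_trans s's).
  have : s' <= rho + d / 2 by rewrite ge_min lexx orbT.
  by rewrite ltr_norml => ?; apply/andP; split; lra.
- by rewrite srho; apply: at_rho; rewrite -srho.
Qed.

Lemma cmeanE g s : cmean g s = cint 0 (pi *+ 2) (fun t => g (circ s t)).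
Proof. by []. Qed.

Implicit Types h : C -> C.

Lemma pcont_cst (k : C) : punctured_continuous (fun=> k).
Proof. by move=> z _ _; exact: (@ccont_cst R _ k z). Qed.

Lemma pcontD g h : punctured_continuous g -> punctured_continuous h ->
  punctured_continuous (fun z => g z + h z).
Proof. by move=> cg ch z z1 z0; exact: (ccvgD _ (cg z z1 z0) (ch z z1 z0)). Qed.

Lemma pcontM g h : punctured_continuous g -> punctured_continuous h ->
  punctured_continuous (fun z => g z * h z).
Proof. by move=> cg ch z z1 z0; exact: (ccvgM _ (cg z z1 z0) (ch z z1 z0)). Qed.

Lemma eq_cmean g h s : 0 < s -> (forall z, modulus z = s -> g z = h z) ->
  cmean g s = cmean h s.
Proof.
by move=> s0 gh; apply: eq_cint => t; apply: gh; rewrite modulus_circ// ltW.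
Qed.

Lemma cmeanD g h s : punctured_continuous g -> punctured_continuous h -> 0 < s < 1 ->
  cmean (fun z => g z + h z) s = cmean g s + cmean h s.
Proof.
by move=> cg ch s01; exact: (cintD _ _ (continuous_circle cg s01) (continuous_circle ch s01)).
Qed.

Lemma cmeanZ (k : C) g s : punctured_continuous g -> 0 < s < 1 ->
  cmean (fun z => k * g z) s = k * cmean g s.
Proof. by move=> cg s01; exact: (cintZ _ _ _ (continuous_circle cg s01)). Qed.

Lemma cmean_cst (k : C) s : cmean (fun=> k) s = k * (pi *+ 2)%:C%C.
Proof. by rewrite /cmean cint_cst ?pi2_ge0// subr0. Qed.

Lemma cmean_bound g s (B : R) : punctured_continuous g -> 0 < s < 1 ->
  (forall z, modulus z = s -> modulus (g z) <= B) ->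
  modulus (cmean g s) <= 2 * (B * (pi *+ 2)).
Proof.
move=> cg s01 gB; have [s0 s1] := andP s01.
have := cint_bound pi2_ge0 (continuous_circle cg s01); rewrite subr0; apply.
by move=> t _; apply: gB; rewrite modulus_circ// ltW.
Qed.

End circle_means.

#[global] Opaque cmean.

(** * Cauchy's formula and Taylor coefficients *)

Section cauchy.
Variable R : realType.
Local Notation C := (Cplx R).
Variables (f : disk R -> C) (hf : holomorphic f).
Local Notation F := (ext f).
Local Notation tau := ((pi *+ 2)%:C%C : C).

Lemma ext_cderiv z : modulus z < 1 -> exists d, cderiv F z d.
Proof. by move=> z1; exists (derive1 F z); apply: derivable_cderiv; exact: hf. Qed.

Lemma ext_cvg z : modulus z < 1 -> F w @[w --> z] --> F z.
Proof. by move=> /ext_cderiv[d]; exact: cderiv_cvg. Qed.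

Lemma ext_modulus_le z (r : R) : modulus z <= r -> r < 1 -> modulus (F z) <= M_infty f r.
Proof.
move=> zr r1; have zD : z \in disk R by rewrite inE /disk /=; exact: le_lt_trans r1.
rewrite (extE f (exist _ z zD)); apply: M_infty_ub => //=.
by rewrite r1 andbT (le_trans _ zr)// modulus_ge0.
Qed.

Lemma derivable_expV n (z : C) : z != 0 -> derivable (fun w : C => (w ^+ n)^-1) z 1.
Proof.
move=> z0; apply: derivableV; first by rewrite expf_neq0.
exact: exprn_derivable.
Qed.

Lemma continuous_conjc : continuous (@conjc R : C -> C).
Proof.
move=> z; apply/(@modulus_cvgP _ _ (nbhs z)) => e e0; apply/modulus_nbhsP; exists e => // w.
by rewrite -rmorphB /= /modulus !normc_def; case: (w - z) => a b /=; rewrite sqrrN.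
Qed.

Lemma pcont_ext : punctured_continuous F.
Proof. by move=> z z1 _; exact: ext_cvg. Qed.

Lemma pcont_expV n : punctured_continuous (fun z : C => (z ^+ n)^-1).
Proof.
move=> z _ z0.
exact: (@cderiv_cvg R (fun z : C => (z ^+ n)^-1) z _ (derivable_cderiv (@derivable_expV n z z0))).
Qed.

(** The contour formula for the n-th coefficient, with integrand F(z) / z^(n+1) dz and dz / z = i
    dt. *)
Definition cauchy_coef n (s : R) : C := cmean (fun z => F z / z ^+ n) s / tau.

Lemma punctured_quot n : punctured_continuous (fun z => F z / z ^+ n).
Proof.
exact: (pcontM pcont_ext (@pcont_expV n)).
Qed.

Lemma cauchy_coef_const n (s1 s2 : R) : 0 < s1 < 1 -> 0 < s2 < 1 ->
  cauchy_coef n s1 = cauchy_coef n s2.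
Proof.
wlog s12 : s1 s2 / s1 <= s2 => [h h1 h2|].
  have [s12|/ltW s21] := leP s1 s2; first exact: h s12 h1 h2.
  exact/esym/(h _ _ s21 h2 h1).
move=> /andP[s10 s11] /andP[s20 s21]; rewrite /cauchy_coef.
rewrite (@cmean_const R _ s1 s2 (@punctured_quot n) s10 s12 s21)//.
move=> z /andP[z1 z2]; have z0 : z != 0 by rewrite -modulus_gt0 (lt_le_trans s10).
have zn := @derivable_expV n z z0.
have zF : derivable F z 1 by apply: hf; exact: le_lt_trans s21.
eexists; apply: derivable_cderiv; exact: derivableM zF zn.
Qed.

Lemma tau_neq0 : tau != 0.
Proof. by rewrite -modulus_gt0 modulus_real normr_gt0 gt_eqF// mulrn_wgt0 ?pi_gt0. Qed.

(** On the circle of radius s, 1/z is the conjugate of z divided by s^2; the mean is thus a multiple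
    of the conjugate of that of z^(n+1), which vanishes by the mean value property. *)
Lemma cmean_expV n (s : R) : 0 < s < 1 -> cmean (fun z => (z ^+ n.+1)^-1) s = 0.
Proof.
move=> s01; have [s0 s1] := andP s01.
have cX : continuous (fun z : C => z ^+ n.+1).
  by move=> z; apply: (@cderiv_cvg R (fun z : C => z ^+ n.+1)); apply: derivable_cderiv; exact: exprn_derivable.
have mX : cmean (fun z => z ^+ n.+1) s = 0.
  have dX (z : C) : modulus z < 1 -> z != 0 -> modulus z != -1 ->
      exists d, cderiv (fun z : C => z ^+ n.+1) z d.
    by move=> _ _ _; eexists; apply: derivable_cderiv; exact: exprn_derivable.
  have := @mean_value R (fun z => z ^+ n.+1) (-1) (fun z _ => cX z) dX s s01.
  by rewrite expr0n mul0r.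
have cc : continuous (fun t => (circ s t) ^+ n.+1).
  by apply: (@continuous_circle R (fun z => z ^+ n.+1)) => // z _ _; exact: cX.
have circV t : (circ s t)^-1 = (s ^- 2)%:C%C * conjc (circ s t) :> C.
  apply: (mulfI (circ_neq0 t s0)); rewrite divff ?circ_neq0//.
  have s2 : s ^+ 2 != 0 by rewrite expf_neq0// gt_eqF.
  have c2 : s ^+ 2 * (cos t ^+ 2 + sin t ^+ 2) = s ^+ 2 by rewrite cos2Dsin2 mulr1.
  apply/eqP; rewrite eq_complex /circ /=; apply/andP; split; apply/eqP; last by ring.
  by rewrite -[LHS](mulfV s2) -{1}c2; ring.
rewrite cmeanE (@eq_cint _ _ _ _ (fun t => ((s ^- 2)%:C%C : C) ^+ n.+1 * conjc ((circ s t) ^+ n.+1))); last first.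
  by move=> t; rewrite -exprVn circV exprMn rmorphXn.
have ccj : continuous (fun t => conjc ((circ s t) ^+ n.+1) : C).
  move=> t; apply: (@continuous_comp _ _ _ (fun t => circ s t ^+ n.+1) (@conjc R : C -> C)).
    exact: cc.
  exact: continuous_conjc.
rewrite cintZ; last exact: ccj.
rewrite cint_conj; last exact: cc.
by have := mX; rewrite cmeanE => ->; rewrite rmorph0 mulr0.
Qed.

(* The singularity at [l] is removable, and the factor [z] makes the value at 0
   vanish, hence also the means over circles. *)
Definition cauchy_quot (l z : C) : C :=
  if z == l then l * derive1 F l else z * (F z - F l) / (z - l).

Lemma cauchy_quot_near (l z : C) : z != l ->
  \forall w \near z, w * (F w - F l) / (w - l) = cauchy_quot l w.
Proof.
move=> zl; apply/modulus_nbhsP; exists (modulus (z - l)).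
  by rewrite modulus_gt0 subr_eq0.
move=> w wz; rewrite /cauchy_quot; case: eqP => // wl.
by move: wz; rewrite wl modulusBC ltxx.
Qed.

Lemma cauchy_quot_cderiv (l z : C) : modulus z < 1 -> z != l ->
  exists d, cderiv (cauchy_quot l) z d.
Proof.
move=> z1 zl; have zl0 : z - l != 0 by rewrite subr_eq0.
have dF : derivable F z 1 := hf z1.
have dI : derivable (fun w : C => w) z 1 by exact: derivable_id.
have dc k : derivable (fun _ : C => k : C) z 1 by exact: derivable_cst.
have d1 : derivable (fun w : C => F w - F l : C) z 1 := derivableB dF (dc (F l)).
have d2 : derivable (fun w : C => w * (F w - F l) : C) z 1 := derivableM dI d1.
have d3 : derivable (fun w : C => w - l : C) z 1 := derivableB dI (dc l).
have d4 : derivable (fun w : C => (w - l)^-1 : C) z 1 .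
  by apply: derivableV; [exact: zl0|exact: d3].
have d5 : derivable (fun w : C => w * (F w - F l) / (w - l) : C) z 1 := derivableM d2 d4.
eexists; apply: cderiv_near (cauchy_quot_near zl) _; exact: derivable_cderiv d5.
Qed.

Lemma cauchy_quot_cvg (l z : C) : modulus l < 1 -> modulus z < 1 ->
  cauchy_quot l w @[w --> z] --> cauchy_quot l z.
Proof.
move=> l1 z1; have [->|zl] := eqVneq z l; last first.
  by have [d] := cauchy_quot_cderiv z1 zl; exact: cderiv_cvg.
have cl : (fun w => w * derive1 F l) w @[w --> l] --> l * derive1 F l.
  exact: (ccvgM _ (@cvg_id _ (nbhs l)) (cvg_cst (derive1 F l))).
apply/(@modulus_cvgP _ _ (nbhs l)) => e e0.
have e20 : 0 < e / 2 by rewrite divr_gt0.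
have l10 : 0 < 1 + modulus l by rewrite ltr_pwDl// modulus_ge0.
move/(@modulus_cvgP _ _ (nbhs l))/(_ _ e20)/modulus_nbhsP : cl => [d1 d10 h1].
(* The factor w of the quotient is at most 1 + |l| as soon as |w - l| < 1, hence this tolerance for
   the derivative. *)
have e30 : 0 < e / 2 / (2 * (1 + modulus l)) by rewrite divr_gt0// mulr_gt0.
have [d2 d20 h2] := derivable_cderiv (hf l1) e30.
apply/modulus_nbhsP; exists (Num.min (Num.min d1 d2) 1) => [|w].
  by rewrite !lt_min d10 d20 ltr01.
rewrite !lt_min => /andP[/andP[w1 w2] w3].
have [->|wl] := eqVneq w l; first by rewrite subrr modulus0.
rewrite /cauchy_quot eqxx (negbTE wl).
have wl0 : w - l != 0 by rewrite subr_eq0.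
have -> : w * (F w - F l) / (w - l) - l * derive1 F l =
   w * ((F w - F l - derive1 F l * (w - l)) / (w - l)) +
   (w * derive1 F l - l * derive1 F l) by field.
rewrite (le_lt_trans (modulusD_le _ _))// (splitr e) ler_ltD//; last exact: h1.
rewrite !modulusM modulusV.
have wle : modulus w <= 1 + modulus l.
  by rewrite -[w](subrK l) (le_trans (modulusD_le _ _))// lerD2r ltW.
rewrite mulrA ler_pdivrMr ?modulus_gt0//.
apply: le_trans (ler_pM _ _ wle (h2 _ w2)) _; rewrite ?modulus_ge0//.
rewrite mulrA ler_wpM2r ?modulus_ge0// invfM mulrA mulrCA.
by rewrite mulrAC divff ?gt_eqF// mul1r; lra.
Qed.

(** The circle through l is taken as the exceptional one of [mean_value]: at l itself only
    continuity is established. *)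
Lemma cauchy_kernel_mean (l : C) (s : R) : modulus l < s -> s < 1 ->
  cmean (cauchy_quot l) s = 0.
Proof.
move=> ls s1; have l1 := lt_trans ls s1.
have s01 : 0 < s < 1 by rewrite s1 (le_lt_trans (modulus_ge0 l)).
have cq z (z1 : modulus z < 1) := cauchy_quot_cvg l1 z1.
have dq z : modulus z < 1 -> z != 0 -> modulus z != modulus l ->
    exists d, cderiv (cauchy_quot l) z d.
  by move=> z1 _ zl; apply: cauchy_quot_cderiv => //; apply: contra_neq zl => ->.
rewrite (mean_value cq dq s01) /cauchy_quot.
by case: eqVneq => [<-|_]; rewrite !mul0r.
Qed.

Lemma pcont_trunc (l : C) M :
  punctured_continuous (fun z => (F z - F l) * \sum_(n < M.+1) l ^+ n / z ^+ n).
Proof.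
apply: (@pcontM R (fun z => F z - F l) (fun z => \sum_(n < M.+1) l ^+ n / z ^+ n)).
  exact: (@pcontD R F (fun=> - F l) pcont_ext (@pcont_cst R (- F l))).
elim: M => [|M IH].
  under eq_fun do rewrite big_ord1 expr0 expr0 divr1; exact: pcont_cst.
under eq_fun do rewrite big_ord_recr /=.
exact: (@pcontD R _ _ IH (@pcontM R _ _ (@pcont_cst R (l ^+ M.+1)) (@pcont_expV M.+1))).
Qed.

(** The sum is the truncated expansion of z / (z - l). Negative powers of z have mean zero, so the
    constant F l contributes through n = 0 only. *)
Lemma cauchy_partial_sum (l : C) (s : R) N : 0 < s < 1 ->
  cmean (fun z => (F z - F l) * \sum_(n < N.+1) l ^+ n / z ^+ n) s =
  tau * (psum (cauchy_coef^~ s) N.+1 l - F l).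
Proof.
move=> s01; have [s0 s1] := andP s01.
have coefE n : cmean (fun z => F z / z ^+ n) s = tau * cauchy_coef n s.
  by rewrite /cauchy_coef mulrC divfK// tau_neq0.
have cG := @pcont_trunc l.
elim: N => [|N IH].
  rewrite (@eq_cmean _ _ (fun z => F z / z ^+ 0 + (- F l)) s s0); last first.
    by move=> z _; rewrite big_ord1 !expr0 divr1 mulr1 divr1.
  rewrite (cmeanD (@punctured_quot 0) (@pcont_cst R (- F l)) s01) coefE cmean_cst.
  by rewrite /psum big_ord1 expr0 mulr1; ring.
rewrite (@eq_cmean _ _ (fun z => (F z - F l) * (\sum_(n < N.+1) l ^+ n / z ^+ n) +
   (l ^+ N.+1 * (F z / z ^+ N.+1) + (- (F l * l ^+ N.+1)) * (z ^+ N.+1)^-1)) s s0); last first.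
  by move=> z _; rewrite [in LHS]big_ord_recr /=; ring.
have c1 := @pcontM R _ _ (@pcont_cst R (l ^+ N.+1)) (@punctured_quot N.+1).
have c2 := @pcontM R _ _ (@pcont_cst R (- (F l * l ^+ N.+1))) (@pcont_expV N.+1).
rewrite (cmeanD (cG N) (@pcontD R _ _ c1 c2) s01) (cmeanD c1 c2 s01).
rewrite (cmeanZ _ (@punctured_quot N.+1) s01) (cmeanZ _ (@pcont_expV N.+1) s01).
rewrite IH cmean_expV// mulr0 addr0 coefE (psumS _ N.+1).
by ring.
Qed.

Lemma geometric_kernel (l z : C) N : z != 0 -> z != l ->
  z / (z - l) = \sum_(n < N) l ^+ n / z ^+ n + (l / z) ^+ N * (z / (z - l)).
Proof.
move=> z0 zl; have zl0 : z - l != 0 by rewrite subr_eq0.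
elim: N => [|N {1}->]; first by rewrite big_ord0 expr0 mul1r add0r.
rewrite big_ord_recr /= -addrA; congr (_ + _).
rewrite -expr_div_n exprSr; move: ((l / z) ^+ N) => q; field.
by rewrite ?z0 ?zl0.
Qed.

(** (F z - F l) z / (z - l) has mean zero; removing the truncated geometric series from the kernel
    leaves the factor (l / z)^(N+1). *)
Lemma cauchy_approx (l : C) (s : R) : modulus l < s -> s < 1 ->
  exists2 B : R, 0 <= B & forall N,
    modulus (F l - psum (cauchy_coef^~ s) N.+1 l) <= B * (modulus l / s) ^+ N.+1.
Proof.
move=> ls s1; have s0 := le_lt_trans (modulus_ge0 l) ls.
have s01 : 0 < s < 1 by rewrite s0.
have l1 := lt_trans ls s1.
have pi20 : 0 < pi *+ 2 :> R by rewrite mulrn_wgt0 ?pi_gt0.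
(* On |z| = s, |F z - F l| is at most the first factor and |z / (z - l)| at most the second. *)
pose K := (M_infty f s + modulus (F l)) * (s / (s - modulus l)).
have sl0 : 0 < s - modulus l by rewrite subr_gt0.
have M0 : 0 <= M_infty f s by apply: M_infty_ge0 => //; rewrite s1 ltW.
have K0 : 0 <= K.
  by rewrite mulr_ge0 ?addr_ge0 ?modulus_ge0// divr_ge0// ltW.
exists (2 * K) => [|N]; first by rewrite mulr_ge0.
have zl0 z : modulus z = s -> z != 0 /\ z != l.
  move=> zs; split; first by rewrite -modulus_gt0 zs.
  by apply: contraTneq ls => <-; rewrite zs ltxx.
have cG := @pcontM R _ _ (@pcont_cst R (-1)) (@pcont_trunc l N).
have cQ : punctured_continuous (cauchy_quot l).
  by move=> z z1 _; exact: cauchy_quot_cvg.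
have := cmean_bound (@pcontD R _ _ cQ cG) s01.
move=> /(_ (K * (modulus l / s) ^+ N.+1)).
rewrite (cmeanD cQ cG s01) cauchy_kernel_mean// add0r.
have -> : cmean (fun z => (-1) * ((F z - F l) * \sum_(n < N.+1) l ^+ n / z ^+ n)) s =
    tau * (F l - psum (cauchy_coef^~ s) N.+1 l).
  by rewrite (cmeanZ _ (@pcont_trunc l N) s01) cauchy_partial_sum//; ring.
rewrite modulusM modulus_real (ger0_norm (ltW pi20)) => h.
have {}h : (pi *+ 2) * modulus (F l - psum (cauchy_coef^~ s) N.+1 l) <=
    2 * (K * (modulus l / s) ^+ N.+1 * (pi *+ 2)).
  apply: h => z zs; have [z0 zl] := zl0 z zs.
  rewrite /cauchy_quot (negbTE zl) mulN1r.
  have -> : z * (F z - F l) / (z - l) - (F z - F l) * (\sum_(n < N.+1) l ^+ n / z ^+ n) =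
     (F z - F l) * ((l / z) ^+ N.+1 * (z / (z - l))).
    have := geometric_kernel N.+1 z0 zl => hk.
    rewrite -[z * _ / _](_ : (F z - F l) * (z / (z - l)) = _); last by ring.
    by rewrite [in LHS]hk; ring.
  rewrite !modulusM modulusX modulusM !modulusV zs /K.
  rewrite mulrCA [leRHS]mulrC ler_wpM2l ?exprn_ge0 ?divr_ge0 ?modulus_ge0 ?(ltW s0)//.
  rewrite ler_pM ?modulus_ge0 ?mulr_ge0 ?invr_ge0 ?modulus_ge0 ?(ltW s0)//.
    rewrite (le_trans (modulusB_le _ _))// lerD2r ext_modulus_le ?zs//.
  rewrite ler_wpM2l ?(ltW s0)// lef_pV2 ?posrE ?modulus_gt0 ?subr_eq0//.
  by rewrite -zs lerBlDr; have := modulusD_le (z - l) l; rewrite subrK.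
rewrite -(ler_pM2l pi20) (le_trans h)// le_eqVlt; apply/orP; left; apply/eqP.
by ring.
Qed.

(** The radius 1/2 is an arbitrary choice, by [cauchy_coef_const]. *)
Definition tcoef n := cauchy_coef n (1 / 2).

Lemma tcoefE n (s : R) : 0 < s < 1 -> tcoef n = cauchy_coef n s.
Proof. by move=> s01; apply: cauchy_coef_const => //; apply/andP; split; lra. Qed.

(** Cauchy's estimate, with the factor 2 of componentwise integration. *)
Lemma tcoef_le n (s : R) : 0 < s < 1 -> modulus (tcoef n) * s ^+ n <= 2 * M_infty f s.
Proof.
move=> s01; have [s0 s1] := andP s01; rewrite (tcoefE n s01).
have pi20 : 0 < pi *+ 2 :> R by rewrite mulrn_wgt0 ?pi_gt0.
have sn : 0 < s ^+ n by rewrite exprn_gt0.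
have h := @cmean_bound R _ s (M_infty f s / s ^+ n) (@punctured_quot n) s01.
rewrite /cauchy_coef modulusM modulusV modulus_real (ger0_norm (ltW pi20)).
apply: (@le_trans _ _ (2 * (M_infty f s / s ^+ n * (pi *+ 2)) / (pi *+ 2) * s ^+ n)).
  rewrite ler_wpM2r ?(ltW sn)// ler_wpM2r ?invr_ge0 ?(ltW pi20)//; apply: h => z zs.
  rewrite modulusM modulusV modulusX zs ler_wpM2r ?invr_ge0 ?(ltW sn)//.
  by rewrite -zs; apply: ext_modulus_le; rewrite ?zs.
rewrite le_eqVlt; apply/orP; left; apply/eqP.
move: (pi *+ 2) pi20 (s ^+ n) sn (M_infty f s) => P P0 S S0 M; clear -P0 S0.
by field; rewrite !gt_eqF.
Qed.

Lemma radius_ge1_tcoef : radius_ge1 tcoef.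
Proof.
move=> r /andP[r0 r1]; pose s := (1 + r) / 2.
have s01 : 0 < s < 1 by rewrite /s; apply/andP; split; lra.
have rs : r <= s by rewrite /s; lra.
exists (2 * M_infty f s) => n; apply: le_trans (tcoef_le n s01).
by rewrite ler_wpM2l ?modulus_ge0// lerXn2r ?nnegrE// (le_trans r0).
Qed.

Lemma ext_ps z : modulus z < 1 -> F z = ps tcoef z.
Proof.
move=> z1; pose s := (1 + modulus z) / 2; have z0 := modulus_ge0 z.
have s1 : s < 1 by rewrite /s; lra.
have zs : modulus z < s by rewrite /s; lra.
have s01 : 0 < s < 1 by rewrite s1 (le_lt_trans z0).
have [B B0 hB] := cauchy_approx zs s1.
apply: modulus_small => e e0; have e20 : 0 < e / 2 by rewrite divr_gt0.
have [N1 h1] := ps_cvg radius_ge1_tcoef z1 e20.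
have : B * (modulus z / s) ^+ n @[n --> \oo] --> 0.
  rewrite -[X in _ --> X](mulr0 B); apply: cvgMr; apply: cvg_expr.
  have s0 : 0 < s by case/andP: s01.
  have q0 : 0 <= modulus z / s by rewrite divr_ge0// ltW.
  by rewrite (ger0_norm q0) ltr_pdivrMr// mul1r.
move=> /cvgrPdist_le/(_ _ e20)[N2 _ h2]; pose N := maxn N1 N2.
have /h1 {}h1 : (N1 <= N.+1)%N by rewrite leqW// leq_maxl.
have /h2 {}h2 : (N2 <= N.+1)%N by rewrite leqW// leq_maxr.
have Ecoef : psum (cauchy_coef^~ s) N.+1 z = psum tcoef N.+1 z.
  by apply: eq_bigr => k _; rewrite (tcoefE k s01).
apply: le_trans (modulus_tri (psum tcoef N.+1 z) _ _) _.
rewrite (splitr e); apply: lerD; last by rewrite modulusBC.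
rewrite -Ecoef; apply: le_trans (hB N) _; apply: le_trans (ler_norm _) _.
by move: h2; rewrite sub0r normrN.
Qed.

Lemma taylor_coefE n : taylor_coef f n = tcoef n.
Proof.
apply: (@taylor_coef_ps R f tcoef 1); [by rewrite ltr01 lexx|exact: radius_ge1_tcoef|].
exact: ext_ps.
Qed.

End cauchy.

(** * Closed maximal ideals (Gelfand-Mazur) *)

Section maximal_ideals.
Variables (A : comNzRingType) (M : idealr A) (maxM : maximal_ideal M).

(** The set M + f A, as a boolean predicate so that it can be packed as an [idealr]. *)
Definition ideal_extension (f : A) : {pred A} :=
  [pred x | `[< exists2 m, m \in M & exists g, x = m + f * g >]].

(** An [idealr] is proper by definition, so M + f A is one exactly when it misses 1; maximality
    would then put f in M. *)
Lemma maximal_ideal_inv (f : A) : f \notin M -> exists g, f * g - 1 \in M.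
Proof.
move=> fM; have [one|none] := boolP (1 \in ideal_extension f).
  move: one => /asboolP[m mM [g e]]; exists g.
  by rewrite (_ : f * g - 1 = - m) ?rpredN// e opprD addrCA subrr addr0.
have idJ : idealr_closed (ideal_extension f).
  split=> [|//|a u v].
    by apply/asboolP; exists 0; rewrite ?rpred0//; exists 0; rewrite mulr0 addr0.
  move=> /asboolP[m mM [g ->]] /asboolP[m' mM' [g' ->]]; apply/asboolP.
  exists (a * m + m'); first by rewrite rpredD// idealMr.
  by exists (a * g + g'); ring.
pose jI := isIdealr.Build A (ideal_extension f) idJ.
pose J : idealr A := HB.pack (ideal_extension f) jI.
have MJ : {subset M <= J}.
  by move=> m mM; apply/asboolP; exists m => //; exists 0; rewrite mulr0 addr0.
have := maxM MJ f; rewrite (negbTE fM) => /negP; case.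
by apply/asboolP; exists 0; rewrite ?rpred0//; exists 1; rewrite mulr1 add0r.
Qed.

End maximal_ideals.

(** * Roots of unity close to 1 *)

Section small_root.
Variable R : realType.
Local Notation C := (Cplx R).

Lemma circ_exp (t : R) n : circ 1 t ^+ n = circ 1 (t * n%:R).
Proof.
elim: n => [|n IH]; first by rewrite expr0 mulr0 /circ cos0 sin0 mulr0 mulr1.
rewrite exprS IH -natr1 mulrDr mulr1 addrC /circ !mul1r cosD sinD.
by apply/eqP; rewrite eq_complex /=; apply/andP; split; apply/eqP; ring.
Qed.

Lemma exists_small_root (e : R) : 0 < e -> exists n (w : C),
  [/\ (0 < n)%N, w ^+ n = 1, modulus w = 1, w != 1 & modulus (w - 1) <= e].
Proof.
move=> e0; have c0 : circ 1 t @[t --> (0 : R)] --> circ 1 (0 : R).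
  by apply: (@circ_cvg R R (fun=> 1) id); [exact: cvg_cst|exact: cvg_id].
have circ0 : circ 1 0 = 1 :> C by rewrite /circ cos0 sin0 mulr0 mulr1.
move/(@modulus_cvgP _ _ (nbhs (0 : R)))/(_ _ e0)/nbhs_ballP : c0 => [d /= d0 hd].
have pi0 := pi_gt0 R.
have q0 : 0 <= pi *+ 2 / d by rewrite divr_ge0// ?ltW// mulrn_wgt0.
(* The summand 4 forces 2 pi / n < pi, where the sine is positive; the root is then not 1. *)
pose n := (Num.bound (pi *+ 2 / d) + 4)%N.
have n0 : 0 < n%:R :> R by rewrite ltr0n /n addnS.
have nd : pi *+ 2 / n%:R < d.
  rewrite ltr_pdivrMr// mulrC -ltr_pdivrMr// (lt_le_trans (archi_boundP q0))//.
  by rewrite ler_nat leq_addr.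
have n4 : 4 <= n%:R :> R by rewrite ler_nat leq_addl.
exists n, (circ 1 (pi *+ 2 / n%:R)); split.
- by rewrite /n addnS.
- by rewrite circ_exp mulfVK ?gt_eqF// /circ cos2pi sin2pi mulr0 mulr1.
- by rewrite modulus_circ.
- apply/eqP => /(congr1 (@complex.Im R)) /= /eqP; rewrite mul1r; apply/negP.
  rewrite gt_eqF//; apply: sin_gt0_pi; apply/andP; split.
    by rewrite divr_gt0// mulrn_wgt0.
  rewrite ltr_pdivrMr//; have := ler_wpM2l (ltW pi0) n4; rewrite mulr2n.
  by move: (pi : R) pi0 (_ * n%:R) => P P0 Q; lra.
- apply/ltW; rewrite -circ0; apply: (hd (pi *+ 2 / n%:R)).
  by rewrite /ball /= sub0r normrN ger0_norm// divr_ge0 ?ltW// mulrn_wgt0.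
Qed.

End small_root.

(** * The resolvent modulo a closed maximal ideal *)

Section closed_maximal_ideals.
Variables (R : realType) (A : comAlgType (Cplx R)) (N : R -> A -> R).
Local Notation C := (Cplx R).
Implicit Types (c : R) (f g : A) (k l : C).
Hypothesis N_ge0 : forall c f, 0 < c -> 0 <= N c f.
Hypothesis ND : forall c f g, 0 < c -> N c (f + g) <= N c f + N c g.
Hypothesis NZ : forall c k f, 0 < c -> N c (k *: f) <= modulus k * N c f.
(** The loss from c to c / 2 is paid at every product; a product of three elements requires bounds
    at c / 4. *)
Hypothesis NM : forall c f g, 0 < c -> N c (f * g) <= N (c / 2) f * N (c / 2) g.
Hypothesis N_anti : forall c c' f, 0 < c -> c <= c' -> N c' f <= N c f.
Hypothesis N_sep : forall f, (forall c, 0 < c -> N c f <= 0) -> f = 0.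
Hypothesis N_complete : forall u : nat -> A,
  (forall c e, 0 < c -> 0 < e -> exists m0, forall m, (m0 <= m)%N -> N c (u m - u m0) <= e) ->
  exists v, forall c e, 0 < c -> 0 < e ->
    exists m0, forall m, (m0 <= m)%N -> N c (u m - v) <= e.
Variables (M : idealr A) (maxM : maximal_ideal M).
Hypothesis closedM : forall f, f \notin M ->
  exists c e, [/\ 0 < c, 0 < e & forall g, g \in M -> e <= N c (g - f)].
Variable x : A.
Hypothesis resolvent_large : forall l, 1 < modulus l ->
  exists2 r, (x - l%:A) * r = 1 & forall c, 0 < c -> N c r <= (modulus l - 1)^-1.

Lemma N0 c : 0 < c -> N c 0 = 0.
Proof.
move=> c0; apply/eqP; rewrite eq_le N_ge0// andbT.
by have := NZ 0 0 c0; rewrite scale0r modulus0 mul0r.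
Qed.

Lemma NN c f : 0 < c -> N c (- f) <= N c f.
Proof. by move=> c0; have := NZ (-1) f c0; rewrite scaleN1r modulusN modulus1 mul1r. Qed.

Lemma NBC c f g : 0 < c -> N c (f - g) <= N c (g - f).
Proof. by move=> c0; rewrite -opprB NN. Qed.

Lemma N_tri c f g h : 0 < c -> N c (f - h) <= N c (f - g) + N c (g - h).
Proof. by move=> c0; have := ND (f - g) (g - h) c0; rewrite addrA subrK. Qed.

(* [quot_le c f B]: the quotient seminorm of the class of [f] modulo M is at
   most [B]. *)
Definition quot_le c f (B : R) := exists2 m, m \in M & N c (f - m) <= B.

Lemma quot_leD c f g B B' : 0 < c -> quot_le c f B -> quot_le c g B' ->
  quot_le c (f + g) (B + B').
Proof.
move=> c0 [m mM h] [m' mM' h']; exists (m + m'); first by rewrite rpredD.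
by rewrite opprD addrACA (le_trans (ND _ _ c0))// lerD.
Qed.

Lemma quot_leZ c k f B : 0 < c -> quot_le c f B -> quot_le c (k *: f) (modulus k * B).
Proof.
move=> c0 [m mM h]; exists (k *: m); first by rewrite -mulr_algl idealMr.
by rewrite -scalerBr (le_trans (NZ _ _ c0))// ler_wpM2l ?modulus_ge0.
Qed.

Lemma quot_leM c f g B B' : 0 < c -> quot_le (c / 2) f B -> quot_le (c / 2) g B' ->
  quot_le c (f * g) (B * B').
Proof.
move=> c0 [m mM h] [m' mM' h']; exists (g * m + (f - m) * m').
  by rewrite rpredD// idealMr.
have -> : f * g - (g * m + (f - m) * m') = (f - m) * (g - m') by ring.
have c20 : 0 < c / 2 by rewrite divr_gt0.
by rewrite (le_trans (NM _ _ c0))// ler_pM ?N_ge0.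
Qed.

Lemma quot_le_eq c f g B : f - g \in M -> quot_le c f B -> quot_le c g B.
Proof.
move=> fg [m mM h]; exists (m - (f - g)); first by rewrite rpredB.
by have -> : g - (m - (f - g)) = f - m by ring.
Qed.

Lemma quot_leW c f B B' : B <= B' -> quot_le c f B -> quot_le c f B'.
Proof. by move=> BB' [m mM h]; exists m => //; exact: le_trans BB'. Qed.

Lemma quot_le_N c f : quot_le c f (N c f).
Proof. by exists 0; rewrite ?rpred0// subr0. Qed.

Lemma quot_le_sum c (F : nat -> A) (B : R) n : 0 < c -> (forall k : nat, (k < n)%N -> quot_le c (F k) B) ->
  quot_le c (\sum_(k < n) F k) (n%:R * B).
Proof.
move=> c0; elim: n => [_|n IH h].
  by rewrite big_ord0 mul0r; exists 0; rewrite ?rpred0// subr0 N0.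
rewrite big_ord_recr /= -natr1 mulrDl mul1r; apply: quot_leD => //; last exact: h.
by apply: IH => k kn; apply: h; rewrite ltnS ltnW.
Qed.

Lemma quot_le_notin f : f \notin M -> exists c e, [/\ 0 < c, 0 < e &
  forall B, quot_le c f B -> e <= B].
Proof.
move=> /closedM[c [e [c0 e0 h]]]; exists c, e; split=> // B [m mM mB].
by rewrite (le_trans (h m mM))// (le_trans (NBC _ _ c0)).
Qed.

Hypothesis no_root : forall l, x - l%:A \notin M.

Lemma resolvent_exists : exists Rs : C -> A, forall l, (x - l%:A) * Rs l - 1 \in M.
Proof.
have h l : exists g, (x - l%:A) * g - 1 \in M by exact: maximal_ideal_inv.
exists (fun l => xget 0 [set g | (x - l%:A) * g - 1 \in M]) => l.
by case: xgetP => [_ -> //|]; have [g hg] := h l => /(_ g).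
Qed.

Variables (Rs : C -> A) (RsP : forall l, (x - l%:A) * Rs l - 1 \in M).

Lemma resolvent_uniq l f : (x - l%:A) * f - 1 \in M -> f - Rs l \in M.
Proof.
move=> h.
have -> : f - Rs l = Rs l * ((x - l%:A) * f - 1) - f * ((x - l%:A) * Rs l - 1) by ring.
by rewrite rpredB// idealMr.
Qed.

(** The resolvent identity, which holds modulo M because [Rs] selects inverses modulo M. *)
Lemma resolvent_eq l k : Rs k - Rs l - (k - l) *: (Rs l * Rs k) \in M.
Proof.
rewrite (_ : _ - _ = Rs l * ((x - k%:A) * Rs k - 1) - Rs k * ((x - l%:A) * Rs l - 1)).
  by rewrite rpredB// idealMr.
by rewrite -(mulr_algl (k - l)) scalerBl; ring.
Qed.

Section local_bound.
Variables (l0 : C) (c : R) (c_gt0 : 0 < c).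
Local Notation r := (Rs l0).

(* A bound for [N a (r ^+ i * P)] when [P] is a product of at most [m] factors
   [1 + k *: r] with [modulus k <= 1]. *)
Fixpoint prod_bound (a : R) (m i : nat) : R :=
  if m is m'.+1 then prod_bound a m' i + prod_bound a m' i.+1 else N a (r ^+ i).

Lemma prod_bound_ge0 a m i : 0 < a -> 0 <= prod_bound a m i.
Proof. by move=> a0; elim: m i => [|m IH] i /=; rewrite ?N_ge0// addr_ge0. Qed.

(** The predicate [b] drops factors, so that the full product and the one without its n-th factor
    obey the same estimates. *)
Definition factor_prod (eps : nat -> C) (b : pred nat) m : A :=
  \prod_(k < m | b k) (1 + eps k *: r).

Lemma factor_prodS eps b m : factor_prod eps b m.+1 =
  factor_prod eps b m * (if b m then 1 + eps m *: r else 1).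
Proof. by rewrite /factor_prod big_mkcond big_ord_recr /= -big_mkcond. Qed.

Lemma factor_prod_le eps b a m i : 0 < a -> (forall i : nat, modulus (eps i) <= 1) ->
  N a (r ^+ i * factor_prod eps b m) <= prod_bound a m i.
Proof.
move=> a0 eps1; elim: m i => [|m IH] i /=.
  by rewrite /factor_prod big_ord0 mulr1.
rewrite factor_prodS; case: ifP => _; last first.
  by rewrite mulr1 (le_trans (IH i))// lerDl prod_bound_ge0.
have -> : r ^+ i * (factor_prod eps b m * (1 + eps m *: r)) =
    r ^+ i * factor_prod eps b m + eps m *: (r ^+ i.+1 * factor_prod eps b m).
  by rewrite -(mulr_algl (eps m) r) -(mulr_algl (eps m) (_ * _)) exprS; ring.
rewrite (le_trans (ND _ _ a0))// lerD// (le_trans (NZ _ _ a0))//.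
by rewrite (le_trans _ (IH i.+1))// ler_piMl// N_ge0.
Qed.

(* The seminorms are not submultiplicative, so the Neumann series is not available.
   If the inverses of [x - lk m] were unbounded along a sequence [lk m] tending fast
   to [l0], the product [v] of all the factors [(x - lk m) / (x - l0)] would converge
   near 1, hence be invertible modulo M; splitting off the [n]-th factor bounds the
   inverse of [x - lk n] independently of [n]. *)
Lemma resolvent_locally_bounded : exists2 d : R, 0 < d & exists B, forall l,
  modulus (l - l0) < d -> quot_le c (Rs l) B.
Proof.
have [c1 [e1 [c10 e10 M1]]] : exists c e, [/\ 0 < c, 0 < e & forall g, g \in M -> e <= N c (g - 1)].
  by apply: closedM; rewrite idealr1.
have c20 : 0 < c / 2 by rewrite divr_gt0.
(* Below c1, where the distance from 1 to M is measured, and below c / 2, where the final product is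
   estimated. *)
pose a0 := Num.min c1 (c / 2).
have a00 : 0 < a0 by rewrite lt_min c10.
(* The indices tend to 0, so smallness of the m-th step at index a m gives convergence at every
   index. *)
pose a m := a0 / m.+1%:R.
have am0 m : 0 < a m by rewrite divr_gt0.
have a_anti m n : (m <= n)%N -> a n <= a m.
  by move=> mn; rewrite /a ler_wpM2l ?(ltW a00)// lef_pV2 ?posrE// ler_nat.
pose eta := Num.min 1 (e1 / 4).
have eta0 : 0 < eta by rewrite lt_min ltr01 divr_gt0.
have eta1 : eta <= 1 by rewrite ge_min lexx.
have etae : eta <= e1 / 4 by rewrite ge_min lexx orbT.
have T1 m : 0 < 1 + prod_bound (a m) m 1 by rewrite ltr_pwDl// prod_bound_ge0.
(* Chosen so that multiplying by the m-th factor changes the product by at most eta / 2^m in N_(a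
   m). *)
pose d m := eta / 2 ^+ m / (1 + prod_bound (a m) m 1).
have p2 m : 0 < 2 ^+ m :> R by rewrite exprn_gt0.
have d0 m : 0 < d m by rewrite /d divr_gt0// divr_gt0.
have d1 m : d m <= 1.
  rewrite /d ler_pdivrMr// mul1r (@le_trans _ _ 1)//; last by rewrite lerDl prod_bound_ge0.
  by rewrite ler_pdivrMr// mul1r (le_trans eta1)// exprn_ege1// ler1n.
apply: contrapT => /forall2NP hn.
(* The negated claim at radius d m gives a point whose resolvent has no bound m; n will be taken
   beyond the bound [Bfix]. *)
have hl m : exists l, modulus (l - l0) < d m /\ ~ quot_le c (Rs l) m%:R.
  have [|/forallNP/(_ m%:R) /existsNP[l /not_implyP[? ?]]] := hn (d m); first by rewrite d0.
  by exists l.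
have [lk lkP] := choice hl.
pose eps m := l0 - lk m.
have epsd m : modulus (eps m) <= d m by rewrite /eps modulusBC ltW// (lkP m).1.
have eps1 m : modulus (eps m) <= 1 := le_trans (epsd m) (d1 m).
pose P b m := factor_prod eps b m.
have Pstep b m : N (a m) (P b m.+1 - P b m) <= eta / 2 ^+ m.
  rewrite /P factor_prodS; case: ifP => _; last first.
    by rewrite mulr1 subrr N0// divr_ge0// ltW.
  have -> : factor_prod eps b m * (1 + eps m *: r) - factor_prod eps b m =
      eps m *: (r ^+ 1 * factor_prod eps b m) by rewrite -(mulr_algl (eps m) r) -(mulr_algl (eps m) (_ * _)) expr1; ring.
  rewrite (le_trans (NZ _ _ (am0 m)))//.
  apply: (@le_trans _ _ (d m * (1 + prod_bound (a m) m 1))).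
    apply: ler_pM; rewrite ?modulus_ge0 ?N_ge0//.
    by rewrite (le_trans (factor_prod_le b m 1 (am0 m) eps1))// lerDr.
  by rewrite /d mulfVK// gt_eqF.
have Ptail b c' m0 m : 0 < c' -> a m0 <= c' -> (m0 <= m)%N ->
    N c' (P b m - P b m0) <= 2 * eta / 2 ^+ m0.
  move=> c'0 ac' mm; apply: (@le_trans _ _ (2 * eta * (2 ^- m0 - 2 ^- m))); last first.
    by rewrite ler_wpM2l ?mulr_ge0 ?(ltW eta0)// gerBl invr_ge0 ltW.
  rewrite -(subnKC mm); elim: (m - m0)%N => [|j IH].
    by rewrite addn0 !subrr mulr0 N0.
  rewrite addnS (le_trans (N_tri _ (P b (m0 + j)%N) _ c'0))//.
  have := Pstep b (m0 + j)%N => hs.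
  have {}hs : N c' (P b (m0 + j).+1 - P b (m0 + j)%N) <= eta / 2 ^+ (m0 + j).
    by apply: le_trans hs; apply: N_anti => //; rewrite (le_trans _ ac')// a_anti ?leq_addr.
  rewrite (le_trans (lerD hs IH))// exprS.
  rewrite le_eqVlt; apply/orP; left; apply/eqP.
  by move: (p2 m0) (p2 (m0 + j)%N); move: (2 ^+ m0) (2 ^+ (m0 + j)) => u v u0 v0; field; rewrite !gt_eqF.
have small c' e : 0 < c' -> 0 < e -> exists m0, a m0 <= c' /\ 2 * eta / 2 ^+ m0 <= e.
  move=> c'0 e0.
  have h1 : 0 <= a0 / c' by rewrite divr_ge0 ?ltW.
  have h2 : 0 <= 2 * eta / e by rewrite divr_ge0 ?mulr_ge0 ?ltW.
  pose m0 := maxn (Num.bound (a0 / c')) (Num.bound (2 * eta / e)); exists m0; split.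
    rewrite /a ler_pdivrMr// [leRHS]mulrC -ler_pdivrMr// (le_trans (ltW (archi_boundP h1)))//.
    by rewrite ler_nat leqW// leq_maxl.
  rewrite ler_pdivrMr// [leRHS]mulrC -ler_pdivrMr// (le_trans (ltW (archi_boundP h2)))//.
  rewrite (@le_trans _ _ m0%:R) ?ler_nat ?leq_maxr// -natrX ler_nat.
  by rewrite ltnW// ltn_expl.
have lim b : exists v, forall c' e, 0 < c' -> 0 < e ->
    exists m0, forall m, (m0 <= m)%N -> N c' (P b m - v) <= e.
  apply: N_complete => c' e c'0 e0; have [m0 [am hm]] := small c' e c'0 e0.
  by exists m0 => m mm; rewrite (le_trans _ hm)// Ptail.
have near1 b v : (forall c' e, 0 < c' -> 0 < e ->
    exists m0, forall m, (m0 <= m)%N -> N c' (P b m - v) <= e) ->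
    forall c', a0 <= c' -> N c' (v - 1) <= 3 * eta.
  move=> hv c' ac'; have c'0 : 0 < c' := lt_le_trans a00 ac'.
  have [m0 hm] := hv c' eta c'0 eta0.
  have P0 : P b 0%N = 1 by rewrite /P /factor_prod big_ord0.
  have a0c : a 0%N <= c' by rewrite /a divr1.
  have := Ptail b c' 0%N m0 c'0 a0c (leq0n _); rewrite P0 expr0 divr1 => h1.
  rewrite (le_trans (N_tri _ (P b m0) _ c'0))//.
  rewrite (le_trans (lerD (NBC _ _ c'0) h1))// (le_trans (lerD (hm m0 (leqnn _)) (lexx _)))//.
  lra.
have [v hv] := lim xpredT.
(* v lies within 3 eta < e1 of 1, closer than any element of M. *)
have vM : v \notin M.
  apply/negP => /M1; rewrite leNgt => /negP; apply.
  rewrite (le_lt_trans (near1 _ _ hv c1 _))//; first by rewrite ge_min lexx.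
  by rewrite (le_lt_trans (ler_wpM2l _ etae))//; lra.
have [w wP] := maximal_ideal_inv maxM vM.
(* Fixed before n: [near1] keeps a product with any one factor removed within 3 eta of 1. *)
pose Bfix := (N (c / 2) 1 + 3 * eta) * N (c / 2) (w * r).
have Bfix0 : 0 <= Bfix by rewrite mulr_ge0 ?addr_ge0 ?N_ge0 ?mulr_ge0// ltW.
pose n := Num.bound Bfix.
have [y hy] := lim (predC1 n).
pose u := 1 + eps n *: r.
have PE m : (n < m)%N -> P xpredT m = P (predC1 n) m * u.
  elim: m => // m IH; rewrite ltnS leq_eqVlt => /orP[/eqP nm|nm].
    rewrite /P !factor_prodS /= nm eqxx /= mulr1 -nm; congr (_ * _).
    rewrite /factor_prod; apply: eq_bigl => k /=; by rewrite (ltn_eqF (ltn_ord k)).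
  rewrite /P !factor_prodS /= (gtn_eqF nm) /= -/(P _ m) (IH nm) -/(P (predC1 n) m).
  by rewrite mulrAC.
have vyu : v = y * u.
  apply/eqP; rewrite -subr_eq0; apply/eqP; apply: N_sep => c' c'0.
  apply/ler_addgt0Pr => e e0; rewrite add0r.
  have c'20 : 0 < c' / 2 by rewrite divr_gt0.
  have u0 : 0 < 1 + N (c' / 2) u by rewrite ltr_pwDl// N_ge0.
  have e20 : 0 < e / 2 by rewrite divr_gt0.
  have [m1 h1] := hv c' (e / 2) c'0 e20.
  have [m2 h2] := hy (c' / 2) (e / 2 / (1 + N (c' / 2) u)) c'20 (divr_gt0 e20 u0).
  pose m := (m1 + m2 + n.+1)%N.
  have mm1 : (m1 <= m)%N by rewrite /m -addnA leq_addr.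
  have mm2 : (m2 <= m)%N by rewrite /m addnAC leq_addl.
  have mn : (n < m)%N by rewrite /m leq_addl.
  rewrite (le_trans (N_tri _ (P xpredT m) _ c'0))// (splitr e) lerD//.
    by rewrite (le_trans (NBC _ _ c'0))// h1.
  rewrite PE// -mulrBl (le_trans (NM _ _ c'0))//.
  rewrite (le_trans (ler_wpM2r (N_ge0 _ c'20) (h2 m mm2)))//.
  by rewrite mulrAC ler_pdivrMr// ler_wpM2l ?(ltW e20)// lerDr.
(* Modulo M, u is (x - lk n) r and v w = y u w is 1, so y w r inverts x - lk n. *)
have key : (x - (lk n)%:A) * (y * (w * r)) - 1 \in M.
  have -> : (x - (lk n)%:A) * (y * (w * r)) - 1 =
     (y * w) * ((x - l0%:A) * r - 1) + (y * u * w - 1).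
    by rewrite /u /eps -(mulr_algl (l0 - _) r) scalerBl; ring.
  by rewrite rpredD ?idealMr// -vyu.
apply: (lkP n).2; apply: quot_le_eq (resolvent_uniq key) _.
apply: (@quot_leW _ _ Bfix); first exact/ltW/archi_boundP.
apply: quot_leW (quot_leM c_gt0 (quot_le_N _ _) (quot_le_N _ _)).
rewrite ler_wpM2r ?N_ge0// -[y](subrK 1) (le_trans (ND _ _ c20))// addrC lerD2l.
by apply: near1 hy _ _; rewrite ge_min lexx orbT.
Qed.

End local_bound.

Lemma resolvent_bounded c (S : R) : 0 < c ->
  exists B, forall l, modulus l <= S -> quot_le c (Rs l) B.
Proof.
move=> c0.
(* Bounds can be enlarged, so letting B tend to infinity turns local bounds into one bound on the
   compact disk. *)
have h : \forall B \near +oo, [set l : C | modulus l <= S] `<=` (fun l => quot_le c (Rs l) B).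
  apply: (proj1 (compact_near_coveringP _) (@compact_modulus_le R S) R (pinfty_nbhs R)
    (fun B l => quot_le c (Rs l) B)) => l0 _.
  have [d d0 [B hB]] := resolvent_locally_bounded l0 c0.
  exists ([set l : C | modulus (l - l0) < d], [set b : R | B <= b]) => /=.
    by split; [apply/modulus_nbhsP; exists d|apply: nbhs_pinfty_ge; exact: num_real].
  by move=> [l b] /= [/hB hl Bb]; exact: quot_leW hl.
by have [B hB] := filter_ex h; exists B.
Qed.

(** Using the resolvent identity twice, the second remainder is (k - l)^2 R_l R_l R_k modulo M; this
    triple product is why bounds at index c / 4 are called for. *)
Lemma resolvent_taylor c (S : R) : 0 < c -> exists2 B : R, 0 <= B &
  forall l k, modulus l <= S -> modulus k <= S ->
    quot_le c (Rs k - Rs l) (modulus (k - l) * B) /\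
    quot_le c (Rs k - Rs l - (k - l) *: (Rs l * Rs l)) (modulus (k - l) ^+ 2 * B).
Proof.
move=> c0; have c20 : 0 < c / 2 by rewrite divr_gt0.
have c40 : 0 < c / 2 / 2 by rewrite divr_gt0.
have [B1 h1] := resolvent_bounded S c20; have [B2 h2] := resolvent_bounded S c40.
exists (`|B1 * B1| + `|B2 * B2 * B1|) => [|l k lS kS]; first by rewrite addr_ge0.
have q1 : quot_le c (Rs l * Rs k) (`|B1 * B1| + `|B2 * B2 * B1|).
  apply: quot_leW (quot_leM c0 (h1 _ lS) (h1 _ kS)).
  by rewrite (le_trans (ler_norm _))// lerDl.
have q2 : quot_le c (Rs l * Rs l * Rs k) (`|B1 * B1| + `|B2 * B2 * B1|).
  apply: quot_leW (quot_leM c0 (quot_leM c20 (h2 _ lS) (h2 _ lS)) (h1 _ kS)).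
  by rewrite (le_trans (ler_norm _))// lerDr.
split.
  apply: quot_le_eq (quot_leZ (k - l) c0 q1).
  by rewrite -opprB rpredN; exact: resolvent_eq.
rewrite -modulusX; apply: quot_le_eq (quot_leZ _ c0 q2).
rewrite -opprB rpredN.
rewrite (_ : _ - _ = (Rs k - Rs l - (k - l) *: (Rs l * Rs k)) +
   (k - l)%:A * Rs l * (Rs k - Rs l - (k - l) *: (Rs l * Rs k))).
  by rewrite rpredD ?idealMr ?resolvent_eq.
rewrite -(mulr_algl (k - l) (Rs l * Rs l)) -(mulr_algl (k - l) (Rs l * Rs k)).
rewrite -(mulr_algl ((k - l) ^+ 2)) expr2 -[((k - l) * (k - l))%:A]scalerA -(mulr_algl (k - l) ((k - l)%:A)).
by ring.
Qed.

(* Averages of the resolvent over the [n]-th roots of unity hardly depend on the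
   radius: the radial and the angular derivatives are proportional, and the
   angular increments sum to zero. *)
Section roots_of_unity.
Variables (c S B : R) (c_gt0 : 0 < c) (B_ge0 : 0 <= B).
Hypothesis BP : forall l k, modulus l <= S -> modulus k <= S ->
    quot_le c (Rs k - Rs l) (modulus (k - l) * B) /\
    quot_le c (Rs k - Rs l - (k - l) *: (Rs l * Rs l)) (modulus (k - l) ^+ 2 * B).
Variables (n : nat) (w : C).
Hypotheses (n_gt0 : (0 < n)%N) (wn : w ^+ n = 1) (w1 : modulus w = 1) (w_neq1 : w != 1).

Let pt (s : R) (k : nat) : C := s%:C%C * w ^+ k.
Definition root_sum (s : R) : A := \sum_(k < n) Rs (pt s k).
Let sq (s : R) : A := \sum_(k < n) w ^+ k *: (Rs (pt s k) * Rs (pt s k)).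

Lemma modulus_pt s (k : nat) : 0 <= s -> modulus (pt s k) = s.
Proof. by move=> s0; rewrite modulusM modulus_real modulusX w1 expr1n mulr1 ger0_norm. Qed.

(** Around the circle the increments of the resolvent telescope to 0, as w^n = 1. The sum of the
    second-order remainders is therefore -s (w - 1) times [sq s], and dividing gains one factor |w -
    1|. *)
Lemma root_sum_sq_le s : 0 < s <= S -> quot_le c (sq s) (n%:R * (s * modulus (w - 1) * B)).
Proof.
move=> /andP[s0 sS]; have s0' := ltW s0.
have wd : 0 < modulus (w - 1) by rewrite modulus_gt0 subr_eq0.
pose D (k : nat) := Rs (pt s k.+1) - Rs (pt s k) -
  (pt s k.+1 - pt s k) *: (Rs (pt s k) * Rs (pt s k)).
have ptS (k : nat) : pt s k.+1 - pt s k = s%:C%C * (w - 1) * w ^+ k.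
  by rewrite /pt exprS; ring.
have hD (k : nat) : (k < n)%N -> quot_le c (D k) ((s * modulus (w - 1)) ^+ 2 * B).
  move=> _; have [] := @BP (pt s k) (pt s k.+1); rewrite ?modulus_pt// => _.
  by rewrite {2}ptS !modulusM modulusX w1 expr1n mulr1 modulus_real ger0_norm.
have := quot_le_sum c_gt0 hD.
have -> : \sum_(k < n) D k = (- (s%:C%C * (w - 1))) *: sq s.
  rewrite /D sumrB (_ : \sum_(k < n) (Rs (pt s k.+1) - Rs (pt s k)) = 0); last first.
    have := telescope_sumr (fun k : nat => Rs (pt s k)) (leq0n n); rewrite big_mkord => ->.
    by rewrite /pt wn expr0 subrr.
  rewrite sub0r scaleNr /sq scaler_sumr; congr (- _); apply: eq_bigr => k _.
  by rewrite ptS scalerA.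
move=> /(quot_leZ (- (s%:C%C * (w - 1)))^-1 c_gt0).
have sw0 : - (s%:C%C * (w - 1)) != 0 :> C.
  rewrite oppr_eq0 mulf_neq0 ?subr_eq0//.
  by rewrite -modulus_gt0 modulus_real normr_gt0 gt_eqF.
rewrite scalerA mulVf// scale1r modulusV modulusN modulusM modulus_real ger0_norm//.
apply: quot_leW; rewrite le_eqVlt; apply/orP; left; apply/eqP.
by field; rewrite !gt_eqF.
Qed.

Lemma root_sum_step s d : 0 < s -> 0 <= d -> s + d <= S ->
  quot_le c (root_sum (s + d) - root_sum s)
    (n%:R * (d ^+ 2 * B + d * (S * modulus (w - 1) * B))).
Proof.
move=> s0 d0 sdS; have s0' := ltW s0.
have sS : s <= S by rewrite (le_trans _ sdS)// lerDl.
pose D (k : nat) := Rs (pt (s + d) k) - Rs (pt s k) -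
  (pt (s + d) k - pt s k) *: (Rs (pt s k) * Rs (pt s k)).
have ptd (k : nat) : pt (s + d) k - pt s k = d%:C%C * w ^+ k.
  by rewrite /pt -mulrBl rmorphD /= addrC addKr.
have hD (k : nat) : (k < n)%N -> quot_le c (D k) (d ^+ 2 * B).
  move=> _; have [] := @BP (pt s k) (pt (s + d) k); rewrite ?modulus_pt ?addr_ge0// => _.
  by rewrite {2}ptd modulusM modulusX w1 expr1n mulr1 modulus_real ger0_norm.
have h1 := quot_le_sum c_gt0 hD.
have s0S : 0 < s <= S by rewrite s0.
have h2 := quot_leZ (d%:C%C : C) c_gt0 (root_sum_sq_le s0S).
have := quot_leD c_gt0 h1 h2.
have -> : \sum_(k < n) D k + (d%:C%C : C) *: sq s = root_sum (s + d) - root_sum s.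
  rewrite /sq scaler_sumr -big_split /root_sum -sumrB; apply: eq_bigr => k _ /=.
  by rewrite /D ptd scalerA subrK.
apply: quot_leW; rewrite modulus_real ger0_norm// mulrDr lerD2l mulrCA.
rewrite ler_wpM2l// ler_wpM2l// ler_wpM2r// ler_wpM2r// modulus_ge0//.
Qed.

Lemma root_sum_path d J : 0 < d -> J.+1%:R * d <= S ->
  quot_le c (root_sum (J.+1%:R * d) - root_sum d)
    (J%:R * (n%:R * (d ^+ 2 * B + d * (S * modulus (w - 1) * B)))).
Proof.
move=> d0; elim: J => [|J IH] JS.
  by rewrite !mul1r subrr mul0r; have := quot_le_N c 0; rewrite N0.
have JS' : J.+1%:R * d <= S.
  by rewrite (le_trans _ JS)// ler_wpM2r ?(ltW d0)// ler_nat.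
have e : J.+2%:R * d = J.+1%:R * d + d by rewrite -natr1 mulrDl mul1r.
rewrite e in JS *.
have := quot_leD c_gt0 (root_sum_step (mulr_gt0 (ltr0Sn _ _) d0) (ltW d0) JS) (IH JS').
rewrite addrA subrK; apply: quot_leW; rewrite le_eqVlt; apply/orP; left; apply/eqP.
by rewrite -(natr1 J); ring.
Qed.

Lemma root_sum0 d : 0 <= d -> d <= S -> quot_le c (root_sum d - Rs 0 *+ n) (n%:R * (d * B)).
Proof.
move=> d0 dS.
have hD (k : nat) : (k < n)%N -> quot_le c (Rs (pt d k) - Rs 0) (d * B).
  move=> _; have [] := @BP 0 (pt d k); rewrite ?modulus0 ?modulus_pt// ?(le_trans d0)//.
  by rewrite subr0 modulus_pt.
have := quot_le_sum c_gt0 hD.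
by rewrite sumrB /root_sum sumr_const card_ord.
Qed.

Lemma root_sum_large : 1 < S -> quot_le c (root_sum S) (n%:R * (S - 1)^-1).
Proof.
move=> S1; have S0 : 0 <= S by rewrite ltW// (lt_trans ltr01).
have hD (k : nat) : (k < n)%N -> quot_le c (Rs (pt S k)) (S - 1)^-1.
  move=> _; have [|r rP rN] := @resolvent_large (pt S k); first by rewrite modulus_pt.
  rewrite modulus_pt// in rN.
  have rR : r - Rs (pt S k) \in M by apply: resolvent_uniq; rewrite rP subrr rpred0.
  by apply: quot_le_eq rR _; apply: quot_leW (rN _ c_gt0) (quot_le_N _ _).
exact: (quot_le_sum c_gt0 hD).
Qed.

(** The three terms come from the decay at radius S, from the discretisation of [0, S] into J + 1
    steps, and from the angular step w - 1. *)
Lemma resolvent0_le J : 1 < S ->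
  quot_le c (Rs 0) ((S - 1)^-1 + S / J.+1%:R * (B + S * B) + S ^+ 2 * modulus (w - 1) * B).
Proof.
move=> S1; have S0 : 0 < S by rewrite (lt_trans ltr01).
have n0 : 0 < n%:R :> R by rewrite ltr0n.
have J0 : 0 < J.+1%:R :> R by rewrite ltr0n.
pose d := S / J.+1%:R; have d0 : 0 < d by rewrite divr_gt0.
have Jd : J.+1%:R * d = S by rewrite mulrC mulfVK// gt_eqF.
have dS : d <= S by rewrite /d ler_pdivrMr// ler_peMr ?(ltW S0)// ler1n.
rewrite -[S / J.+1%:R]/d; clearbody d.
have h1 := root_sum_large S1.
have h2 := @root_sum_path d J d0; rewrite Jd lexx in h2; have {}h2 := h2 isT.
have h3 := root_sum0 (ltW d0) dS.
have h2' := quot_leZ (-1) c_gt0 h2; have h3' := quot_leZ (-1) c_gt0 h3.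
have := quot_leD c_gt0 (quot_leD c_gt0 h1 h2') h3'.
have -> : root_sum S + -1 *: (root_sum S - root_sum d) + -1 *: (root_sum d - Rs 0 *+ n) = Rs 0 *+ n.
  rewrite !scaleN1r; ring.
rewrite modulusN modulus1 !mul1r -scaler_nat.
move=> /(quot_leZ (n%:R)^-1 c_gt0); rewrite scalerA mulVf ?pnatr_eq0 -?lt0n// scale1r.
apply: quot_leW; rewrite modulusV modulus_natr.
rewrite [leLHS](_ : _ = (S - 1)^-1 + J%:R * d * (d * B + S * modulus (w - 1) * B) + d * B); last first.
  by move: (S - 1)^-1 (modulus (w - 1)) n%:R n0 => t u m m0; field; rewrite gt_eqF.
have JdS : J%:R * d <= S by rewrite -Jd ler_wpM2r ?(ltW d0)// ler_nat.
have T0 : 0 <= d * B + S * modulus (w - 1) * B.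
  by rewrite addr_ge0 ?mulr_ge0 ?modulus_ge0 ?(ltW d0) ?(ltW S0).
have := ler_wpM2r T0 JdS; move: (modulus (w - 1)) (J%:R * d) (S - 1)^-1 => u v t h.
apply: (@le_trans _ _ (t + S * (d * B + S * u * B) + d * B)); first by rewrite lerD2r lerD2l.
by rewrite le_eqVlt; apply/orP; left; apply/eqP; ring.
Qed.

End roots_of_unity.

(** The inverse of x stays at distance e from M, yet each of the three terms can be made at most e /
    4. The order matters: S first, then B, which depends on S, then w and J. *)
Lemma closed_maximal_absurd : False.
Proof.
have R0M : Rs 0 \notin M.
  apply/negP => R0; have := RsP 0; rewrite scale0r subr0 => h.
  have : 1 \in M; last by rewrite idealr1.
  have -> : 1 = x * Rs 0 - (x * Rs 0 - 1) by rewrite opprB addrCA subrr addr0.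
  by rewrite rpredB// idealMr.
have [c [e [c0 e0 he]]] := quot_le_notin R0M.
pose S := 1 + 4 / e.
have S1 : 1 < S by rewrite /S ltrDl divr_gt0.
have S0 : 0 < S by rewrite (lt_trans ltr01).
have [B B0 BP] := resolvent_taylor S c0.
have K10 : 0 < S ^+ 2 * B + 1 by rewrite ltr_wpDl// mulr_ge0// exprn_ge0// ltW.
have [n [w [n0 wn w1 wN1 we]]] := exists_small_root (divr_gt0 (divr_gt0 e0 (ltr0Sn _ 3)) K10).
pose K2 := S * (B + S * B) / (e / 4).
have e40 : 0 < e / 4 by rewrite divr_gt0.
have K20 : 0 <= K2.
  by rewrite divr_ge0 ?(ltW e40)// mulr_ge0 ?(ltW S0)// addr_ge0// mulr_ge0// ltW.
have := he _ (resolvent0_le c0 B0 BP n0 wn w1 wN1 (Num.bound K2) S1).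
rewrite leNgt => /negP; apply.
have h1 : (S - 1)^-1 = e / 4 by rewrite /S addrC addKr invf_div.
have h2 : S / (Num.bound K2).+1%:R * (B + S * B) <= e / 4.
  rewrite mulrAC ler_pdivrMr// -ler_pdivrMl// [leLHS]mulrC -/K2.
  by rewrite (le_trans (ltW (archi_boundP K20)))// ler_nat.
have h3 : S ^+ 2 * modulus (w - 1) * B <= e / 4.
  rewrite mulrAC (@le_trans _ _ ((S ^+ 2 * B + 1) * modulus (w - 1)))//.
    by rewrite ler_wpM2r ?modulus_ge0// lerDl.
  by rewrite mulrC -ler_pdivlMr.
rewrite h1; move: h2 h3 e0.
move: (S / _ * _) (S ^+ 2 * _ * _) => a b; lra.
Qed.

End closed_maximal_ideals.

Theorem closed_maximal_ideal_root (R : realType) (A : comAlgType (Cplx R)) (N : R -> A -> R)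
  (N_ge0 : forall c f, 0 < c -> 0 <= N c f)
  (ND : forall c f g, 0 < c -> N c (f + g) <= N c f + N c g)
  (NZ : forall c k f, 0 < c -> N c (k *: f) <= modulus k * N c f)
  (NM : forall c f g, 0 < c -> N c (f * g) <= N (c / 2) f * N (c / 2) g)
  (N_anti : forall c c' f, 0 < c -> c <= c' -> N c' f <= N c f)
  (N_sep : forall f, (forall c, 0 < c -> N c f <= 0) -> f = 0)
  (N_complete : forall u : nat -> A,
    (forall c e, 0 < c -> 0 < e -> exists m0, forall m, (m0 <= m)%N -> N c (u m - u m0) <= e) ->
    exists v, forall c e, 0 < c -> 0 < e ->
      exists m0, forall m, (m0 <= m)%N -> N c (u m - v) <= e)
  (M : idealr A) (maxM : maximal_ideal M)
  (closedM : forall f, f \notin M ->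
    exists c e, [/\ 0 < c, 0 < e & forall g, g \in M -> e <= N c (g - f)])
  (x : A) (resolvent_large : forall l : Cplx R, 1 < modulus l ->
    exists2 r, (x - l%:A) * r = 1 & forall c, 0 < c -> N c r <= (modulus l - 1)^-1) :
  exists l : Cplx R, x - l%:A \in M.
Proof.
apply: contrapT => /forallNP h.
have no_root l : x - l%:A \notin M by apply/negP/h.
have [Rs RsP] := resolvent_exists maxM no_root.
exact: (closed_maximal_absurd N_ge0 ND NZ NM N_anti N_sep N_complete maxM closedM
  resolvent_large RsP).
Qed.

(** * Algebra of power series *)

Section power_series_algebra.
Variable R : realType.
Local Notation C := (Cplx R).
Implicit Types (a b : nat -> C) (z : C).

Lemma ps_unique a z (l : C) : radius_ge1 a -> modulus z < 1 ->
  (forall e : R, 0 < e -> exists N, forall n, (N <= n)%N -> modulus (psum a n z - l) <= e) ->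
  ps a z = l.
Proof.
move=> ha z1 h; apply: modulus_small => e e0.
have e20 : 0 < e / 2 by rewrite divr_gt0.
have [N1 h1] := ps_cvg ha z1 e20; have [N2 h2] := h _ e20.
apply: le_trans (modulus_tri (psum a (maxn N1 N2) z) _ _) _; rewrite (splitr e).
by apply: lerD; [apply: h1; exact: leq_maxl|apply: h2; exact: leq_maxr].
Qed.

Lemma radius_ge1_le a (K : R) b : 0 <= K -> radius_ge1 a ->
  (forall n, modulus (b n) <= K * modulus (a n)) -> radius_ge1 b.
Proof.
move=> K0 ha ab r r01; have [B hB] := ha r r01; exists (K * B) => n.
have r0 : 0 <= r by case/andP: r01.
apply: le_trans (ler_wpM2l K0 (hB n)); rewrite mulrA ler_wpM2r ?exprn_ge0//.
Qed.

Lemma radius_ge1D a b : radius_ge1 a -> radius_ge1 b -> radius_ge1 (fun n => a n + b n).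
Proof.
move=> ha hb r r01; have [A hA] := ha r r01; have [B hB] := hb r r01; exists (A + B) => n.
have r0 : 0 <= r by case/andP: r01.
apply: le_trans (lerD (hA n) (hB n)); rewrite -mulrDl ler_wpM2r ?exprn_ge0//.
exact: modulusD_le.
Qed.

Lemma radius_ge1Z (k : C) a : radius_ge1 a -> radius_ge1 (fun n => k * a n).
Proof. by move=> ha; apply: radius_ge1_le (modulus_ge0 k) ha _ => n; rewrite modulusM. Qed.

Definition shift a n := a n.+1.

(** The shifted coefficients are dominated by those of the derived series, because n + 1 >= 1. *)
Lemma radius_ge1_shift a : radius_ge1 a -> radius_ge1 (shift a).
Proof.
move=> /radius_ge1_dps ha; apply: radius_ge1_le ler01 ha _ => n.
by rewrite mul1r modulusM modulus_natr ler_peMl ?modulus_ge0// ler1n.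
Qed.

Lemma psD a b z : radius_ge1 a -> radius_ge1 b -> modulus z < 1 ->
  ps (fun n => a n + b n) z = ps a z + ps b z.
Proof.
move=> ha hb z1; apply: ps_unique => // [|e e0]; first exact: radius_ge1D.
have e20 : 0 < e / 2 by rewrite divr_gt0.
have [N1 h1] := ps_cvg ha z1 e20; have [N2 h2] := ps_cvg hb z1 e20.
exists (maxn N1 N2) => n; rewrite geq_max => /andP[/h1 {}h1 /h2 {}h2].
have -> : psum (fun n => a n + b n) n z = psum a n z + psum b n z.
  by rewrite /psum -big_split; apply: eq_bigr => k _; rewrite mulrDl.
rewrite opprD addrACA (le_trans (modulusD_le _ _))// (splitr e).
by apply: lerD; rewrite modulusBC.
Qed.

Lemma psZ (k : C) a z : radius_ge1 a -> modulus z < 1 ->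
  ps (fun n => k * a n) z = k * ps a z.
Proof.
move=> ha z1; apply: ps_unique => // [|e e0]; first exact: radius_ge1Z.
have k0 : 0 < 1 + modulus k by rewrite ltr_pwDl// modulus_ge0.
have [N h] := ps_cvg ha z1 (divr_gt0 e0 k0); exists N => n /h {}h.
have -> : psum (fun n => k * a n) n z = k * psum a n z.
  by rewrite /psum mulr_sumr; apply: eq_bigr => i _; rewrite mulrA.
rewrite -mulrBr modulusM modulusBC; apply: le_trans (ler_wpM2l (modulus_ge0 k) h) _.
by rewrite mulrA ler_pdivrMr// mulrC ler_wpM2l ?(ltW e0)// lerDr.
Qed.

Lemma psum_recl a n z : psum a n.+1 z = a 0%N + z * psum (shift a) n z.
Proof.
rewrite /psum big_ord_recl expr0 mulr1 mulr_sumr; congr (_ + _).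
by apply: eq_bigr => i _; rewrite /shift lift0 exprS mulrCA.
Qed.

Lemma ps_shift a z : radius_ge1 a -> modulus z < 1 -> ps a z = a 0%N + z * ps (shift a) z.
Proof.
move=> ha z1; apply: ps_unique => // e e0.
have [N h] := ps_cvg (radius_ge1_shift ha) z1 e0; exists N.+1 => -[//|n].
rewrite ltnS => /h {}h; rewrite psum_recl opprD addrACA subrr add0r -mulrBr modulusM.
by rewrite modulusBC (le_trans _ h)// ler_piMl ?modulus_ge0// ltW.
Qed.

Lemma eq_ps a b z : (forall n, a n = b n) -> ps a z = ps b z.
Proof. by move=> ab; congr ps; apply/funext. Qed.

(** Both sides sum u_k v_l over the triangle k + l < m. *)
Lemma triangle_sum (A : pzRingType) (u v : nat -> A) m :
  \sum_(n < m) \sum_(k < n.+1) u k * v (n - k)%N =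
  \sum_(k < m) u k * \sum_(l < m - k) v l.
Proof.
elim: m => [|m IH]; first by rewrite !big_ord0.
rewrite big_ord_recr /= IH [RHS]big_ord_recr /= subSnn big_ord1.
rewrite [X in _ + X]big_ord_recr /= subnn addrA; congr (_ + _).
rewrite -big_split; apply: eq_bigr => k _ /=.
by rewrite subSn ?(ltnW (ltn_ord k))// big_ord_recr /= mulrDr.
Qed.

Definition conv a b n : C := \sum_(k < n.+1) a k * b (n - k)%N.

Lemma psum_conv a b m z :
  psum (conv a b) m z = \sum_(k < m) (a k * z ^+ k) * psum b (m - k) z.
Proof.
rewrite /psum -(triangle_sum (fun k => a k * z ^+ k) (fun l => b l * z ^+ l)).
apply: eq_bigr => n _; rewrite /conv mulr_suml; apply: eq_bigr => k _.
by rewrite mulrACA -exprD subnKC// -ltnS.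
Qed.

Lemma radius_ge1_conv a b : radius_ge1 a -> radius_ge1 b -> radius_ge1 (conv a b).
Proof.
move=> ha hb r r01.
have r0 : 0 <= r by case/andP: r01.
have [A [q [A0 q01 hA]]] := psum_geometric ha r01; have [B hB] := hb r r01.
have B0 : 0 <= B by apply: le_trans (hB 0%N); rewrite mulr_ge0 ?modulus_ge0 ?exprn_ge0.
have q10 : 0 < 1 - q by rewrite subr_gt0; case/andP: q01.
have q0 : 0 <= q by case/andP: q01.
exists (A * (1 - q)^-1 * B) => n; rewrite /conv.
have rm : modulus (r%:C%C : C) = r by rewrite modulus_real ger0_norm.
apply: (@le_trans _ _ (\sum_(k < n.+1) (A * q ^+ k) * B)).
  apply: le_trans (ler_wpM2r _ (modulus_sum _ _ _)) _; first by rewrite exprn_ge0.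
  rewrite mulr_suml; apply: ler_sum => k _.
  have -> : r ^+ n = r ^+ k * r ^+ (n - k) by rewrite -exprD subnKC// -ltnS.
  rewrite modulusM mulrACA.
  apply: ler_pM; rewrite ?mulr_ge0 ?modulus_ge0 ?exprn_ge0//.
  have := hA r%:C%C; rewrite rm => /(_ (lexx _) k).
  by rewrite modulusM modulusX rm.
rewrite -mulr_suml ler_wpM2r// -mulr_sumr ler_wpM2l// -[leRHS]mul1r ler_pdivlMr//.
have := subrX1 q n.+1; rewrite -opprB -[q - 1]opprB mulNr => /oppr_inj.
by rewrite mulrC => <-; rewrite gerBl exprn_ge0.
Qed.

(** Against (partial sum of a) times (sum of b), the error pairs the k-th term of a with the tail of
    b after n - k terms: n products, each at most A B Q^n. *)
Lemma psM a b z : radius_ge1 a -> radius_ge1 b -> modulus z < 1 ->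
  ps (conv a b) z = ps a z * ps b z.
Proof.
move=> ha hb z1; apply: ps_unique => // [|e e0]; first exact: radius_ge1_conv.
have r01 : 0 <= modulus z < 1 by rewrite modulus_ge0.
have [A [q [A0 /andP[q0 q1] hA]]] := psum_geometric ha r01.
have [B [q' [B0 /andP[q'0 q'1] hB]]] := ps_psum_le hb r01.
pose Q := Num.max q q'.
have qQ : q <= Q by rewrite le_max lexx.
have q'Q : q' <= Q by rewrite le_max lexx orbT.
have Q1 : Q < 1 by rewrite gt_max q1.
have Q0 : 0 <= Q := le_trans q0 qQ.
have e20 : 0 < e / 2 by rewrite divr_gt0.
have b0 : 0 < 1 + modulus (ps b z) by rewrite ltr_pwDl// modulus_ge0.
have [N1 h1] := ps_cvg ha z1 (divr_gt0 e20 b0).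
(* The number n of terms is absorbed by a slightly larger ratio: n Q^n is at most a constant times
   Q2^n. *)
pose Q2 := (1 + Q) / 2.
have Q20 : 0 < Q2 by rewrite /Q2; lra.
have Q21 : Q2 < 1 by rewrite /Q2; lra.
have QQ2 : Q < Q2 by rewrite /Q2; lra.
have QQ : 0 <= Q / Q2 < 1 by rewrite divr_ge0 ?(ltW Q20)//= ltr_pdivrMr// mul1r.
pose K := A * B * (1 - Q / Q2)^-1.
have : K * Q2 ^+ n @[n --> \oo] --> 0.
  rewrite -[X in _ --> X](mulr0 K); apply: cvgMr; apply: cvg_expr.
  by rewrite ger0_norm ?(ltW Q20).
move=> /cvgrPdist_le/(_ _ e20)[N2 _ h2].
exists (maxn N1 N2) => n; rewrite geq_max => /andP[/h1 {}h1 /h2 {}h2].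
apply: le_trans (modulus_tri (psum a n z * ps b z) _ _) _; rewrite (splitr e).
apply: lerD; last first.
  rewrite -mulrBl modulusM modulusBC; apply: le_trans (ler_wpM2r (modulus_ge0 _) h1) _.
  by rewrite mulrAC ler_pdivrMr// ler_wpM2l ?(ltW e20)// lerDr.
move: h2; rewrite sub0r normrN => h2; apply: le_trans (le_trans (ler_norm _) h2).
rewrite psum_conv {2}/psum mulr_suml -sumrB.
apply: le_trans (modulus_sum _ _ _) _.
apply: (@le_trans _ _ (\sum_(k < n) A * B * Q ^+ n)).
  apply: ler_sum => k _; rewrite -mulrBr modulusM.
  have -> : Q ^+ n = Q ^+ k * Q ^+ (n - k) by rewrite -exprD subnKC// ltnW.
  rewrite mulrACA.
  apply: ler_pM; rewrite ?modulus_ge0//.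
    apply: le_trans (hA z (lexx _) k) _; rewrite ler_wpM2l// lerXn2r ?nnegrE//.
  rewrite modulusBC; apply: le_trans (hB z (n - k)%N (lexx _)) _.
  by rewrite ler_wpM2l// lerXn2r ?nnegrE.
have h : n%:R * Q ^+ n <= (1 - Q / Q2)^-1 * Q2 ^+ n.
  rewrite -ler_pdivrMr ?exprn_gt0// -mulrA -expr_div_n.
  apply: le_trans (natr_expr_le n QQ); rewrite ler_wpM2r ?ler_nat//.
  by rewrite exprn_ge0//; case/andP: QQ.
rewrite sumr_const card_ord -mulr_natl mulrCA /K -[leRHS]mulrA.
by rewrite ler_wpM2l ?mulr_ge0.
Qed.

End power_series_algebra.

#[global] Opaque ps.

(** * Weights and growth of coefficients *)

Section weights.
Variables (R : realType) (p : R) (p_gt1 : 1 < p).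
Local Notation C := (Cplx R).
Implicit Types (c : R) (n : nat).

Let p_gt0 : 0 < p. Proof. exact: lt_trans p_gt1. Qed.
Let p1_gt0 : 0 < p + 1. Proof. by rewrite addr_gt0. Qed.

Lemma one_powR (q : R) : 1 `^ q = 1 :> R. Proof. by rewrite powR1. Qed.

Lemma powR_lt_inv (q x y : R) : 0 <= q -> 0 <= x -> 0 <= y -> x `^ q < y `^ q -> x < y.
Proof.
move=> q0 x0 y0; rewrite !ltNge => /negP h; apply/negP => yx; apply: h.
by rewrite ge0_ler_powR ?nnegrE.
Qed.

Definition npow n : R := n%:R `^ (p + 1)^-1.
Definition wt c n : R := expR (- (c * npow n)).

Lemma npow_ge0 n : 0 <= npow n. Proof. exact: powR_ge0. Qed.

Lemma wt_gt0 c n : 0 < wt c n. Proof. exact: expR_gt0. Qed.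

Lemma wt_ge0 c n : 0 <= wt c n. Proof. exact: expR_ge0. Qed.

Lemma wt_le1 c n : 0 < c -> wt c n <= 1.
Proof. by move=> c0; rewrite expR_le1 oppr_le0 mulr_ge0 ?npow_ge0// ltW. Qed.

Lemma wt_anti c c' n : c <= c' -> wt c' n <= wt c n.
Proof. by move=> cc; rewrite ler_expR lerN2 ler_wpM2r ?npow_ge0. Qed.

Lemma le_npow m n : (m <= n)%N -> npow m <= npow n.
Proof. by move=> mn; rewrite /npow ge0_ler_powR ?nnegrE ?invr_ge0 ?(ltW p1_gt0)// ler_nat. Qed.

(** Monotonicity alone: n^(1/(p+1)) at m + n is at least the average of its values at m and n. This
    is the source of the halved index for products. *)
Lemma wtD c m n : 0 < c -> wt c (m + n) <= wt (c / 2) m * wt (c / 2) n.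
Proof.
move=> c0; rewrite /wt -expRD ler_expR -opprD lerN2.
have h1 := ler_wpM2l (ltW c0) (le_npow (leq_addr n m)).
have h2 := ler_wpM2l (ltW c0) (le_npow (leq_addl m n)).
move: h1 h2; move: (npow m) (npow n) (npow (m + n)) => x y z; lra.
Qed.

(** m + n is at most twice the larger one, and 2^(1/(p+1)) <= 2. *)
Lemma npowD m n : npow (m + n) <= 2 * (npow m + npow n).
Proof.
wlog mn : m n / (m <= n)%N => [h|].
  by have [/h//|/ltnW/h] := leqP m n; rewrite addnC [npow n + _]addrC.
apply: (@le_trans _ _ (npow (2 * n))); first by rewrite le_npow// mul2n -addnn leq_add2r.
rewrite /npow natrM powRM//; apply: ler_pM; rewrite ?powR_ge0//.
  rewrite -[leRHS]powRr1// ler_powR ?ler1n// invf_le1// lerDr; exact: ltW.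
by rewrite lerDr powR_ge0.
Qed.

Lemma wt_mul c m n : 0 < c -> wt (2 * c) m * wt (2 * c) n <= wt c (m + n).
Proof.
move=> c0; rewrite /wt -expRD ler_expR -opprD lerN2 -mulrDr -mulrA mulrCA.
by rewrite ler_wpM2l ?(ltW c0)// npowD.
Qed.

(* [n = (npow n) ^ (p + 1)], so [c * npow n > n * y] forces [npow n < (c / y) ^ (1 / p)]. *)
Lemma npow_young c n (y : R) : 0 < c -> 0 < y ->
  c * npow n - n%:R * y <= c * (c / y) `^ p^-1.
Proof.
move=> c0 y0; have R0 : 0 <= c * (c / y) `^ p^-1 by rewrite mulr_ge0 ?powR_ge0// ltW.
case: n => [|n]; first by rewrite mul0r subr0 /npow powR0 ?mulr0// invr_neq0// gt_eqF.
set t := npow n.+1.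
have t0 : 0 < t by rewrite powR_gt0.
have nt : n.+1%:R = t * t `^ p.
  rewrite -{1}[t]powRr1 ?(ltW t0)// -powRD; last by rewrite (gt_eqF t0) implybT.
  by rewrite /t /npow -powRrM [1 + p]addrC mulVf ?gt_eqF// powRr1.
have [h|h] := leP (c * t) (n.+1%:R * y).
  by rewrite (le_trans _ R0)// subr_le0.
apply: (@le_trans _ _ (c * t)); first by rewrite gerBl mulr_ge0// ltW.
rewrite ler_wpM2l ?(ltW c0)//.
move: h; rewrite nt -mulrA [c * t]mulrC ltr_pM2l// => h.
rewrite -[leLHS]powRr1 ?(ltW t0)// -(@mulfV _ p) ?gt_eqF// powRrM.
rewrite ge0_ler_powR ?nnegrE ?invr_ge0 ?powR_ge0 ?divr_ge0 ?(ltW p_gt0) ?(ltW c0) ?(ltW y0)//.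
by rewrite ler_pdivlMr// ltW.
Qed.

(** The constant comparing evaluation on |z| <= r with N_c; its logarithm has the order (1 -
    r)^(-1/p) that defines F^p. *)
Definition eval_const c (r : R) := expR (c * (c / (1 - r)) `^ p^-1).

(** From r <= exp(-(1 - r)), followed by [npow_young] with y = 1 - r. *)
Lemma expr_le_wt c (r : R) n : 0 < c -> 0 <= r < 1 -> r ^+ n <= eval_const c r * wt c n.
Proof.
move=> c0 /andP[r0 r1]; have r10 : 0 < 1 - r by rewrite subr_gt0.
have h : r <= expR (- (1 - r)).
  by have := expR_ge1Dx (- (1 - r)); rewrite opprB addrCA subrr addr0.
apply: (@le_trans _ _ (expR (- (n%:R * (1 - r))))).
  by rewrite -mulrN expRM_natl lerXn2r ?nnegrE ?expR_ge0.
rewrite /eval_const /wt -expRD ler_expR -lerBlDr opprK addrC.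
exact: npow_young.
Qed.

Lemma sum_inv_square_le n : \sum_(k < n.+1) (k.+1%:R ^+ 2)^-1 <= 2 - n.+1%:R^-1 :> R.
Proof.
elim: n => [|n IH]; first by rewrite big_ord1 expr1n invr1; lra.
rewrite big_ord_recr /=; apply: le_trans (lerD IH (lexx _)) _.
have n1 : 0 < n.+1%:R :> R by rewrite ltr0n.
have -> : n.+2%:R = n.+1%:R + 1 :> R by rewrite natr1.
move: (n.+1%:R : R) n1 => u u0.
have u10 : 0 < u + 1 by rewrite addr_gt0.
rewrite -lerBrDl [leRHS](_ : _ = (u * (u + 1))^-1); last first.
  by field; rewrite !gt_eqF.
rewrite lef_pV2 ?posrE ?exprn_gt0 ?mulr_gt0// expr2 ler_wpM2r ?(ltW u10)//; lra.
Qed.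

(** From (x / m)^m <= exp x at x = c k^(1/(p+1)), with m >= 2 (p + 1) so that the m-th power reaches
    k^2. *)
Lemma wt_le_inv_square c : 0 < c ->
  exists2 D, 0 <= D & forall k, wt c k.+1 <= D * (k.+1%:R ^+ 2)^-1.
Proof.
move=> c0; pose m := (Num.bound (2 * (p + 1))).+1.
have m0 : 0 < m%:R :> R by rewrite ltr0n.
have mb : 2 * (p + 1) <= m%:R.
  apply: le_trans (ltW (archi_boundP _)) _; first by rewrite mulr_ge0 ?(ltW p1_gt0).
  by rewrite ler_nat.
pose D := (m%:R / c) ^+ m.
have D0 : 0 <= D by rewrite exprn_ge0// divr_ge0 ?(ltW m0) ?(ltW c0).
exists D => // k.
have t0 : 0 < npow k.+1 by rewrite powR_gt0.
have t1 : 0 < c * npow k.+1 by rewrite mulr_gt0.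
have h1 : (c * npow k.+1 / m%:R) ^+ m <= expR (c * npow k.+1).
  rewrite -{2}[c * npow k.+1](@mulfVK _ m%:R) ?gt_eqF// [X in expR X]mulrC expRM_natl.
  have q0 : 0 <= c * npow k.+1 / m%:R by rewrite divr_ge0 ?(ltW t1) ?(ltW m0).
  rewrite lerXn2r ?nnegrE ?expR_ge0//.
  by apply: le_trans (expR_ge1Dx _); rewrite lerDr.
have h2 : k.+1%:R ^+ 2 <= npow k.+1 ^+ m.
  rewrite -!powR_mulrn ?ler0n ?(ltW t0)// /npow -powRrM ler_powR ?ler1n//.
  by rewrite mulrC ler_pdivlMr.
have h3 : npow k.+1 ^+ m = D * (c * npow k.+1 / m%:R) ^+ m.
  rewrite /D -exprMn; congr (_ ^+ _); move: (npow k.+1) (m%:R : R) m0 => t u u0.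
  by field; rewrite !gt_eqF.
rewrite /wt expRN ler_pdivlMr ?exprn_gt0// mulrC ler_pdivrMr ?expR_gt0//.
by apply: le_trans h2 _; rewrite h3 ler_wpM2l.
Qed.

Lemma wt_sum_bounded c : 0 < c -> exists K, forall n, \sum_(k < n) wt c k <= K.
Proof.
move=> c0; have [D D0 hk] := wt_le_inv_square c0.
exists (1 + D * 2) => -[|n]; first by rewrite big_ord0 addr_ge0// mulr_ge0.
rewrite big_ord_recl; apply: lerD; first exact: wt_le1.
apply: (@le_trans _ _ (\sum_(k < n.+1) D * (k.+1%:R ^+ 2)^-1)).
  rewrite [leRHS]big_ord_recr -[leLHS]addr0; apply: lerD; last first.
    by apply: mulr_ge0; rewrite ?invr_ge0 ?exprn_ge0.
  by apply: ler_sum => k _; rewrite lift0; exact: hk.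
rewrite -mulr_sumr ler_wpM2l//; apply: le_trans (sum_inv_square_le n) _.
by rewrite gerBl invr_ge0.
Qed.

(** Finiteness of all coefficient seminorms; by [Fp_of_coef] and [Fp_coef_adm] this characterises
    the coefficient sequences of F^p. *)
Definition adm (a : nat -> C) := forall c, 0 < c ->
  exists B, forall n, \sum_(k < n) modulus (a k) * wt c k <= B.

Lemma term_le_sum (u : nat -> R) n : (forall k, 0 <= u k) -> u n <= \sum_(k < n.+1) u k.
Proof. by move=> u0; rewrite big_ord_recr /= lerDr sumr_ge0. Qed.

Lemma mterm_ge0 (a : nat -> C) c k : 0 <= modulus (a k) * wt c k.
Proof. by rewrite mulr_ge0 ?modulus_ge0 ?wt_ge0. Qed.

Lemma eval_const_ge0 c (r : R) : 0 <= eval_const c r.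
Proof. exact: expR_ge0. Qed.

Lemma adm_radius (a : nat -> C) : adm a -> radius_ge1 a.
Proof.
move=> ha r r01; have [B hB] := ha 1 ltr01; exists (eval_const 1 r * B) => n.
apply: le_trans (ler_wpM2l (modulus_ge0 _) (expr_le_wt n ltr01 r01)) _.
rewrite mulrCA ler_wpM2l ?eval_const_ge0//; apply: le_trans (hB n.+1).
by apply: (@term_le_sum (fun k => modulus (a k) * wt 1 k)) => k; exact: mterm_ge0.
Qed.

Lemma ps_eval_le (a : nat -> C) c (B r : R) z : radius_ge1 a -> 0 < c ->
  (forall n, \sum_(k < n) modulus (a k) * wt c k <= B) -> modulus z <= r -> r < 1 ->
  modulus (ps a z) <= eval_const c r * B.
Proof.
move=> ha c0 hB zr r1; apply: ps_le => //; first exact: le_lt_trans r1.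
move=> n; apply: le_trans (ler_wpM2l (eval_const_ge0 c r) (hB n)).
rewrite mulr_sumr; apply: ler_sum => k _; rewrite mulrCA ler_wpM2l ?modulus_ge0//.
have r01 : 0 <= r < 1 by rewrite r1 andbT (le_trans _ zr)// modulus_ge0.
apply: le_trans (expr_le_wt k c0 r01); rewrite lerXn2r ?nnegrE ?modulus_ge0//.
by case/andP: r01.
Qed.

Definition psfun (a : nat -> C) (z : disk R) : C := ps a (val z).

Lemma ext_psfun (a : nat -> C) z : modulus z < 1 -> ext (psfun a) z = ps a z.
Proof.
by move=> z1; have zD : z \in disk R by [rewrite inE]; exact: (extE (psfun a) (exist _ z zD)).
Qed.

Lemma holomorphic_psfun (a : nat -> C) : radius_ge1 a -> holomorphic (psfun a).
Proof.
move=> ha z z1; have : cderiv (ext (psfun a)) z (ps (dps a) z).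
  apply: cderiv_near (cderiv_ps ha z1).
  by apply: filterS (open_disk z1) => w w1; rewrite ext_psfun.
by move=> /cderivP[].
Qed.

(** Multiplying log M(r) <= c (c / (1 - r))^(1/p) + logp B by (1 - r)^(1/p) turns the first term
    into c^(1 + 1/p) <= c, with c arbitrarily small. *)
Lemma Fp_set_psfun (a : nat -> C) : adm a -> Fp_set p (psfun a).
Proof.
move=> ha; have hr := adm_radius ha; have hh := holomorphic_psfun hr; split=> //.
apply/cvgrPdist_le => e e0.
pose c := Num.min 1 (e / 2).
have c0 : 0 < c by rewrite lt_min ltr01 divr_gt0.
have c1 : c <= 1 by rewrite ge_min lexx.
have ce : c <= e / 2 by rewrite ge_min lexx orbT.
have [B hB] := ha c c0.
have B0 : 0 <= B by have := hB 0%N; rewrite big_ord0.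
have := cvg_powR_left1 (logp B) p_gt0; move/cvgrPdist_le => /(_ _ (divr_gt0 e0 (ltr0Sn _ 1))) h.
near=> r.
have /andP[r0 r1] : 0 <= r < 1 by near: r; exact: near_left1.
have : `|0 - (1 - r) `^ p^-1 * logp B| <= e / 2 by near: r; exact: h.
rewrite !sub0r !normrN => hB2.
have x0 : 0 < 1 - r by rewrite subr_gt0.
have xp0 : 0 < (1 - r) `^ p^-1 by rewrite powR_gt0.
have M0 : 0 <= M_infty (psfun a) r by apply: M_infty_ge0; rewrite ?r0.
rewrite ger0_norm ?mulr_ge0 ?logp_ge0 ?powR_ge0//.
have hM : M_infty (psfun a) r <= eval_const c r * B.
  apply: M_infty_le; rewrite ?r0//.
  by move=> z zr; exact: (ps_eval_le hr c0 hB zr r1).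
have hl : logp (M_infty (psfun a) r) <= c * (c / (1 - r)) `^ p^-1 + logp B.
  apply: le_trans (le_logp hM) _; apply: le_trans (logpM (eval_const_ge0 _ _) B0) _.
  rewrite lerD2r /logp /eval_const expRK ge_max lexx /= mulr_ge0 ?powR_ge0// ltW//.
apply: le_trans (ler_wpM2l (powR_ge0 _ _) hl) _; rewrite mulrDr (splitr e).
apply: lerD; last by apply: le_trans (ler_norm _) hB2.
rewrite mulrCA -powRM ?divr_ge0 ?(ltW c0) ?(ltW x0)// mulrCA mulfV ?gt_eqF// mulr1.
apply: le_trans ce; rewrite ler_piMr ?(ltW c0)//.
by rewrite -[leRHS](one_powR p^-1) ge0_ler_powR ?nnegrE ?invr_ge0 ?(ltW p_gt0) ?(ltW c0).
Unshelve. all: by end_near. Qed.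

Lemma Fp_of_coef (a : nat -> C) : adm a -> exists f : Fp p_gt1,
  (forall n, taylor_coef f n = a n) /\ (forall z, f z = ps a (val z)).
Proof.
move=> ha; have hF : psfun a \in Fp_pred p_gt1 by rewrite inE; exact: Fp_set_psfun.
exists (MkFp hF); split=> // n /=.
apply: (@taylor_coef_ps R _ a 1); rewrite ?ltr01 ?lexx//; first exact: adm_radius.
exact: ext_psfun.
Qed.

(** Cauchy's estimate at s = 1 - dl t^(-p), with t = n^(1/(p+1)): the growth condition bounds M(s)
    by exp(c t / 2), and s^(-n) is at most exp(2 dl t) <= exp(c t / 2). The weight exp(-c t)
    compensates both. *)
Lemma Fp_coef_growth (f : Fp p_gt1) c : 0 < c ->
  exists K, forall n, modulus (taylor_coef f n) * wt c n <= K.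
Proof.
move=> c0; case: f => f /=; rewrite inE => -[hf gf].
(* The bound c / 4 serves the exponent 2 dl t, the bound 1/2 the inequality (1 - y)(1 + 2 y) >=
   1. *)
pose dl := Num.min (c / 4) (1 / 2).
have dl0 : 0 < dl by rewrite lt_min !divr_gt0.
have dlc : dl <= c / 4 by rewrite ge_min lexx.
have dl2 : dl <= 1 / 2 by rewrite ge_min lexx orbT.
(* Since y^(1/p) = dl^(1/p) / t, this tolerance becomes exactly c t / 2 after division. *)
pose ep := c / 2 * dl `^ p^-1.
have ep0 : 0 < ep by rewrite mulr_gt0 ?powR_gt0// divr_gt0.
move/cvgrPdist_le/(_ _ ep0) : gf => [d /= d0 hd].
(* As n = (t^p)^((p+1)/p), beyond n0 the distance y from s to 1 is below d. *)
pose n0 := (Num.bound ((dl / d) `^ (p^-1 * (p + 1)))).+1.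
have hbig n : (n0 <= n)%N -> modulus (taylor_coef f n) * wt c n <= 2.
  move=> nn0; rewrite (taylor_coefE hf).
  have n0' : (0 < n)%N by exact: leq_trans nn0.
  set t := npow n; have t1 : 1 <= t.
    rewrite -(one_powR (p + 1)^-1) /t /npow ge0_ler_powR ?nnegrE ?invr_ge0 ?(ltW p1_gt0)//.
    by rewrite ler1n.
  have t0 : 0 < t := lt_le_trans ltr01 t1.
  have nt : n%:R = t * t `^ p.
    rewrite -{1}[t]powRr1 ?(ltW t0)// -powRD; last by rewrite (gt_eqF t0) implybT.
    by rewrite /t /npow -powRrM [1 + p]addrC mulVf ?gt_eqF// powRr1.
  have tp0 : 0 < t `^ p by rewrite powR_gt0.
  have tp1 : 1 <= t `^ p by rewrite -(powRr0 t) ler_powR// ltW.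
  pose y := dl / t `^ p.
  have y0 : 0 < y by rewrite divr_gt0.
  have y2 : y <= 1 / 2 by rewrite (le_trans _ dl2)// ler_pdivrMr// ler_peMr// ltW.
  have yd : y < d.
    rewrite ltr_pdivrMr// mulrC -ltr_pdivrMr//.
    have : (dl / d) `^ (p^-1 * (p + 1)) < n%:R.
      apply: lt_le_trans (archi_boundP (powR_ge0 _ _)) _.
      by rewrite ler_nat (leq_trans _ nn0).
    have -> : n%:R = (t `^ p) `^ (p^-1 * (p + 1)).
      rewrite -powRrM mulrA mulfV ?gt_eqF// mul1r /t /npow -powRrM mulVf ?gt_eqF//.
      by rewrite powRr1.
    have q0 : 0 <= p^-1 * (p + 1) by rewrite mulr_ge0 ?invr_ge0 ?(ltW p_gt0) ?(ltW p1_gt0).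
    by apply: (powR_lt_inv q0 _ (ltW tp0)); rewrite divr_ge0 ?(ltW dl0) ?(ltW d0).
  pose s := 1 - y.
  have s01 : 0 < s < 1 by rewrite /s; apply/andP; split; lra.
  have [s0 s1] := andP s01.
  have M0 : 0 <= M_infty f s by apply: M_infty_ge0; rewrite ?(ltW s0).
  have hlog : y `^ p^-1 * logp (M_infty f s) <= ep.
    have := hd s; rewrite /ball /= (_ : 1 - s = y); last by rewrite /s; ring.
    rewrite (ger0_norm (ltW y0)) => /(_ yd s1); rewrite sub0r normrN.
    by move=> /(le_trans (ler_norm _)).
  have yp : y `^ p^-1 = dl `^ p^-1 / t.
    rewrite /y powRM ?invr_ge0 ?(ltW dl0) ?(ltW tp0)//; congr (_ * _).
    by rewrite -powRN -powRrM mulNr mulfV ?(gt_eqF p_gt0)// powRN powRr1 ?(ltW t0).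
  have hM : M_infty f s <= expR (c / 2 * t).
    have hl : logp (M_infty f s) <= c / 2 * t.
      move: hlog; rewrite yp /ep mulrAC -ler_pdivlMr ?invr_gt0// invrK => hh.
      rewrite -(ler_pM2l (powR_gt0 p^-1 dl0)); apply: le_trans hh _.
      by rewrite le_eqVlt; apply/orP; left; apply/eqP; move: (dl `^ p^-1) => w; ring.
    have [M00|M00] := leP (M_infty f s) 0; first by rewrite (le_trans M00)// expR_ge0.
    rewrite -[leLHS](lnK (x := M_infty f s)) ?posrE// ler_expR (le_trans _ hl)//.
    by rewrite le_max lexx.
  have hs : 1 <= s ^+ n * expR (2 * (n%:R * y)).
    have h1 : 1 <= s * expR (2 * y).
      apply: (@le_trans _ _ (s * (1 + 2 * y))); last by rewrite ler_pM2l// expR_ge1Dx.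
      rewrite /s; have : y * y <= y * (1 / 2) by rewrite ler_pM2l.
      lra.
    by rewrite mulrCA expRM_natl -exprMn exprn_ege1.
  have hny : n%:R * y = dl * t.
    by rewrite nt /y; move: (t `^ p) tp0 => w w0; field; rewrite gt_eqF.
  have h := tcoef_le hf n s01.
  apply: (@le_trans _ _ ((modulus (tcoef f n) * s ^+ n) * (expR (2 * (n%:R * y)) * wt c n))).
    rewrite -mulrA ler_wpM2l ?modulus_ge0// mulrA ler_peMl ?wt_ge0//.
  apply: le_trans (ler_wpM2r _ (le_trans h (ler_wpM2l _ hM))) _ => //.
    by rewrite mulr_ge0 ?expR_ge0 ?wt_ge0.
  rewrite -mulrA ler_piMr// /wt -/t -!expRD expR_le1 hny.
  have : dl * t <= c / 4 * t by rewrite ler_pM2r.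
  by rewrite !(mulrAC c _ t); move: (dl * t) (c * t) => X Y; lra.
exists (2 + \sum_(k < n0) modulus (taylor_coef f k) * wt c k) => n.
have S0 : 0 <= \sum_(k < n0) modulus (taylor_coef f k) * wt c k.
  by rewrite sumr_ge0// => k _; rewrite mulr_ge0 ?modulus_ge0 ?wt_ge0.
have [/hbig h|h] := leqP n0 n; first by rewrite (le_trans h)// lerDl.
rewrite (bigD1 (Ordinal h)) //= addrCA lerDl addr_ge0// sumr_ge0// => k _.
by rewrite mulr_ge0 ?modulus_ge0 ?wt_ge0.
Qed.

(** Half of the index bounds the terms, the other half makes the series of weights converge. *)
Lemma Fp_coef_adm (f : Fp p_gt1) : adm (taylor_coef f).
Proof.
move=> c c0; have c20 : 0 < c / 2 by rewrite divr_gt0.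
have [K hK] := Fp_coef_growth f c20; have [W hW] := wt_sum_bounded c20.
have K0 : 0 <= K by apply: le_trans (hK 0%N); rewrite mulr_ge0 ?modulus_ge0 ?wt_ge0.
exists (K * W) => n; apply: le_trans (ler_wpM2l K0 (hW n)); rewrite mulr_sumr.
apply: ler_sum => k _; apply: (@le_trans _ _ (modulus (taylor_coef f k) * wt (c / 2) k * wt (c / 2) k)).
  rewrite -mulrA ler_wpM2l ?modulus_ge0// /wt -expRD ler_expR -opprD lerN2.
  by rewrite -mulrDl -splitr.
by rewrite ler_wpM2r ?wt_ge0.
Qed.

End weights.

(** * The algebra F^p and its coefficient norms *)

Section Fp_norm.
Variables (R : realType) (p : R) (p_gt1 : 1 < p).
Local Notation C := (Cplx R).
Local Notation A := (Fp p_gt1).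
Implicit Types (f g : A) (c : R) (n : nat).

Let p_gt0 : 0 < p. Proof. exact: lt_trans p_gt1. Qed.

Lemma Fp_holomorphic f : holomorphic f.
Proof. by case: f => f /=; rewrite inE => -[]. Qed.

Lemma Fp_radius f : radius_ge1 (taylor_coef f).
Proof. exact: adm_radius (Fp_coef_adm f). Qed.

Lemma Fp_ext_ps f z : modulus z < 1 -> ext f z = ps (taylor_coef f) z.
Proof.
move=> z1; rewrite (ext_ps (@Fp_holomorphic f) z1); apply: eq_ps => n.
by rewrite (taylor_coefE (@Fp_holomorphic f)).
Qed.

Lemma diskP (z : disk R) : modulus (val z) < 1.
Proof. by case: z => z /= /set_mem. Qed.

Lemma Fp_valE f (z : disk R) : f z = ps (taylor_coef f) (val z).
Proof. by rewrite -extE Fp_ext_ps// diskP. Qed.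

Lemma Fp_ext f g : (forall z, f z = g z) -> f = g.
Proof. by move=> fg; apply/val_inj/funext. Qed.

Lemma Fp_coef_inj f g : (forall n, taylor_coef f n = taylor_coef g n) -> f = g.
Proof. by move=> fg; apply: Fp_ext => z; rewrite !Fp_valE; exact: eq_ps. Qed.

Lemma Fp_coef_uniq f a : radius_ge1 a -> (forall z, f z = ps a (val z)) ->
  forall n, taylor_coef f n = a n.
Proof.
move=> ha fa; apply: (@taylor_coef_ps R f a 1); rewrite ?ltr01 ?lexx// => z z1.
by have zD : z \in disk R; [rewrite inE|rewrite (extE f (exist _ z zD)) fa].
Qed.

Lemma FpDE f g z : (f + g) z = f z + g z. Proof. by []. Qed.
Lemma FpBE f g z : (f - g) z = f z - g z. Proof. by []. Qed.
Lemma FpME f g z : (f * g) z = f z * g z. Proof. by []. Qed.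
Lemma FpZE k f z : (k *: f) z = k * f z. Proof. by []. Qed.
Lemma Fp1E z : (1 : A) z = 1. Proof. by []. Qed.

Lemma Fp_coefD f g n : taylor_coef (f + g) n = taylor_coef f n + taylor_coef g n.
Proof.
apply: (@Fp_coef_uniq (f + g) (fun n => taylor_coef f n + taylor_coef g n)).
  exact: radius_ge1D (Fp_radius f) (Fp_radius g).
by move=> z; rewrite FpDE !Fp_valE psD//; [exact: Fp_radius|exact: Fp_radius|exact: diskP].
Qed.

Lemma Fp_coefZ (k : C) f n : taylor_coef (k *: f) n = k * taylor_coef f n.
Proof.
apply: (@Fp_coef_uniq (k *: f) (fun n => k * taylor_coef f n)).
  exact: radius_ge1Z (Fp_radius f).
by move=> z; rewrite FpZE !Fp_valE psZ//; [exact: Fp_radius|exact: diskP].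
Qed.

Lemma Fp_coefB f g n : taylor_coef (f - g) n = taylor_coef f n - taylor_coef g n.
Proof. by rewrite -scaleN1r Fp_coefD Fp_coefZ mulN1r. Qed.

Lemma Fp_coefM f g n : taylor_coef (f * g) n = conv (taylor_coef f) (taylor_coef g) n.
Proof.
apply: (@Fp_coef_uniq (f * g) (conv (taylor_coef f) (taylor_coef g))).
  exact: radius_ge1_conv (Fp_radius f) (Fp_radius g).
by move=> z; rewrite FpME !Fp_valE psM//; [exact: Fp_radius|exact: Fp_radius|exact: diskP].
Qed.

Definition wsum c (a : nat -> C) n : R := \sum_(k < n) modulus (a k) * wt p c k.

(** The real-valued version of [coef_seminorm]; [Fp_coef_adm] makes the supremum finite. *)
Definition wnorm c f : R := sup [set wsum c (taylor_coef f) n | n in [set: nat]].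

Lemma wsum_ge0 c a n : 0 <= wsum c a n.
Proof. by rewrite sumr_ge0// => k _; exact: mterm_ge0. Qed.

Lemma wsum_le c f n : 0 < c -> wsum c (taylor_coef f) n <= wnorm c f.
Proof.
move=> c0; apply: ub_le_sup; last by exists n.
by have [B hB] := Fp_coef_adm f c0; exists B => _ [m _ <-]; exact: hB.
Qed.

Lemma wnorm_le c f B : (forall n, wsum c (taylor_coef f) n <= B) -> wnorm c f <= B.
Proof.
move=> h; apply: ge_sup; first by exists (wsum c (taylor_coef f) 0), 0%N.
by move=> _ [n _ <-].
Qed.

Lemma wnorm_ge0 c f : 0 < c -> 0 <= wnorm c f.
Proof. by move=> c0; apply: le_trans (wsum_le f 0 c0); exact: wsum_ge0. Qed.

Lemma coef_le_wnorm c f n : 0 < c -> modulus (taylor_coef f n) * wt p c n <= wnorm c f.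
Proof.
move=> c0; apply: le_trans (wsum_le f n.+1 c0).
by apply: (@term_le_sum _ (fun k => modulus (taylor_coef f k) * wt p c k)) => k; exact: mterm_ge0.
Qed.

Lemma wnormD c f g : 0 < c -> wnorm c (f + g) <= wnorm c f + wnorm c g.
Proof.
move=> c0; apply: wnorm_le => n; apply: le_trans (lerD (wsum_le f n c0) (wsum_le g n c0)).
rewrite /wsum -big_split; apply: ler_sum => k _ /=.
rewrite Fp_coefD; apply: le_trans (ler_wpM2r (wt_ge0 _ _ _) (modulusD_le _ _)) _.
by rewrite mulrDl.
Qed.

Lemma wnormZ c k f : 0 < c -> wnorm c (k *: f) <= modulus k * wnorm c f.
Proof.
move=> c0; apply: wnorm_le => n; apply: le_trans (ler_wpM2l (modulus_ge0 k) (wsum_le f n c0)).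
rewrite /wsum mulr_sumr; apply: ler_sum => i _.
by rewrite Fp_coefZ modulusM mulrA.
Qed.

(** The Cauchy product truncated at n runs over a triangle inside the n by n square, and [wtD]
    splits the weights. *)
Lemma wnormM c f g : 0 < c -> wnorm c (f * g) <= wnorm (c / 2) f * wnorm (c / 2) g.
Proof.
move=> c0; have c20 : 0 < c / 2 by rewrite divr_gt0.
apply: wnorm_le => n.
apply: le_trans (ler_pM (wsum_ge0 _ _ _) (wsum_ge0 _ _ _) (wsum_le f n c20) (wsum_le g n c20)).
pose u k := modulus (taylor_coef f k) * wt p (c / 2) k.
pose v k := modulus (taylor_coef g k) * wt p (c / 2) k.
apply: (@le_trans _ _ (\sum_(i < n) \sum_(k < i.+1) u k * v (i - k)%N)).
  apply: ler_sum => i _; rewrite Fp_coefM /conv.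
  apply: le_trans (ler_wpM2r (wt_ge0 _ _ _) (modulus_sum _ _ _)) _.
  rewrite mulr_suml; apply: ler_sum => k _.
  rewrite modulusM /u /v mulrACA ler_wpM2l ?mulr_ge0 ?modulus_ge0//.
  by have := wtD p_gt1 k (i - k) c0; rewrite subnKC// -ltnS.
have -> : wsum (c / 2) (taylor_coef f) n = \sum_(k < n) u k by [].
rewrite triangle_sum mulr_suml; apply: ler_sum => k _.
rewrite ler_wpM2l ?mterm_ge0// /wsum.
have := @big_nat_widen R 0 +%R 0 (n - k) n xpredT v (leq_subr _ _).
rewrite !big_mkord => ->; rewrite [leLHS]big_mkcond; apply: ler_sum => l _ /=.
by case: ifP => // _; exact: mterm_ge0.
Qed.

Lemma wnorm_anti c c' f : 0 < c -> c <= c' -> wnorm c' f <= wnorm c f.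
Proof.
move=> c0 cc; apply: wnorm_le => n; apply: le_trans (wsum_le f n c0).
by apply: ler_sum => k _; rewrite ler_wpM2l ?modulus_ge0// wt_anti.
Qed.

Lemma wnorm_sep f : (forall c, 0 < c -> wnorm c f <= 0) -> f = 0.
Proof.
move=> h; have f0 n : taylor_coef f n = 0.
  apply/eqP; rewrite -modulus_eq0 eq_le modulus_ge0 andbT.
  have := le_trans (coef_le_wnorm f n ltr01) (h 1 ltr01).
  by rewrite pmulr_lle0 ?wt_gt0.
apply: Fp_coef_inj => n; rewrite f0.
by have := Fp_coefZ 0 f n; rewrite scale0r mul0r.
Qed.

(** Coefficients converge one by one because each weight is positive; the Cauchy estimate then
    passes to the limit in each finite partial sum. *)
Lemma wnorm_complete (u : nat -> A) :
  (forall c e, 0 < c -> 0 < e -> exists m0, forall m, (m0 <= m)%N -> wnorm c (u m - u m0) <= e) ->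
  exists v, forall c e, 0 < c -> 0 < e ->
    exists m0, forall m, (m0 <= m)%N -> wnorm c (u m - v) <= e.
Proof.
move=> hu.
have hk k : exists l : C, forall e, 0 < e ->
    exists N, forall n, (N <= n)%N -> modulus (taylor_coef (u n) k - l) <= e.
  apply: cauchy_complex => e e0.
  have [m0 h] := hu 1 (e * wt p 1 k) ltr01 (mulr_gt0 e0 (wt_gt0 _ _ _)).
  exists m0 => m /h {}h; rewrite -Fp_coefB -(ler_pM2r (wt_gt0 p 1 k)).
  exact: le_trans (coef_le_wnorm _ _ ltr01) h.
have [a aP] := choice hk.
have lim c n e : 0 < c -> 0 < e -> exists M, forall m, (M <= m)%N ->
    wsum c (fun k => taylor_coef (u m) k - a k) n <= e.
  move=> c0; elim: n e => [|n IH] e e0.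
    by exists 0%N => m _; rewrite /wsum big_ord0 ltW.
  have e20 : 0 < e / 2 by rewrite divr_gt0.
  have [M1 h1] := IH _ e20; have [M2 h2] := aP n _ e20.
  exists (maxn M1 M2) => m; rewrite geq_max => /andP[/h1 {}h1 /h2 {}h2].
  rewrite /wsum big_ord_recr /= (splitr e) lerD//.
  by apply: le_trans h2; rewrite ler_piMr ?modulus_ge0// wt_le1.
have tri c (b d e : nat -> C) n :
    wsum c (fun k => b k - e k) n <= wsum c (fun k => b k - d k) n + wsum c (fun k => d k - e k) n.
  rewrite /wsum -big_split; apply: ler_sum => k _ /=.
  by rewrite -mulrDl ler_wpM2r ?wt_ge0// modulus_tri.
(* The rank m0 is uniform in n: only the auxiliary index m', which disappears from the conclusion,
   depends on n. *)
have close c e : 0 < c -> 0 < e -> exists m0, forall m, (m0 <= m)%N ->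
    forall n, wsum c (fun k => taylor_coef (u m) k - a k) n <= e.
  move=> c0 e0; have e30 : 0 < e / 3 by rewrite divr_gt0.
  have [m0 h0] := hu c _ c0 e30; exists m0 => m mm n.
  have [M hM] := lim c n _ c0 e30; pose m' := maxn m0 M.
  have wsumB i j : wsum c (taylor_coef (u i - u j)) n =
      wsum c (fun k => taylor_coef (u i) k - taylor_coef (u j) k) n.
    by apply: eq_bigr => k _; rewrite Fp_coefB.
  have s1 := le_trans (wsum_le (u m - u m0) n c0) (h0 m mm).
  have s2 := le_trans (wsum_le (u m' - u m0) n c0) (h0 m' (leq_maxl _ _)).
  have s3 := hM m' (leq_maxr _ _).
  rewrite !wsumB in s1 s2.
  apply: le_trans (tri c _ (taylor_coef (u m0)) _ n) _.
  apply: le_trans (lerD s1 (tri c _ (taylor_coef (u m')) _ n)) _.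
  have s2' : wsum c (fun k => taylor_coef (u m0) k - taylor_coef (u m') k) n <= e / 3.
    by apply: le_trans s2; apply: ler_sum => k _; rewrite modulusBC.
  move: s2' s3; move: (wsum c _ n) (wsum c _ n) => x y; lra.
have adma : adm p a.
  move=> c c0; have [m0 h] := close c 1 c0 ltr01.
  have [B hB] := Fp_coef_adm (u m0) c0; exists (B + 1) => n.
  apply: le_trans (lerD (hB n) (h m0 (leqnn _) n)); rewrite /wsum -big_split.
  apply: ler_sum => k _ /=; rewrite -mulrDl ler_wpM2r ?wt_ge0//.
  have := modulusB_le (taylor_coef (u m0) k) (taylor_coef (u m0) k - a k).
  by rewrite opprB addrCA subrr addr0.
have [v [vc _]] := Fp_of_coef p_gt1 adma; exists v => c e c0 e0.
have [m0 h] := close c e c0 e0; exists m0 => m mm; apply: wnorm_le => n.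
apply: le_trans (h m mm n); apply: ler_sum => k _.
by rewrite Fp_coefB vc.
Qed.

Lemma coef_seminormE c f : 0 < c -> coef_seminorm p c f = (wnorm c f)%:E.
Proof.
move=> c0; rewrite /coef_seminorm.
pose v n := (modulus (taylor_coef f n) * wt p c n)%:E.
have v0 n : (0 <= n)%N -> true -> (0 <= v n)%E by move=> _ _; rewrite lee_fin mterm_ge0.
have vE n : (\sum_(0 <= k < n) v k)%E = (wsum c (taylor_coef f) n)%:E.
  by rewrite big_mkord sumEFin.
apply/eqP; rewrite eq_le; apply/andP; split.
  apply: lime_le; first exact: (is_cvg_nneseries v0).
  by apply: nearW => n; rewrite -/v vE lee_fin wsum_le.
have fin : (\sum_(0 <= n <oo) v n)%E \is a fin_num.
  rewrite ge0_fin_numE; last exact: nneseries_ge0.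
  apply: (@le_lt_trans _ _ (wnorm c f)%:E); last exact: ltry.
  apply: lime_le; first exact: (is_cvg_nneseries v0).
  by apply: nearW => n; rewrite vE lee_fin wsum_le.
rewrite -/v -(fineK fin) lee_fin; apply: wnorm_le => n.
rewrite -lee_fin (fineK fin) -vE; exact: nneseries_lim_ge.
Qed.

Lemma Fp_eval_le c f (r : R) (z : disk R) : 0 < c -> modulus (val z) <= r -> r < 1 ->
  modulus (f z) <= eval_const p c r * wnorm c f.
Proof.
move=> c0 zr r1; rewrite Fp_valE; apply: ps_eval_le => //; first exact: Fp_radius.
by move=> n; exact: wsum_le.
Qed.

End Fp_norm.

(** * Resolvent of z and division by z - l in F^p *)

Section Fp_elements.
Variables (R : realType) (p : R) (p_gt1 : 1 < p).
Local Notation C := (Cplx R).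
Local Notation A := (Fp p_gt1).
Implicit Types (f g : A) (c : R).

Let p_gt0 : 0 < p. Proof. exact: lt_trans p_gt1. Qed.

Lemma Fp_set_val : Fp_set p (fun z : disk R => val z).
Proof.
have hol : holomorphic (fun z : disk R => val z : C).
  move=> z zD; apply: (@near_eq_derivable _ _ _ id) => //.
  apply: filterS (open_disk zD) => w /mem_set wD.
  exact/esym/(extE (fun z : disk R => val z : C) (exist _ w wD)).
split=> //; apply: growth_squeeze (cvg_powR_left1 0 p_gt0).
apply: filterS (near_left1 R) => r r01; rewrite logp_ge0 /=.
have -> : 0 = logp 1 :> R by rewrite /logp ln1 maxxx.
apply: le_logp; apply: M_infty_le => // z zr; exact/ltW/diskP.
Qed.

Definition zed : A := MkFp (mem_set Fp_set_val : _ \in Fp_pred p_gt1).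

Lemma zedE z : zed z = val z. Proof. by []. Qed.

Lemma algE (l : C) (z : disk R) : (l%:A : A) z = l.
Proof. by rewrite FpZE Fp1E mulr1. Qed.

(** The inverse has coefficients -1 / l^(n+1), bounded by 1 even on the circle |l| = 1, hence
    admissible. For |l| > 1 dropping the weights leaves a geometric series, whence a bound common to
    all c. *)
Lemma resolvent_zed (l : C) : 1 <= modulus l ->
  exists2 r : A, (zed - l%:A) * r = 1 &
    1 < modulus l -> forall c, 0 < c -> wnorm c r <= (modulus l - 1)^-1.
Proof.
move=> l1; have l0 : 0 < modulus l by rewrite (lt_le_trans ltr01).
have lN0 : l != 0 by rewrite -modulus_gt0.
pose b n : C := - l^-1 ^+ n.+1.
have bm n : modulus (b n) = (modulus l)^-1 ^+ n.+1 by rewrite modulusN modulusX modulusV.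
have q0 : 0 <= (modulus l)^-1 by rewrite invr_ge0 ltW.
have q1 : (modulus l)^-1 <= 1 by rewrite invf_le1.
have admb : adm p b.
  move=> c c0; have [K hK] := wt_sum_bounded p_gt1 c0; exists K => n.
  apply: le_trans (hK n); apply: ler_sum => k _.
  by rewrite bm ler_piMl ?wt_ge0// exprn_ile1.
have [r [rc rz]] := Fp_of_coef p_gt1 admb; exists r.
  apply: Fp_ext => z; rewrite FpME FpBE zedE algE rz Fp1E.
  have z1 := diskP z; have hb := adm_radius p_gt1 admb.
  have e : ps b (val z) = - l^-1 + val z * (l^-1 * ps b (val z)).
    rewrite {1}(ps_shift hb z1) -(psZ l^-1 hb z1) /b expr1; congr (_ + _ * _).
    by apply: eq_ps => n; rewrite /shift mulrN -exprS.
  have : l * ps b (val z) = -1 + val z * ps b (val z).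
    by rewrite {1}e; field.
  by rewrite mulrBl => ->; rewrite opprD opprK addrCA subrr addr0.
move=> l1' c c0; apply: wnorm_le => n.
apply: (@le_trans _ _ (\sum_(k < n) (modulus l)^-1 ^+ k.+1)).
  by apply: ler_sum => k _; rewrite rc bm ler_piMr ?exprn_ge0// wt_le1.
have l10 : 0 < modulus l - 1 by rewrite subr_gt0.
have e m : \sum_(k < m) (modulus l)^-1 ^+ k.+1 = (1 - (modulus l)^-1 ^+ m) / (modulus l - 1).
  elim: m => [|m IH]; first by rewrite big_ord0 expr0 subrr mul0r.
  rewrite big_ord_recr /= IH exprS; move: ((modulus l)^-1 ^+ m) => y.
  by field; rewrite !gt_eqF.
by rewrite e -[leRHS]mul1r ler_wpM2r ?invr_ge0 ?(ltW l10)// gerBl exprn_ge0.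
Qed.

Lemma radius_ge1_shiftn (a : nat -> C) n : radius_ge1 a -> radius_ge1 (fun k => a (n + k)%N).
Proof.
move=> ha; elim: n => [//|n IH].
have -> : (fun k => a (n.+1 + k)%N) = shift (fun k => a (n + k)%N).
  by apply/funext => k; rewrite /shift addSnnS.
exact: radius_ge1_shift.
Qed.

Lemma wt_add c c' n : wt p (c + c') n = wt p c n * wt p c' n.
Proof. by rewrite /wt -expRD mulrDl opprD. Qed.

(** These are the coefficients of (f - f(l)) / (z - l). Splitting the weight at n + 1 + k between n
    + 1 and k makes the sum over k converge against |l|^k. *)
Lemma adm_quotient f (l : C) : modulus l < 1 ->
  adm p (fun n => ps (fun k => taylor_coef f (n.+1 + k)%N) l).
Proof.
(* Splitting n + 1 + k and then n + 1 doubles the index twice, up to 4 d; another 4 d is kept for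
   summing over n. *)
move=> l1 c c0; pose d := c / 8.
have d0 : 0 < d by rewrite divr_gt0.
have d20 : 0 < 2 * d by rewrite mulr_gt0.
have d40 : 0 < 2 * (2 * d) by rewrite mulr_gt0.
have [K hK] := Fp_coef_growth f d0.
have K0 : 0 <= K by apply: le_trans (hK 0%N); exact: mterm_ge0.
have [W hW] := wt_sum_bounded p_gt1 d20.
have [W' hW'] := wt_sum_bounded p_gt1 d40.
have W0 : 0 <= W by have := hW 0%N; rewrite big_ord0.
pose E := eval_const p (2 * (2 * d)) (modulus l).
have E0 : 0 <= E by exact: eval_const_ge0.
have l01 : 0 <= modulus l < 1 by rewrite modulus_ge0.
have hb n : modulus (ps (fun k => taylor_coef f (n.+1 + k)%N) l) <=
    K * E * W / (wt p (2 * d) n.+1).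
  apply: ps_le => //; first exact: radius_ge1_shiftn (Fp_radius f).
  move=> m; rewrite ler_pdivlMr ?wt_gt0// mulr_suml.
  apply: le_trans (ler_wpM2l (mulr_ge0 K0 E0) (hW m)); rewrite mulr_sumr.
  apply: ler_sum => j _.
  have h1 := hK (n.+1 + j)%N.
  have h2 := wt_mul p_gt1 n.+1 j d0.
  have h3 := expr_le_wt p_gt1 j d40 l01; rewrite -/E in h3.
  have h4 : wt p (2 * (2 * d)) j = wt p (2 * d) j * wt p (2 * d) j.
    by rewrite -wt_add (mulr_natl (2 * d) 2) mulr2n.
  rewrite h4 in h3.
  apply: (@le_trans _ _ ((modulus (taylor_coef f (n.+1 + j)) *
     (wt p (2 * d) n.+1 * wt p (2 * d) j)) * (E * wt p (2 * d) j))).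
    rewrite -!mulrA ler_wpM2l ?modulus_ge0// mulrC ler_wpM2l ?wt_ge0//.
    by apply: le_trans h3 _; rewrite mulrCA.
  rewrite -[leRHS]mulrA; apply: ler_wpM2r; first by rewrite mulr_ge0 ?wt_ge0.
  by apply: le_trans h1; rewrite ler_wpM2l ?modulus_ge0.
exists (K * E * W / wt p (2 * (2 * d)) 1 * W') => n.
have T0 : 0 <= K * E * W / wt p (2 * (2 * d)) 1.
  by rewrite divr_ge0 ?wt_ge0// mulr_ge0// mulr_ge0.
apply: le_trans (ler_wpM2l T0 (hW' n)); rewrite mulr_sumr; apply: ler_sum => k _.
apply: le_trans (ler_wpM2r (wt_ge0 _ _ _) (hb k)) _.
rewrite -!mulrA; do 3 (rewrite ler_wpM2l//).
have h := wt_mul p_gt1 1 k d20; rewrite add1n in h.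
have -> : wt p c k = wt p (2 * (2 * d)) k * wt p (2 * (2 * d)) k.
  have cE : c = 2 * (2 * d) + 2 * (2 * d) by rewrite /d; field.
  by rewrite {1}cE wt_add.
rewrite [leLHS]mulrA; apply: ler_wpM2r; first exact: wt_ge0.
rewrite [leLHS]mulrC ler_pdivrMr ?wt_gt0// [leRHS]mulrC ler_pdivlMr ?wt_gt0//.
by rewrite [leLHS]mulrC.
Qed.

(** The recursion b_n = a_(n+1) + l b_(n+1), with f(l) = a_0 + l b_0, is the coefficientwise form of
    the factorisation. *)
Lemma Fp_division f (l : disk R) : exists g, f - (f l)%:A = (zed - (val l)%:A) * g.
Proof.
have l1 := diskP l; have ha := Fp_radius f.
set a := taylor_coef f in ha.
pose b n := ps (fun k => a (n.+1 + k)%N) (val l).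
have admb : adm p b by exact: adm_quotient.
have hb := adm_radius p_gt1 admb.
have [g [_ gz]] := Fp_of_coef p_gt1 admb; exists g; apply: Fp_ext => z.
have z1 := diskP z.
rewrite FpME !FpBE zedE !algE gz !Fp_valE -/a.
have bE n : b n = shift a n + val l * shift b n.
  rewrite /b (ps_shift (radius_ge1_shiftn n.+1 ha) l1) addn0; congr (_ + _ * _).
  by rewrite /shift; apply: eq_ps => k; rewrite [in RHS]addSnnS.
have h1 : ps b (val z) = ps (shift a) (val z) + val l * ps (shift b) (val z).
  rewrite -(psZ _ (radius_ge1_shift hb) z1) -psD//; last 2 first.
  - exact: radius_ge1_shift.
  - exact: radius_ge1Z (radius_ge1_shift hb).
  exact: eq_ps.
have h2 := ps_shift ha z1; have h3 := ps_shift hb z1; have h4 := ps_shift ha l1.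
have h5 : b 0%N = ps (shift a) (val l) by apply: eq_ps.
rewrite mulrBl {1}h1 {1}h2 h4 -h5 h3.
by ring.
Qed.

Variables (M : idealr A).

Lemma Fp_root_disk (l : C) : zed - l%:A \in M -> modulus l < 1.
Proof.
move=> hM; rewrite ltNge; apply/negP => /resolvent_zed[r hr _].
by have := idealMr r hM; rewrite mulrC hr idealr1.
Qed.

Lemma Fp_ideal_of_root (l : disk R) : zed - (val l)%:A \in M ->
  [set f | f \in M] = [set f : A | f l = 0].
Proof.
move=> hM; apply/seteqP; split=> f /=.
  move=> fM; have [g fg] := Fp_division f l; apply/eqP/negPn/negP => fl.
  have : (f l)%:A \in M.
    rewrite -[X in X \in M](subKr f) rpredB// fg mulrC; exact: idealMr.
  move=> /(idealMr ((f l)^-1)%:A); rewrite -scalerAl mul1r scalerA mulVf// scale1r.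
  by rewrite idealr1.
move=> fl; have [g] := Fp_division f l; rewrite fl scale0r subr0 => ->.
by rewrite mulrC; exact: idealMr.
Qed.

End Fp_elements.

(** * Comparison of the topologies *)

Section seminorm_closed.
Variables (R : realType) (V : zmodType) (I : choiceType) (N : I -> V -> \bar R).

Lemma seminorm_closedP (D : set V) :
  @closed (seminorm_topology N) D <-> seminorm_open (N := N) (~` D).
Proof.
by split=> [/(@closed_openC (seminorm_topology N))|/(@open_closedC (seminorm_topology N))];
  rewrite ?setCK.
Qed.

End seminorm_closed.

Section Fp_topologies.
Variables (R : realType) (p : R) (p_gt1 : 1 < p).
Local Notation C := (Cplx R).
Local Notation A := (Fp p_gt1).
Implicit Types (f g : A) (D : set A).

Let p_gt0 : 0 < p. Proof. exact: lt_trans p_gt1. Qed.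

(** N_c grows as c decreases, so the least index of a finite family dominates the family. *)
Lemma coef_closedP D : @closed (Fp_coef_topology p_gt1) D <->
  forall f, ~ D f -> exists c e, [/\ 0 < c, 0 < e & forall g, D g -> e <= wnorm c (g - f)].
Proof.
split=> [/seminorm_closedP oD f Df|h].
  have [s [e [e0 hs]]] := oD f Df.
  have [c c0 hc] : exists2 c, 0 < c & forall i : {posnum R}, i \in s -> c <= i%:num.
    elim: (s) => [|i t [c c0 hc]]; first by exists 1.
    exists (Num.min c i%:num) => [|j]; first by rewrite lt_min c0 /=.
    rewrite in_cons => /orP[/eqP->|/hc]; first by rewrite ge_min lexx orbT.
    by rewrite ge_min => ->.
  exists c, e; split=> // g Dg; rewrite leNgt; apply/negP => gf.
  apply: (hs g) => // i /hc ci; rewrite coef_seminormE// lte_fin.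
  exact: le_lt_trans (wnorm_anti _ c0 ci) gf.
apply/seminorm_closedP => f Df; have [c [e [c0 e0 hD]]] := h f Df.
exists [:: PosNum c0], e; split=> // g hg Dg.
have := hg (PosNum c0); rewrite inE eqxx => /(_ isT).
by rewrite coef_seminormE// lte_fin ltNge hD.
Qed.

Lemma compact_disk_bound (K : set (disk R)) : compact K ->
  exists2 r : R, 0 <= r < 1 & forall z, K z -> modulus (val z) <= r.
Proof.
move=> cK.
have h : \forall r \near (1 : R)^'-, K `<=` [set z | modulus (val z) <= r].
  apply: (proj1 (compact_near_coveringP _) cK R ((1 : R)^'-)
    (fun r z => modulus (val z) <= r)) => z _.
  have z1 := diskP z; pose r0 := (1 + modulus (val z)) / 2.
  have zr : modulus (val z) < r0 by rewrite /r0; lra.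
  have r1 : r0 < 1 by rewrite /r0; lra.
  exists ([set z' : disk R | modulus (val z') < r0], [set r | r0 <= r]) => /=; last first.
    by move=> [z' r] /= [h1 h2]; exact: le_trans (ltW h1) h2.
  split; last exact: nbhs_left_ge.
  have cv : continuous (modulus \o (@set_val _ (disk R))).
    move=> x; apply: continuous_comp; first exact: initial_continuous.
    exact: continuous_modulus.
  have : open ((modulus \o (@set_val _ (disk R))) @^-1` [set x | x < r0]).
    by apply: open_comp => [x _|]; [exact: cv|exact: open_lt].
  rewrite openE => /(_ z); apply; rewrite /= set_valE; exact: zr.
have [r [hr r01]] := filter_ex (filterI h (near_left1 R)).
by exists r.
Qed.

(** The index 1 dominates evaluation on every disk |z| <= r < 1. If D met every N_1-ball around f,
    the filter of these balls, which converges to f on compact subsets, would meet D inside the open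
    complement. *)
Lemma compact_closed_coef_closed D : @closed (Fp_compact_topology p_gt1) D ->
  @closed (Fp_coef_topology p_gt1) D.
Proof.
move=> /(@closed_openC (Fp_compact_topology p_gt1)) [U oU UD].
apply/coef_closedP => f Df; apply: contrapT => hn.
have hN e : 0 < e -> exists2 g, D g & wnorm 1 (g - f) < e.
  move=> e0; apply: contrapT => /forall2NP hg; apply: hn; exists 1, e; split=> // g Dg.
  by have [//|/negP] := hg g; rewrite -leNgt.
pose G : set_system (disk R -> C) := filter_from [set e : R | 0 < e]
  (fun e => [set h : disk R -> C | exists2 g : A, wnorm 1 (g - f) < e & h = Fp_fun g]).
have FG : Filter G.
  apply: filter_from_filter; first by exists 1 => /=.
  move=> e1 e2 /= e10 e20; exists (Num.min e1 e2); first by rewrite /= lt_min e10.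
  move=> h [g gm hg]; split.
    by exists g; [apply: lt_le_trans gm _; rewrite ge_min lexx|exact: hg].
  by exists g; [apply: lt_le_trans gm _; rewrite ge_min lexx orbT|exact: hg].
have Gf : {family compact, G --> (Fp_fun f)}.
  apply/fam_cvgP => K cK P /uniform_nbhs[E [entE EP]].
  move: entE; rewrite -entourage_from_ballE => -[e /= e0 eE].
  have ee : e = (complex.Re e)%:C%C by case: (e) e0 => a b /[!ltcE]/= /andP[/eqP->].
  have er0 : 0 < complex.Re e by rewrite -ltcR -ee.
  have [r /andP[r0 r1] hr] := compact_disk_bound cK.
  have k0 : 0 < eval_const p 1 r by exact: expR_gt0.
  exists (complex.Re e / eval_const p 1 r) => /=; first by rewrite divr_gt0.
  move=> h [g gf ->]; apply: EP => z Kz; apply: eE; rewrite /ball /= ee distrC modulusE ltcR.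
  have := Fp_eval_le (g - f) ltr01 (hr z Kz) r1; rewrite FpBE => /le_lt_trans; apply.
  by rewrite mulrC -ltr_pdivlMr.
have Uf : U (Fp_fun f).
  by have : (~` D) f by []; rewrite -UD.
have /Gf[e /= e0 he] : nbhs (Fp_fun f : {family compact, disk R -> C}) U.
  exact: open_nbhs_nbhs.
have [g Dg gf] := hN e e0.
have : U (Fp_fun g) by apply: he; exists g.
by rewrite -[U _]/((@Fp_fun R p p_gt1 @^-1` U) g) UD.
Qed.

Lemma eval_compact_closed (l : disk R) :
  @closed (Fp_compact_topology p_gt1) [set f : A | f l = 0].
Proof.
have cl : closed [set h : {family compact, disk R -> C} | h l = 0].
  rewrite -openC openE => h hl.
  have hl0 : 0 < modulus (h l) by rewrite modulus_gt0; apply/eqP.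
  pose E : set (C * C) := [set xy | ball xy.1 (modulus (h l))%:C%C xy.2].
  have entE : entourage E.
    by rewrite -entourage_from_ballE; exists (modulus (h l))%:C%C => //=; rewrite ltcR.
  apply: filterS (@fam_nbhs _ _ compact [set l] E h entE (@compact_set1 _ l)) => g hg gl.
  have := hg l erefl; rewrite /E /ball /= gl subr0 modulusE ltxx; exact: notF.
have := @closed_comp (Fp_compact_topology p_gt1) {family compact, disk R -> C} (@Fp_fun R p p_gt1) _ _ cl.
apply => f _; exact: initial_continuous.
Qed.

End Fp_topologies.

(** The integral of a nonnegative function is a supremum over simple functions below it, hence
    monotone without measurability; [M_mean] can thus be integrated in r as it stands. *)
Lemma integral_le_pointwise (d : measure_display) (T : measurableType d) (R : realType)
    (mu : {measure set T -> \bar R}) (D : set T) (f g : T -> \bar R) :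
  (forall x, D x -> (0 <= f x)%E) -> (forall x, D x -> (f x <= g x)%E) ->
  (\int[mu]_(x in D) f x <= \int[mu]_(x in D) g x)%E.
Proof.
move=> f0 fg; have g0 x : D x -> (0 <= g x)%E by move=> Dx; exact: le_trans (f0 x Dx) (fg x Dx).
rewrite (ge0_integralE mu f0) (ge0_integralE mu g0); apply: ereal_sup_le => _ [k kf <-].
exists k => // x; apply: le_trans (kf x) _; rewrite !patchE.
by case: ifPn => // /set_mem; exact: fg.
Qed.

(** * The mean seminorms *)

Section mean_seminorm.
Variables (R : realType) (p : R) (p_gt1 : 1 < p).
Local Notation C := (Cplx R).
Local Notation A := (Fp p_gt1).
Local Notation mu := (@lebesgue_measure R).
Implicit Types (f h : A) (c r s t : R).

Let p_gt0 : 0 < p. Proof. exact: lt_trans p_gt1. Qed.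

Lemma two_pi_gt0 : 0 < 2 * pi :> R.
Proof. by rewrite mulr_gt0 ?pi_gt0. Qed.

Lemma M_mean_ge0 f r : (0 <= M_mean p f r)%E.
Proof. exact: poweR_ge0. Qed.

Lemma M_mean_le f r (B : R) : 0 <= B ->
  (forall t, modulus (ext f (circ r t)) <= B) -> (M_mean p f r <= B%:E)%E.
Proof.
move=> B0 hB; have t0 := two_pi_gt0.
have -> : B%:E = (((B `^ p) `^ p^-1)%:E)%E.
  by rewrite -powRrM mulfV ?gt_eqF// powRr1.
rewrite -poweR_EFin; apply: gt0_ler_poweR.
- by rewrite invr_ge0 ltW.
- rewrite in_itv /= leey andbT; apply: mule_ge0; first by rewrite lee_fin invr_ge0 ltW.
  by apply: integral_ge0 => t _; rewrite lee_fin powR_ge0.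
- by rewrite in_itv /= leey andbT lee_fin powR_ge0.
have -> : ((B `^ p)%:E = (2 * pi)^-1%:E * ((B `^ p)%:E * (2 * pi)%:E))%E.
  by rewrite -!EFinM mulrCA mulVf ?mulr1// gt_eqF.
apply: lee_wpmul2l; first by rewrite lee_fin invr_ge0 ltW.
have <- : (mu `[0%R, (2 * pi)%R] = (2 * pi)%:E)%E.
  by rewrite lebesgue_measure_itv /= lte_fin t0 oppr0 adde0.
rewrite -integral_cst//; apply: integral_le_pointwise => t _.
  by rewrite lee_fin powR_ge0.
rewrite lee_fin ge0_ler_powR ?nnegrE ?modulus_ge0 ?(ltW p_gt0)//.
exact: hB.
Qed.

(** For c <= 1 one has c^(1 + 1/p) <= c <= c', so the radial weight absorbs the evaluation constant;
    hence the minimum with 1 in [mean_le_coef]. *)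
Lemma eval_const_weight c r : 0 < c -> c <= 1 -> r < 1 -> forall c', c <= c' ->
  expR (- (c' * (1 - r) `^ (- p^-1))) * eval_const p c r <= 1.
Proof.
move=> c0 c1 r1 c' cc'; have r10 : 0 < 1 - r by rewrite subr_gt0.
rewrite -expRD expR_le1 addrC subr_le0 powRM ?invr_ge0 ?(ltW c0) ?(ltW r10)//.
rewrite -[(1 - r)^-1]powR_inv1 ?(ltW r10)// -powRrM mulN1r mulrA.
apply: ler_wpM2r; first exact: powR_ge0.
apply: le_trans cc'; rewrite ler_piMr ?(ltW c0)//.
by rewrite -[leRHS](one_powR p^-1) ge0_ler_powR ?nnegrE ?invr_ge0 ?(ltW p_gt0) ?(ltW c0).
Qed.

Lemma mean_le_coef c f : 0 < c ->
  (mean_seminorm p c f <= (wnorm (Num.min c 1) f)%:E)%E.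
Proof.
move=> c0; set c1 := Num.min c 1.
have c10 : 0 < c1 by rewrite lt_min c0 ltr01.
have c1c : c1 <= c by rewrite ge_min lexx.
have c11 : c1 <= 1 by rewrite ge_min lexx orbT.
have N0 := wnorm_ge0 f c10.
have -> : ((wnorm c1 f)%:E = \int[mu]_(r in `[0%R, 1%R[) (cst (wnorm c1 f)%:E r))%E.
  by rewrite integral_cst//= lebesgue_measure_itv /= lte_fin ltr01 oppr0 adde0 mule1.
apply: integral_le_pointwise => r.
  by move=> _; rewrite mule_ge0 ?M_mean_ge0// lee_fin expR_ge0.
rewrite /= in_itv /= => /andP[r0 r1].
have E0 := eval_const_ge0 p c1 r.
have hM : (M_mean p f r <= (eval_const p c1 r * wnorm c1 f)%:E)%E.
  apply: M_mean_le => [|t]; first exact: mulr_ge0.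
  have zr : modulus (circ r t) <= r by rewrite modulus_circ.
  rewrite (Fp_ext_ps f (le_lt_trans zr r1)); apply: (ps_eval_le p_gt1 (Fp_radius f) c10 _ zr r1).
  by move=> n; exact: wsum_le.
apply: le_trans (lee_wpmul2l _ hM) _; first by rewrite lee_fin expR_ge0.
rewrite -EFinM lee_fin mulrA ler_piMl//; exact: eval_const_weight.
Qed.

Lemma mean_closed_coef_closed (D : set A) : @closed (Fp_mean_topology p_gt1) D ->
  @closed (Fp_coef_topology p_gt1) D.
Proof.
move=> /seminorm_closedP oD; apply/seminorm_closedP => f Df.
have [s [e [e0 hs]]] := oD f Df.
have m0 (c : {posnum R}) : 0 < Num.min c%:num 1 by rewrite lt_min ltr01 andbT.
exists [seq PosNum (m0 c) | c : {posnum R} <- s], e; split=> // g hg; apply: hs => c cs.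
have := hg (PosNum (m0 c)) (map_f (fun c : {posnum R} => PosNum (m0 c)) cs); rewrite coef_seminormE//.
apply: le_lt_trans; exact: mean_le_coef.
Qed.

Section circle_lower_bound.
Variables (h : A) (l : C) (s : R).
Hypotheses (ls : modulus l < s) (s1 : s < 1).
Let s0 : 0 < s. Proof. exact: le_lt_trans (modulus_ge0 l) ls. Qed.
Let s01 : 0 < s < 1. Proof. by rewrite s0. Qed.
Let u t := modulus (ext h (circ s t)).

Let cu : continuous u.
Proof.
have cF : continuous (fun t => ext h (circ s t)).
  exact: (@continuous_circle R (ext h) s (pcont_ext (@Fp_holomorphic _ _ _ h)) s01).
move=> t; apply: (@continuous_comp _ _ _ (fun t => ext h (circ s t)) (@modulus R)).
  exact: cF.
exact: continuous_modulus.
Qed.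

(** Cauchy's estimate with the integral mean over the circle in place of the supremum. *)
Lemma tcoef_circle_mean n : modulus (tcoef h n) * s ^+ n <= 2 * Rint 0 (pi *+ 2) u / (pi *+ 2).
Proof.
have hh := @Fp_holomorphic _ _ _ h.
have t0 : 0 < pi *+ 2 :> R by rewrite mulrn_wgt0 ?pi_gt0.
have sn0 : 0 < s ^+ n by rewrite exprn_gt0.
rewrite (tcoefE hh n s01) /cauchy_coef modulusM modulusV modulus_real (gtr0_norm t0).
rewrite mulrAC; apply: ler_wpM2r; first by rewrite invr_ge0 ltW.
rewrite -ler_pdivlMr// cmeanE.
have cq := @continuous_circle R _ s (@punctured_quot R h hh n) s01.
have cv : continuous (fun t => s ^- n * u t) by move=> t; apply: cvgMr; exact: cu.
apply: le_trans (@cint_modulus_le R 0 (pi *+ 2) _ (fun t => s ^- n * u t) cq cv _) _.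
  move=> t _; rewrite modulusM modulusV modulusX modulus_circ ?(ltW s0)//.
  by rewrite [leRHS]mulrC.
by rewrite (@RintZ R 0 (pi *+ 2) (s ^- n) u cu) [s ^- n * _]mulrC mulrA.
Qed.

(** Summing the coefficient estimates gives a geometric series of ratio |l| / s; the remaining
    factor s <= 1 is dropped. *)
Lemma modulus_le_circle_mean : modulus l < 1 ->
  modulus (ext h l) * (s - modulus l) * (pi *+ 2) <= 2 * Rint 0 (pi *+ 2) u.
Proof.
move=> l1; have hh := @Fp_holomorphic _ _ _ h.
have t0 : 0 < pi *+ 2 :> R by rewrite mulrn_wgt0 ?pi_gt0.
have d0 : 0 < s - modulus l by rewrite subr_gt0.
set m := 2 * Rint 0 (pi *+ 2) u / (pi *+ 2).
have m0 : 0 <= m.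
  by apply: le_trans (tcoef_circle_mean 0); rewrite expr0 mulr1 modulus_ge0.
suff : modulus (ext h l) <= m / (s - modulus l).
  by rewrite ler_pdivlMr// /m ler_pdivlMr.
rewrite (ext_ps hh l1); apply: ps_le => //; first exact: radius_ge1_tcoef.
move=> n; set q := modulus l / s.
have q0 : 0 <= q by rewrite divr_ge0 ?modulus_ge0// ltW.
have q1 : q < 1 by rewrite ltr_pdivrMr// mul1r.
apply: (@le_trans _ _ (\sum_(k < n) m * q ^+ k)).
  apply: ler_sum => k _; have := tcoef_circle_mean k; rewrite -/m => hk.
  apply: le_trans (ler_wpM2r (exprn_ge0 k q0) hk).
  rewrite -mulrA -exprMn /q mulrC [s * _]mulrC divfK ?gt_eqF// mulrC.
  exact: lexx.
rewrite -mulr_sumr; apply: ler_wpM2l => //.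
have e k : (\sum_(i < k) q ^+ i) * (1 - q) = 1 - q ^+ k.
  elim: k => [|k IH]; first by rewrite big_ord0 expr0 subrr mul0r.
  by rewrite big_ord_recr /= mulrDl IH exprS; ring.
have dq : s - modulus l = s * (1 - q) by rewrite mulrBr mulr1 /q mulrC divfK// gt_eqF.
rewrite -[leRHS]mul1r ler_pdivlMr// dq mulrCA e; apply: mulr_ile1; rewrite ?(ltW s0) ?(ltW s1)//.
  by rewrite subr_ge0 exprn_ile1// ltW.
by rewrite gerBl exprn_ge0.
Qed.

(* [x ^ p] lies above the truncated line [max (eta ^ (p - 1) * (x - eta)) 0]. *)
Lemma circle_mean_le_M_mean (eta : R) : 0 < eta ->
  2 * eta * (pi *+ 2) <= Rint 0 (pi *+ 2) u -> (eta%:E <= M_mean p h s)%E.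
Proof.
move=> e0 hI; have t0 : 0 < pi *+ 2 :> R by rewrite mulrn_wgt0 ?pi_gt0.
(* The positive part [v] keeps the minorant nonnegative; through [Num.min] it inherits continuity
   from [continuous_min_cst]. *)
pose k := eta `^ (p - 1); have k0 : 0 < k by exact: powR_gt0.
pose w t := k * (u t - eta); pose v t := - Num.min (- w t) 0.
have pw x : 0 <= x -> k * (x - eta) <= x `^ p.
  move=> x0; have [xe|ex] := leP x eta.
    by apply: le_trans (powR_ge0 _ _); rewrite pmulr_rle0// subr_le0.
  have x0' := lt_trans e0 ex.
  have -> : x `^ p = x `^ (p - 1) * x.
    by rewrite -{3}[x]powRr1// -powRD ?(gt_eqF x0') ?implybT// subrK.
  apply: ler_pM; rewrite ?subr_ge0 ?(ltW k0) ?(ltW ex)//; last by rewrite gerBl ltW.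
  by rewrite ge0_ler_powR ?nnegrE ?subr_ge0 ?(ltW e0) ?(ltW ex) ?(ltW p_gt1) ?(ltW x0').
have cu1 : continuous (fun t => u t + - eta).
  by move=> t; apply: (@cvgD _ R^o); [exact: cu|exact: cvg_cst].
have cw : continuous w by move=> t; apply: (@cvgMr _ R); exact: cu1.
have cw' : continuous (fun t => - w t) by move=> t; apply: (@cvgN _ R^o); exact: cw.
have cv : continuous v.
  move=> t; apply: (@cvgN _ R^o).
  apply: (@continuous_comp _ _ _ (fun t => - w t) (fun x : R => Num.min x 0)).
    exact: cw'.
  exact: (@continuous_min_cst R 0).
(* The mean of u is at least 2 eta, so that of u - eta is at least eta, and k eta = eta^p. *)
have hJ : eta `^ p * (pi *+ 2) <= Rint 0 (pi *+ 2) v.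
  apply: (@le_trans _ _ (Rint 0 (pi *+ 2) w)); last first.
    by apply: (@le_Rint R 0 (pi *+ 2) w v cw cv) => t _; rewrite /v lerNr ge_min lexx.
  have cc : continuous (fun _ : R => - eta : R) by exact: cst_continuous.
  rewrite (@RintZ R 0 (pi *+ 2) k _ cu1) (@RintD R 0 (pi *+ 2) u _ cu cc).
  rewrite (@Rint_cst R 0 (pi *+ 2) (- eta) (ltW t0)) subr0.
  have -> : eta `^ p = k * eta.
    by rewrite /k -{3}[eta]powRr1 ?(ltW e0)// -powRD ?(gt_eqF e0) ?implybT// subrK.
  rewrite -mulrA ler_pM2l//; move: hI; move: (Rint _ _ _) => I hI.
  by move: (pi *+ 2) hI => x; lra.
have -> : eta%:E = (((eta `^ p) `^ p^-1)%:E)%E.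
  by rewrite -powRrM mulfV ?gt_eqF// powRr1// ltW.
rewrite -poweR_EFin /M_mean; apply: gt0_ler_poweR.
- by rewrite invr_ge0 ltW.
- by rewrite in_itv /= leey andbT lee_fin powR_ge0.
- rewrite in_itv /= leey andbT; apply: mule_ge0; first by rewrite lee_fin invr_ge0 (ltW two_pi_gt0).
  by apply: integral_ge0 => t _; rewrite lee_fin powR_ge0.
have -> : ((2 * pi : R) = pi *+ 2) by rewrite mulr_natl.
have -> : ((eta `^ p)%:E = (pi *+ 2)^-1%:E * (eta `^ p * (pi *+ 2))%:E)%E.
  by rewrite -EFinM mulrC mulfK// gt_eqF.
apply: lee_wpmul2l; first by rewrite lee_fin invr_ge0 ltW.
have Jfin : (\int[mu]_(t in `[0%R, (pi *+ 2)%R]) (EFin \o v) t)%E \is a fin_num.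
  by apply: integrable_fin_num; [exact: measurable_itv|exact: continuous_itv_integrable].
apply: (@le_trans _ _ (\int[mu]_(t in `[0%R, (pi *+ 2)%R]) (EFin \o v) t)%E).
  by rewrite -[leRHS](fineK Jfin) lee_fin; exact: hJ.
apply: integral_le_pointwise => t _; rewrite /= lee_fin /v.
  by rewrite oppr_ge0 ge_min lexx orbT.
rewrite lerNl le_min lerN2 oppr_le0 powR_ge0 andbT; exact: pw (modulus_ge0 _).
Qed.

End circle_lower_bound.

(** On radii in [s0, s1], away from both |l| and 1, the weight is bounded below by w and the circle
    mean by eta; the part of the integral over this interval suffices. *)
Lemma mean_seminorm_eval_lower (l : C) (v : R) : modulus l < 1 -> 0 < v ->
  exists2 e : R, 0 < e & forall h, v <= modulus (ext h l) -> (e%:E <= mean_seminorm p 1 h)%E.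
Proof.
move=> l1 v0; pose L := modulus l; pose s0 := (1 + L) / 2; pose s1 := (1 + s0) / 2.
have L0 : 0 <= L := modulus_ge0 l.
have Ls0 : L < s0 by rewrite /s0 /L; lra.
have s01 : s0 < s1 by rewrite /s1 /s0 /L; lra.
have s11 : s1 < 1 by rewrite /s1 /s0 /L; lra.
have s00 : 0 < s0 by rewrite (le_lt_trans L0).
have t0 : 0 < pi *+ 2 :> R by rewrite mulrn_wgt0 ?pi_gt0.
(* One factor 2 comes from [modulus_le_circle_mean], the other from the 2 eta required by
   [circle_mean_le_M_mean]. *)
pose eta := v * (s0 - L) / 4.
have eta0 : 0 < eta by rewrite divr_gt0// mulr_gt0// subr_gt0.
pose w := expR (- ((1 - s1) `^ (- p^-1))).
have w0 : 0 < w by exact: expR_gt0.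
exists (w * eta * (s1 - s0)); first by rewrite !mulr_gt0// subr_gt0.
move=> h hv.
have -> : ((w * eta * (s1 - s0))%:E =
    \int[mu]_(r in `[0%R, 1%R[) ((cst (w * eta)%:E) \_ `[s0, s1]) r)%E.
  rewrite -integral_mkcondr (_ : _ `&` _ = `[s0, s1]%classic); last first.
    apply/seteqP; split=> [r []//|r /= rs]; split=> //; move: rs.
    by rewrite /= !in_itv /= => /andP[h1 h2]; rewrite (le_trans (ltW s00) h1) (le_lt_trans h2 s11).
  by rewrite integral_cst//= lebesgue_measure_itv /= lte_fin s01 -EFinB -EFinM.
apply: integral_le_pointwise => r.
  by move=> _; rewrite patchE; case: ifP => // _; rewrite lee_fin mulr_ge0 ?(ltW w0) ?(ltW eta0).
rewrite /= in_itv /= => /andP[r0 r1]; rewrite patchE; case: ifPn; last first.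
  by move=> _; rewrite mule_ge0 ?M_mean_ge0// lee_fin expR_ge0.
move=> /set_mem; rewrite /= in_itv /= => /andP[sr rs].
rewrite EFinM; apply: lee_pmul; rewrite ?lee_fin ?(ltW w0) ?(ltW eta0)//.
  rewrite mul1r ler_expR lerN2 !powRN lef_pV2 ?posrE ?powR_gt0 ?subr_gt0//.
  rewrite ge0_ler_powR ?nnegrE ?invr_ge0 ?subr_ge0 ?(ltW p_gt0) ?(ltW s11) ?(ltW r1)//.
  by rewrite lerB.
have lr : modulus l < r by exact: lt_le_trans sr.
apply: (circle_mean_le_M_mean lr r1 eta0).
have := modulus_le_circle_mean h lr r1 l1.
set I := Rint _ _ _ => hI.
suff : v * (s0 - L) * (pi *+ 2) <= 2 * I.
  by rewrite /eta; clear hI; move: (pi *+ 2) I => x y; lra.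
apply: le_trans hI; apply: ler_wpM2r; first exact: ltW.
by apply: ler_pM; rewrite ?(ltW v0) ?subr_ge0 ?(ltW Ls0)// lerB.
Qed.

Lemma eval_mean_closed (l : disk R) :
  @closed (Fp_mean_topology p_gt1) [set f : A | f l = 0].
Proof.
apply/seminorm_closedP => f fl; have l1 := diskP l.
have v0 : 0 < modulus (f l) by rewrite modulus_gt0; apply/eqP.
have [e e0 he] := mean_seminorm_eval_lower l1 v0.
exists [:: 1%:pos], e; split=> // g hg gl.
have := hg 1%:pos (mem_head _ _); rewrite ltNge => /negP; apply.
by apply: he; rewrite extE FpBE gl sub0r modulusN.
Qed.

End mean_seminorm.

(** * Maximal ideals of F^p *)

Local Open Scope quotient_scope.

Section equivalences.
Variables (R : realType) (p : R) (p_gt1 : 1 < p).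
Local Notation C := (Cplx R).
Local Notation A := (Fp p_gt1).
Variables (M : idealr A).

Lemma coef_closed_root : maximal_ideal M ->
  @closed (Fp_coef_topology p_gt1) [set f | f \in M] ->
  exists l : C, zed p_gt1 - l%:A \in M.
Proof.
move=> maxM /coef_closedP clM.
apply: (@closed_maximal_ideal_root R A (@wnorm R p p_gt1)
  (fun c f => @wnorm_ge0 R p p_gt1 c f) (fun c f g => @wnormD R p p_gt1 c f g)
  (fun c k f => @wnormZ R p p_gt1 c k f) (fun c f g => @wnormM R p p_gt1 c f g)
  (fun c c' f => @wnorm_anti R p p_gt1 c c' f) (@wnorm_sep R p p_gt1)
  (@wnorm_complete R p p_gt1) M maxM _ (zed p_gt1)).
- by move=> f /negP /clM.
- move=> l l1; have [r h1 h2] := resolvent_zed p_gt1 (ltW l1).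
  by exists r => //; exact: h2.
Qed.

Lemma root_evaluation (l : C) : zed p_gt1 - l%:A \in M ->
  exists lambda : disk R, [set f | f \in M] = [set f : A | f lambda = 0].
Proof.
move=> hM; have lD : l \in disk R by rewrite inE; exact: Fp_root_disk hM.
by exists (exist _ l lD); exact: Fp_ideal_of_root.
Qed.

Section evaluation.
Variables (l : disk R) (Ml : [set f | f \in M] = [set f : A | f l = 0]).
Local Notation Q := {ideal_quot M}.

Let memM (f : A) : f \in M <-> f l = 0.
Proof.
have := congr1 (fun D : set A => D f) Ml => /= e.
by split=> h; [rewrite -e|rewrite e].
Qed.

(** Evaluation at l of a chosen representative; [quot_eval_pi] shows that the choice is
    immaterial. *)
Definition quot_eval (x : Q) : C := (repr x : A) l.

Lemma quot_eval_pi (f : A) : quot_eval (\pi_Q f) = f l.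
Proof.
have : \pi_Q (repr (\pi_Q f)) == \pi_Q f by rewrite reprK.
by rewrite -Quotient.idealrBE => /memM/eqP; rewrite FpBE subr_eq0 => /eqP.
Qed.

Lemma quot_eval_zmod : zmod_morphism quot_eval.
Proof.
move=> x y; rewrite -[x]reprK -[y]reprK.
by rewrite -rmorphB !quot_eval_pi.
Qed.

Lemma quot_eval_monoid : monoid_morphism quot_eval.
Proof.
split=> [|x y]; first by rewrite -(rmorph1 (\pi_Q)) quot_eval_pi.
by rewrite -[x]reprK -[y]reprK -rmorphM !quot_eval_pi.
Qed.

HB.instance Definition _ := GRing.isZmodMorphism.Build Q C quot_eval quot_eval_zmod.
HB.instance Definition _ := GRing.isMonoidMorphism.Build Q C quot_eval quot_eval_monoid.

Lemma evaluation_quotient : exists phi : {rmorphism Q -> C}, bijective phi /\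
  (forall (k : C) (f : A), phi (\pi_Q (k *: f)) = k * phi (\pi_Q f)).
Proof.
exists quot_eval; split; last by move=> k f /=; rewrite !quot_eval_pi.
exists (fun k => \pi_Q (k%:A)) => [x|k]; last by rewrite /= quot_eval_pi algE.
rewrite /= -[x]reprK quot_eval_pi; apply/eqP; rewrite -Quotient.idealrBE; apply/memM.
by rewrite FpBE algE subrr.
Qed.

End evaluation.

(** With l the image of the class of z, linearity gives phi(l) = l, so z - l is in the kernel; for a
    mere ring isomorphism l and phi(l) could differ by a field automorphism. *)
Lemma quotient_evaluation (phi : {rmorphism {ideal_quot M} -> C}) : bijective phi ->
  (forall (k : C) (f : A),
     phi (\pi_{ideal_quot M} (k *: f)) = k * phi (\pi_{ideal_quot M} f)) ->
  exists lambda : disk R, [set f | f \in M] = [set f : A | f lambda = 0].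
Proof.
move=> /bij_inj phiI phiZ; pose l := phi (\pi_{ideal_quot M} (zed p_gt1)).
apply: (@root_evaluation l); rewrite Quotient.idealrBE; apply/eqP/phiI.
by rewrite phiZ !rmorph1 mulr1.
Qed.

End equivalences.

Theorem theorem4 (R : realType) (p : R) (p_gt1 : 1 < p)
    (M : idealr (Fp p_gt1)) (maxM : maximal_ideal M) :
  [<-> @closed (Fp_compact_topology p_gt1) [set f | f \in M];
       exists phi : {rmorphism {ideal_quot M} -> Cplx R},
         bijective phi /\
         (forall (k : Cplx R) (f : Fp p_gt1),
            phi (\pi_{ideal_quot M} (k *: f)) = k * phi (\pi_{ideal_quot M} f));
       exists lambda : disk R,
         [set f | f \in M] = [set f : Fp p_gt1 | f lambda = 0];
       @closed (Fp_coef_topology p_gt1) [set f | f \in M];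
       @closed (Fp_mean_topology p_gt1) [set f | f \in M]].
Proof.
have coef_eval : @closed (Fp_coef_topology p_gt1) [set f | f \in M] ->
    exists lambda : disk R, [set f | f \in M] = [set f : Fp p_gt1 | f lambda = 0].
  by move=> /(coef_closed_root maxM)[l]; exact: root_evaluation.
tfae.
- by move=> /compact_closed_coef_closed/coef_eval[l]; exact: evaluation_quotient.
- by move=> [phi [bphi phiZ]]; exact: quotient_evaluation bphi phiZ.
- move=> [l Ml]; apply: compact_closed_coef_closed; rewrite Ml; exact: eval_compact_closed.
- move=> /coef_eval[l ->]; exact: eval_mean_closed.
- move=> /mean_closed_coef_closed/coef_eval[l ->]; exact: eval_compact_closed.
Qed.
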